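(* Let $H$ be a semisimple quasitriangular Hopf algebra over an algebraically closed field $k$ of characteristic $0$ containing $\mathbb R$ as a subfield (for instance $k=\mathbb C$). Let $z\in Z(H)$ be a central distribution element and let $T(z)=\{z,\Lambda\}$. Then $$\mathrm{Prob}(T^m(z)=1)\longrightarrow 1\quad\text{as}\quad m\to\infty .$$
   Context: Notation: $\Delta(h)=\sum h_1\otimes h_2$, $\varepsilon$, $S$ are the comultiplication, counit and antipode of $H$; $d=\dim H$; $Z(H)$ is the center of $H$; $\Lambda$ is the idempotent integral of $H$. The character algebra $R(H)\subseteq H^*$ is the span of the irreducible characters $\chi_0=\varepsilon,\dots,\chi_{n-1}$ of $H$; it is commutative (and semisimple) when $H$ is quasitriangular. Let $\lambda=\sum_i d_i\chi_i$ with $d_i=\langle\chi_i,1\rangle$, an integral of $H^*$ with $\langle\lambda,\Lambda\rangle=1$. For $h\in H$, $p\in H^*$, $h\leftharpoonup p=\sum\langle p,h_1\rangle h_2$. For $a,b\in H$, $\{a,b\}=\sum a_1b_1S(a_2)S(b_2)$; the map $z\mapsto\{z,\Lambda\}$ sends $Z(H)$ to $Z(H)$. Let $F_0=\frac1d\lambda,F_1,\dots,F_{n-1}$ be the primitive idempotents of $R(H)$. The conjugacy classes are $\mathfrak C_i=\Lambda\leftharpoonup F_iH^*$, the class sums are $C_i=\Lambda\leftharpoonup dF_i$, and the normalized class sums are $\eta_i=C_i/\dim\mathfrak C_i$. One has $\eta_0=1$, $\langle\varepsilon,\eta_i\rangle=1$, and $\{\eta_i\}$ is a basis of $Z(H)$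 dual to the basis $\{F_i\}$ of $R(H)$. An element $z\in Z(H)$ is a central distribution element if $z=\sum_i\alpha_i\eta_i$ with all $\alpha_i$ non-negative real numbers and $\sum_i\alpha_i=1$. It defines a distribution $X_z$ by $\mathrm{Prob}(X_z=C_i)=\alpha_i$; $\mathrm{Prob}(z=1)$ denotes $\mathrm{Prob}(X_z=C_0)=\alpha_0$, the coefficient of $\eta_0=1$ in $z$. When $H$ is quasitriangular, $T$ maps central distribution elements to central distribution elements. *)

(* Defs.v *)
From HB Require Import structures.
From mathcomp Require Import all_boot all_order all_algebra all_field.
From mathcomp Require Import all_classical all_reals all_analysis.
Import numFieldNormedType.Exports.

Set Implicit Arguments.
Unset Strict Implicit.
Unset Printing Implicit Defensive.

Import Order.TTheory GRing.Theory Num.Theory.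
Local Open Scope ring_scope.

Declare Scope hopf_scope.
Delimit Scope hopf_scope with hopf.
Local Open Scope hopf_scope.

Reserved Notation "u ⊗ v" (at level 40, left associativity).
Reserved Notation "p ∗ q" (at level 40, left associativity).
Reserved Notation "h ↼ p" (at level 40, left associativity).

(* U ⊗ V is realised by coordinate matrices with respect to the bases
   [vbasis] of U and V. Everything below goes through the pure tensors and
   the extension [tlift f] of a bilinear map f; [tliftE], [tensor_span] and
   [tlift_unique] are the universal property.
   The type is an alias because the product on U ⊗ V is not that of matrices. *)
Definition tensor (k : fieldType) (U V : vectType k) : Type :=
  'M[k]_(\dim (fullv : {vspace U}), \dim (fullv : {vspace V})).
HB.instance Definition _ (k : fieldType) (U V : vectType k) :=
  Vector.copy (tensor U V)
    'M[k]_(\dim (fullv : {vspace U}), \dim (fullv : {vspace V})).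

Definition tens (k : fieldType) (U V : vectType k) (u : U) (v : V) :
    tensor U V :=
  \matrix_(i, j) (coord (vbasis fullv) i u * coord (vbasis fullv) j v).

Notation "u ⊗ v" := (tens u v) : hopf_scope.

(* If t = Σ t₁ ⊗ t₂ then [tlift f t] = Σ f(t₁, t₂), for f bilinear. *)
Definition tlift (k : fieldType) (U V : vectType k) (W : lmodType k)
    (f : U -> V -> W) (t : tensor U V) : W :=
  \sum_i \sum_j fun_of_matrix t i j *: f (vbasis fullv)`_i (vbasis fullv)`_j.

Section TensorTheory.
Variables (k : fieldType) (U V : vectType k).

Lemma tlift_is_linear (W : lmodType k) (f : U -> V -> W) : linear (tlift f).
Proof.
move=> a s t; rewrite /tlift scaler_sumr -big_split; apply: eq_bigr => i _ /=.
rewrite scaler_sumr -big_split; apply: eq_bigr => j _ /=.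
by rewrite !mxE scalerDl scalerA.
Qed.
HB.instance Definition _ (W : lmodType k) (f : U -> V -> W) :=
  GRing.isLinear.Build k (tensor U V) W *:%R (tlift f) (tlift_is_linear f).

Definition is_bilinear (W : lmodType k) (f : U -> V -> W) : Prop :=
  (forall v, linear (f^~ v)) /\ (forall u, linear (f u)).

Lemma tens_bilinear : is_bilinear (@tens k U V).
Proof.
split=> x a y z; apply/matrixP=> i j; rewrite !mxE linearP.
  by rewrite mulrDl mulrA.
by rewrite mulrDr mulrCA.
Qed.

Lemma linear_sumZ (A B : lmodType k) (g : A -> B) (I : finType)
    (c : I -> k) (x : I -> A) :
  linear g -> g (\sum_i c i *: x i) = \sum_i c i *: g (x i).
Proof.
move=> lg; pose G := HB.pack g (GRing.isLinear.Build k A B *:%R g lg)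
  : {linear A -> B}.
by rewrite -[g]/(G : A -> B) linear_sum; apply: eq_bigr => i _; rewrite linearZ.
Qed.

Lemma tliftE (W : lmodType k) (f : U -> V -> W) u v :
  is_bilinear f -> tlift f (u ⊗ v) = f u v.
Proof.
case=> fl fr; rewrite {2}(coord_vbasis (memvf u)) (linear_sumZ _ _ (fl v)).
apply: eq_bigr => i _.
rewrite {2}(coord_vbasis (memvf v)) (linear_sumZ _ _ (fr _)).
by rewrite scaler_sumr; apply: eq_bigr => j _; rewrite mxE scalerA.
Qed.

Lemma tensor_span (t : tensor U V) : t = tlift (@tens k U V) t.
Proof.
rewrite /tlift [LHS](matrix_sum_delta t).
apply: eq_bigr => i _; apply: eq_bigr => j _; congr (_ *: _).
apply/matrixP=> i' j'; rewrite !mxE !coord_free ?(basis_free (vbasisP _)) //.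
by rewrite eq_sym [j == _]eq_sym; case: (_ == _); case: (_ == _);
  rewrite ?mulr1 ?mulr0.
Qed.

Lemma tlift_unique (W : lmodType k) (f g : tensor U V -> W) :
    linear f -> linear g -> (forall u v, f (u ⊗ v) = g (u ⊗ v)) -> f =1 g.
Proof.
move=> lf lg fg t; rewrite (tensor_span t) /tlift !pair_bigA /=.
by rewrite !linear_sumZ //; apply: eq_bigr => i _; rewrite fg.
Qed.

Lemma eq_tlift (W : lmodType k) (f g : U -> V -> W) :
  (forall u v, f u v = g u v) -> tlift f =1 tlift g.
Proof.
by move=> fg t; apply: eq_bigr => i _; apply: eq_bigr => j _; rewrite fg.
Qed.

Lemma tlift_linearf (W : lmodType k) (t : tensor U V) (c : k)
    (f g : U -> V -> W) :
  tlift (fun x y => c *: f x y + g x y) t = c *: tlift f t + tlift g t.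
Proof.
rewrite /tlift scaler_sumr -big_split; apply: eq_bigr => i _ /=.
rewrite scaler_sumr -big_split; apply: eq_bigr => j _ /=.
by rewrite scalerDr !scalerA mulrC.
Qed.

End TensorTheory.

Section TensorAlgebra.
Variables (k : fieldType) (A B : falgType k).
Local Notation AB := (tensor A B).

(* (a ⊗ b)(c ⊗ d) = ac ⊗ bd *)
Definition tens_mul (s t : AB) : AB :=
  tlift (fun a b => tlift (fun c d => (a * c) ⊗ (b * d)) t) s.

Let tensl (v : B) a (x y : A) : (a *: x + y) ⊗ v = a *: (x ⊗ v) + y ⊗ v.
Proof. exact: (tens_bilinear A B).1. Qed.
Let tensr (u : A) a (x y : B) : u ⊗ (a *: x + y) = a *: (u ⊗ x) + u ⊗ y.
Proof. exact: (tens_bilinear A B).2. Qed.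

Let inner_bilin (a : A) (b : B) :
  is_bilinear (fun c d => (a * c) ⊗ (b * d)).
Proof.
by split=> [d | c] x y z; rewrite mulrDr -scalerAr ?tensl ?tensr.
Qed.

Let outer_bilin (t : AB) :
  is_bilinear (fun a b => tlift (fun c d => (a * c) ⊗ (b * d)) t).
Proof.
split=> [b | a] x y z; rewrite -tlift_linearf; apply: eq_tlift => c d;
  by rewrite mulrDl -scalerAl ?tensl ?tensr.
Qed.

Lemma tens_mulE a b c d : tens_mul (a ⊗ b) (c ⊗ d) = (a * c) ⊗ (b * d).
Proof.
by rewrite /tens_mul (tliftE _ _ (outer_bilin _)) (tliftE _ _ (inner_bilin _ _)).
Qed.

Let mul_linl (t : AB) : linear (tens_mul^~ t).
Proof. by move=> a x y; apply: tlift_is_linear. Qed.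

Let mul_linr (s : AB) : linear (tens_mul s).
Proof.
move=> a x y; rewrite /tens_mul -tlift_linearf; apply: eq_tlift => c d.
exact: tlift_is_linear.
Qed.

Let mulA : associative tens_mul.
Proof.
move=> x y z.
apply: (tlift_unique (f := fun x => tens_mul x (tens_mul y z))
         (g := fun x => tens_mul (tens_mul x y) z)) => [||a b].
- exact: mul_linl.
- by move=> c u v /=; rewrite !mul_linl.
apply: (tlift_unique (f := fun y => tens_mul (a ⊗ b) (tens_mul y z))
         (g := fun y => tens_mul (tens_mul (a ⊗ b) y) z)) => [||c d].
- by move=> e u v /=; rewrite mul_linl mul_linr.
- by move=> e u v /=; rewrite mul_linr mul_linl.
apply: (tlift_unique (f := fun z => tens_mul (a ⊗ b) (tens_mul (c ⊗ d) z))
         (g := fun z => tens_mul (tens_mul (a ⊗ b) (c ⊗ d)) z)) => [||e f].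
- by move=> g u v /=; rewrite !mul_linr.
- exact: mul_linr.
by rewrite !tens_mulE !mulrA.
Qed.

Let mul1 : left_id (1 ⊗ 1) tens_mul.
Proof.
move=> x; apply: (tlift_unique (f := tens_mul (1 ⊗ 1)) (g := idfun)) => [||a b].
- exact: mul_linr.
- by [].
by rewrite tens_mulE !mul1r.
Qed.

Let mulr1' : right_id (1 ⊗ 1) tens_mul.
Proof.
move=> x; apply: (tlift_unique (f := tens_mul^~ (1 ⊗ 1)) (g := idfun)) => [||a b].
- exact: mul_linl.
- by [].
by rewrite tens_mulE !mulr1.
Qed.

Let mulDl : left_distributive tens_mul +%R.
Proof. by move=> x y z; have := mul_linl z 1 x y; rewrite !scale1r. Qed.

Let mulDr : right_distributive tens_mul +%R.
Proof. by move=> x y z; have := mul_linr x 1 y z; rewrite !scale1r. Qed.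

Let one_neq0 : (1 : A) ⊗ (1 : B) != 0.
Proof.
have ex (C : falgType k) : exists i, coord (vbasis (fullv : {vspace C})) i 1 != 0.
  apply/existsP; rewrite -negb_forall; apply/negP => /forallP h.
  have /eqP[] := oner_neq0 C; rewrite (coord_vbasis (memvf (1 : C))).
  by apply: big1 => i _; rewrite (eqP (h i)) scale0r.
have [[i hi] [j hj]] := (ex A, ex B).
apply/eqP => /matrixP/(_ i j); rewrite !mxE => /eqP.
by rewrite mulf_eq0 (negPf hi) (negPf hj).
Qed.

HB.instance Definition _ := GRing.Zmodule_isNzRing.Build AB
  mulA mul1 mulr1' mulDl mulDr one_neq0.

Let scaleAl (a : k) (x y : AB) : a *: (x * y) = (a *: x) * y.
Proof.
have := mul_linl y a x 0; rewrite addr0 -[tens_mul 0 y]/((0 : AB) * y) mul0r.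
by rewrite addr0.
Qed.
HB.instance Definition _ := GRing.Lmodule_isLalgebra.Build k AB scaleAl.

Let scaleAr (a : k) (x y : AB) : a *: (x * y) = x * (a *: y).
Proof.
have := mul_linr x a y 0; rewrite addr0 -[tens_mul x 0]/(x * (0 : AB)) mulr0.
by rewrite addr0.
Qed.
HB.instance Definition _ := GRing.Lalgebra_isAlgebra.Build k AB scaleAr.
HB.instance Definition _ := Algebra_isFalgebra.Build k AB.

Lemma tens1 : 1 ⊗ 1 = 1 :> AB. Proof. by []. Qed.
Lemma tensM a b c d : (a ⊗ b) * (c ⊗ d) = (a * c) ⊗ (b * d) :> AB.
Proof. exact: tens_mulE. Qed.

End TensorAlgebra.

HB.mixin Record isHopfAlgebra (k : fieldType) H of Falgebra k H := {
  comul : 'Hom(H, tensor H H);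
  counit : 'Hom(H, k^o);
  antipode : 'End(H);
  comul1 : comul 1 = 1;
  comulM : forall a b : H, comul (a * b) = comul a * comul b;
  counit1 : counit 1 = 1;
  counitM : forall a b : H, counit (a * b) = counit a * counit b;
  comulA : forall h : H,
    tlift (fun h1 h2 => comul h1 ⊗ h2) (comul h)
    = tlift (fun h1 h2 => tlift (fun h21 h22 => (h1 ⊗ h21) ⊗ h22) (comul h2))
        (comul h);
  counitl : forall h : H, tlift (fun h1 h2 => (counit h1 : k) *: h2) (comul h) = h;
  counitr : forall h : H, tlift (fun h1 h2 => (counit h2 : k) *: h1) (comul h) = h;
  antipodel : forall h : H,
    tlift (fun h1 h2 => antipode h1 * h2) (comul h) = (counit h : k)%:A;
  antipoder : forall h : H,
    tlift (fun h1 h2 => h1 * antipode h2) (comul h) = (counit h : k)%:A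
}.

#[short(type="hopfAlgType")]
HB.structure Definition HopfAlgebra (k : fieldType) :=
  { H of isHopfAlgebra k H & Falgebra k H }.

Notation dual_space H := 'Hom(H, _^o).

Section HopfDefs.
Variables (k : fieldType) (H : hopfAlgType k).
Implicit Types (h x y a b z : H) (p q : dual_space H).

Definition conv p q : dual_space H :=
  linfun (fun h => tlift (fun h1 h2 => p h1 * q h2 : k^o) (comul h)).
Local Notation "p ∗ q" := (conv p q).

Lemma convE p q h :
  (p ∗ q) h = tlift (fun h1 h2 => p h1 * q h2 : k^o) (comul h).
Proof.
pose f := (fun h => tlift (fun h1 h2 => p h1 * q h2 : k^o) (comul h)).
have lf : linear f by move=> c u v; rewrite /f !linearP.
pose F := HB.pack f (GRing.isLinear.Build k H k^o *:%R f lf)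
  : {linear H -> k^o}.
exact: (lfunE F).
Qed.

Definition hit h p : H := tlift (fun h1 h2 => (p h1 : k) *: h2) (comul h).
Local Notation "h ↼ p" := (hit h p).

Lemma conv_linearr p : linear (conv p).
Proof.
move=> c u v; apply/lfunP=> h; rewrite add_lfunE scale_lfunE !convE.
rewrite -tlift_linearf; apply: eq_tlift => x y.
by rewrite add_lfunE scale_lfunE mulrDr; congr (_ + _); apply: mulrCA.
Qed.

Lemma hit_linearr h : linear (hit h).
Proof.
move=> c u v; rewrite /hit -tlift_linearf; apply: eq_tlift => x y.
by rewrite add_lfunE scale_lfunE scalerDl -scalerA.
Qed.

Definition is_left_ideal (I : {vspace H}) : Prop :=
  forall h x, x \in I -> h * x \in I.

Definition semisimple : Prop :=
  forall I : {vspace H}, is_left_ideal I ->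
  exists J : {vspace H},
    [/\ is_left_ideal J, (I + J = fullv)%VS & (I :&: J = 0)%VS].

Definition tflip (t : tensor H H) : tensor H H := tlift (fun x y => y ⊗ x) t.

(* R₁₂, R₁₃, R₂₃ live in (H ⊗ H) ⊗ H. *)
Definition leg12 (r : tensor H H) : tensor (tensor H H) H := r ⊗ 1.
Definition leg13 (r : tensor H H) : tensor (tensor H H) H :=
  tlift (fun x y => (x ⊗ 1) ⊗ y) r.
Definition leg23 (r : tensor H H) : tensor (tensor H H) H :=
  tlift (fun x y => (1 ⊗ x) ⊗ y) r.

Definition is_universal_R (r : tensor H H) : Prop :=
  [/\ r \is a GRing.unit,
      forall h, r * comul h = tflip (comul h) * r,
      tlift (fun x y => comul x ⊗ y) r = leg13 r * leg23 r
    & tlift (fun x y => tlift (fun y1 y2 => (x ⊗ y1) ⊗ y2) (comul y)) r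
      = leg13 r * leg12 r].

Definition quasitriangular : Prop := exists r, is_universal_R r.

Definition idempotent_integral (L : H) : Prop :=
  [/\ forall h, h * L = (counit h : k) *: L, forall h, L * h = (counit h : k) *: L,
      L * L = L & L != 0].

(* [rho] acts on column vectors; the rows of U are the transposes of vectors
   spanning a subspace of the module. *)
Definition irreducible_repr m (rho : H -> 'M[k]_m.+1) : Prop :=
  forall U : 'M[k]_m.+1,
    (forall h, (U *m (rho h)^T <= U)%MS) -> U != 0 -> row_full U.

Definition irreducible_character p : Prop :=
  exists m (rho : {lrmorphism H -> 'M[k]_m.+1}),
    irreducible_repr rho /\ forall h, p h = \tr (rho h).

Definition enum_irr n (chi : 'I_n.+1 -> dual_space H) : Prop :=
  [/\ injective chi,
      forall p, irreducible_character p <-> exists i, chi i = p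
    & chi ord0 = counit].

Definition character_algebra n (chi : 'I_n.+1 -> dual_space H) : {vspace dual_space H} :=
  <<codom chi>>%VS.

Definition idempotent_in (A : {vspace dual_space H}) p : Prop :=
  p \in A /\ p ∗ p = p.

Definition primitive_idempotent_in (A : {vspace dual_space H}) p : Prop :=
  [/\ idempotent_in A p, p != 0
    & forall e f, idempotent_in A e -> idempotent_in A f ->
        e ∗ f = 0 -> f ∗ e = 0 -> p = e + f -> e = 0 \/ f = 0].

Definition hdim : nat := \dim (fullv : {vspace H}).

(* λ = Σ dᵢ χᵢ *)
Definition dual_integral n (chi : 'I_n.+1 -> dual_space H) : dual_space H :=
  \sum_i (chi i 1 : k) *: chi i.

Definition enum_primitive_idempotents n (chi F : 'I_n.+1 -> dual_space H) : Prop :=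
  [/\ injective F,
      forall p, primitive_idempotent_in (character_algebra chi) p
                <-> exists i, F i = p
    & F ord0 = (hdim%:R : k)^-1 *: dual_integral chi].

Definition conjugacy_class (L : H) (f : dual_space H) : {vspace H} :=
  limg (linfun (fun p : dual_space H => L ↼ (f ∗ p))).

Lemma conjugacy_classP L f x :
  x \in conjugacy_class L f <-> exists p, x = L ↼ (f ∗ p).
Proof.
pose g p := L ↼ (f ∗ p).
have lg : linear g by move=> c u v; rewrite /g conv_linearr hit_linearr.
pose G := HB.pack g (GRing.isLinear.Build k (dual_space H) H *:%R g lg)
  : {linear dual_space H -> H}.
split=> [/memv_imgP[p _ ->] | [p ->]]; first by exists p; apply: (lfunE G).
by rewrite -[_ ↼ _]/(g p) -[g p](lfunE G); apply: memv_img; apply: memvf.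
Qed.

Definition class_sum (L : H) (f : dual_space H) : H := L ↼ ((hdim%:R : k) *: f).

Definition normalized_class_sum (L : H) (f : dual_space H) : H :=
  ((\dim (conjugacy_class L f))%:R : k)^-1 *: class_sum L f.

(* {a, b} = Σ a₁ b₁ S(a₂) S(b₂) *)
Definition hcommutator a b : H :=
  tlift (fun a1 a2 => tlift (fun b1 b2 => a1 * b1 * antipode a2 * antipode b2)
    (comul b)) (comul a).

(* T(z) = {z, Λ} *)
Definition commutator_op (L : H) z : H := hcommutator z L.

End HopfDefs.

Notation "p ∗ q" := (conv p q) : hopf_scope.
Notation "h ↼ p" := (hit h p) : hopf_scope.

Section Distribution.
Variables (R : realType) (k : fieldType) (iota : {rmorphism R -> k}).
Variables (H : hopfAlgType k) (L : H) (n : nat) (F : 'I_n.+1 -> dual_space H).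
Implicit Types (z : H) (alpha : {ffun 'I_n.+1 -> R}).

Definition is_distribution_of z alpha : Prop :=
  [/\ forall i, 0 <= alpha i, \sum_i alpha i = 1
    & z = \sum_i iota (alpha i) *: normalized_class_sum L (F i)].

Definition central_distribution z : Prop :=
  z \in 'Z(fullv)%VS /\ exists alpha, is_distribution_of z alpha.

(* Prob(X_z = C_i); only meaningful when z is a central distribution element,
   in which case its distribution is unique because the η_i form a basis. *)
Definition prob_class z (i : 'I_n.+1) : R :=
  xget [ffun=> 0] [set alpha | is_distribution_of z alpha]%classic i.

Definition prob_one z : R := prob_class z ord0.

End Distribution.

(* Main.v *)
From HB Require Import structures.
Require Import Defs.
From mathcomp Require Import all_boot all_order all_algebra all_field.
From mathcomp Require cyclic.
From mathcomp Require Import all_classical all_reals all_analysis.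
From mathcomp Require Import zify.
Import numFieldNormedType.Exports.
Import Order.TTheory GRing.Theory Num.Theory.
Set Implicit Arguments.
Unset Strict Implicit.
Unset Printing Implicit Defensive.
Local Open Scope classical_set_scope.
Local Open Scope ring_scope.
Local Open Scope hopf_scope.

(** Write z = Σ α_i η_i.  The F_i form the basis of R(H) dual to the η_i, so T
    acts on coefficients by the matrix t_ij = F_j(T(η_i)).  The theorem holds
    because t is the transition matrix of a Markov chain on the conjugacy
    classes that is absorbed in the class of 1:

    - T(η_i) = η_i η_{i*}, where F_{i*} = F_i ∘ S ([commutator_eta]);
    - the entries of t are non-negative rational numbers
      ([structure_constant_nat]);
    - the rows of t sum to 1, since Σ F_j = ε and ε(η_i) = 1
      ([transition_sum]);
    - t_i0 is the inverse of the dimension of the i-th conjugacy class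
      ([F0_commutator_eta]), hence at least 1/d, and it is 1 for i = 0.

    So at each step the mass that lies outside the class of 1 is multiplied by
    at most 1 - 1/d ([absorbing_cvg]).

    The deepest point is the sign of t_ij.  Multiplied by
    the dimensions of the i-th and j-th conjugacy classes, the structure
    constant F_l(η_i η_j) is the trace of an operator on H ⊗ H, the product of three commuting idempotents attached to
    F_l, F_j and F_i; a trace of an idempotent is a dimension.  The first of
    them, [theta], is built from the universal R-matrix, and its commutation
    with the second, [theta_rho1], rests on the hexagon identities.

    These computations use S² = 1, proved here as follows.  The functional
    λ(h) = Tr(x ↦ h S²(x)) is a left integral of H* with λ(Λ) = 1, and it
    makes H a Frobenius algebra; this yields Radford's formula
    S⁴(c) = g⁻¹ c g with g grouplike of finite order ([antipode4_conj],
    [grouplike_order]).  On the other hand S² is conjugation by the Drinfeld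
    element u, so some power of u is central, and Tr(S²) becomes a sum of terms
    q |Σ w^e|² with q ≥ 0 rational and w a root of unity, which does not vanish
    ([lam1_neq0]).  As λ(1) = Tr(S²), this gives g = 1 and S⁴ = 1.  Then the
    traces of S² on H and on the image of the projection attached to F_0 are
    integers, and the first is d times the second.  It is non-zero and at most d
    in absolute value, and it is not -d because S²(1) = 1; so it is d, and
    S² = 1 ([antipode_involutive]). *)

(** * Linear maps and Sweedler sums *)

(** A predicate on bare functions, unlike the structure {linear U -> W}: the
    functions met in Sweedler sums are mostly anonymous, and [lins] finds their
    linearity from the shape of their bodies. *)
Definition lin (k : fieldType) (U W : lmodType k) (f : U -> W) : Prop :=
  forall a x y, f (a *: x + y) = a *: f x + f y.

Section Lin.
Variable k : fieldType.
Implicit Types U V W : lmodType k.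

Lemma lin_id U : lin (fun x : U => x). Proof. by []. Qed.
Lemma lin_lfun (U V : vectType k) (F : 'Hom(U, V)) : lin F.
Proof. by move=> a x y; rewrite linearP. Qed.
Lemma lin_lapp W (U V : vectType k) (F : 'Hom(U, V)) (g : W -> U) :
  lin g -> lin (fun x => F (g x)).
Proof. by move=> lg a x y; rewrite lg linearP. Qed.
Lemma lin_comp U V W (F : V -> W) (g : U -> V) :
  lin F -> lin g -> lin (fun x => F (g x)).
Proof. by move=> lF lg a x y; rewrite lg lF. Qed.
Lemma lin_mull U (A : algType k) (c : A) (g : U -> A) :
  lin g -> lin (fun x => g x * c).
Proof. by move=> lg a x y; rewrite lg mulrDl scalerAl. Qed.
Lemma lin_mulr U (A : algType k) (c : A) (g : U -> A) :
  lin g -> lin (fun x => c * g x).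
Proof. by move=> lg a x y; rewrite lg mulrDr scalerAr. Qed.
Lemma lin_scalel U W (c : W) (g : U -> k^o) : lin g -> lin (fun x => (g x : k) *: c).
Proof. by move=> lg a x y; rewrite lg scalerDl -scalerA. Qed.
Lemma lin_scaler U W (c : k) (g : U -> W) : lin g -> lin (fun x => c *: g x).
Proof. by move=> lg a x y; rewrite lg scalerDr !scalerA mulrC. Qed.
Lemma lin_tensl U (A B : vectType k) (c : B) (g : U -> A) :
  lin g -> lin (fun x => g x ⊗ c).
Proof. by move=> lg a x y; rewrite lg (tens_bilinear A B).1. Qed.
Lemma lin_tensr U (A B : vectType k) (c : A) (g : U -> B) :
  lin g -> lin (fun x => c ⊗ g x).
Proof. by move=> lg a x y; rewrite lg (tens_bilinear A B).2. Qed.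
Lemma lin_tlift_arg U W (A B : vectType k) (f : A -> B -> W)
  (g : U -> tensor A B) : lin g -> lin (fun x => tlift f (g x)).
Proof. by move=> lg a x y; rewrite lg linearP. Qed.
Lemma lin_tlift_fun U W (A B : vectType k) (f : U -> A -> B -> W)
  (t : tensor A B) : (forall a b, lin (fun x => f x a b)) ->
  lin (fun x => tlift (f x) t).
Proof.
by move=> lf a x y; rewrite -tlift_linearf; apply: eq_tlift => u v; rewrite lf.
Qed.
Lemma lin_add U W (f g : U -> W) : lin f -> lin g -> lin (fun x => f x + g x).
Proof. by move=> lf lg a x y; rewrite lf lg scalerDr addrACA. Qed.
Lemma lin_opp U W (f : U -> W) : lin f -> lin (fun x => - f x).
Proof. by move=> lf a x y; rewrite lf opprD scalerN. Qed.
Lemma lin_sum U W (I : finType) (f : I -> U -> W) :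
  (forall i, lin (f i)) -> lin (fun x => \sum_i f i x).
Proof.
move=> lf a x y; rewrite scaler_sumr -big_split /=.
by apply: eq_bigr => i _; apply: lf.
Qed.

Lemma lin0 U W (f : U -> W) : lin f -> f 0 = 0.
Proof.
move=> lf; have := lf 1 0 0; rewrite !scale1r addr0 => h.
by apply: (addrI (f 0)); rewrite addr0 -h.
Qed.
Lemma linZ U W (f : U -> W) c x : lin f -> f (c *: x) = c *: f x.
Proof. by move=> lf; have := lf c x 0; rewrite (lin0 lf) !addr0. Qed.
Lemma linD U W (f : U -> W) x y : lin f -> f (x + y) = f x + f y.
Proof. by move=> lf; have := lf 1 x y; rewrite !scale1r. Qed.
Lemma linN U W (f : U -> W) x : lin f -> f (- x) = - f x.
Proof. by move=> lf; rewrite -scaleN1r linZ // scaleN1r. Qed.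
Lemma linS U W (f : U -> W) (I : finType) (F : I -> U) : lin f ->
  f (\sum_i F i) = \sum_i f (F i).
Proof.
move=> lf; apply: (big_morph f) => [x y|]; [exact: linD|exact: lin0].
Qed.

Lemma lin_linfunE (U V : vectType k) (f : U -> V) : lin f -> linfun f =1 f.
Proof.
move=> lf x.
pose F := HB.pack f (GRing.isLinear.Build k U V *:%R f lf) : {linear U -> V}.
exact: (lfunE F).
Qed.

End Lin.

(** Keeps [lin_gen] from writing F as F ∘ id for ever. *)
Ltac notid g := lazymatch g with (fun x => x) => fail | _ => idtac end.

(** [lins] goes down the body of a function: [lin_struct] treats the known
    head symbols, [lin_hyps] closes a goal by a hypothesis, and [lin_gen] splits
    off an argument of an unknown function. *)
Ltac lin_struct :=
  match goal with
  | |- linear ?f => change (lin f)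
  | |- forall _, _ => intro; cbv beta
  | |- _ /\ _ => split
  | |- is_bilinear _ => split
  | |- @lin ?k ?U ?W (fun x => x) => intros ? ? ?; reflexivity
  | |- @lin ?k ?U ?W (fun x => fun_of_lfun ?F (@?g x)) => apply (@lin_lapp k U _ _ F g)
  | |- @lin ?k ?U ?W (fun x => GRing.mul (@?g x) ?c) => apply (@lin_mull k U _ c g)
  | |- @lin ?k ?U ?W (fun x => GRing.mul ?c (@?g x)) => apply (@lin_mulr k U _ c g)
  | |- @lin ?k ?U ?W (fun x => GRing.scale (@?g x) ?c) => apply (@lin_scalel k U W c g)
  | |- @lin ?k ?U ?W (fun x => GRing.scale ?c (@?g x)) => apply (@lin_scaler k U W c g)
  | |- @lin ?k ?U ?W (fun x => GRing.add (@?f x) (@?g x)) => apply (@lin_add k U W f g)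
  | |- @lin ?k ?U ?W (fun x => GRing.opp (@?f x)) => apply (@lin_opp k U W f)
  | |- @lin ?k ?U ?W (fun x => tens (@?g x) ?c) => apply (@lin_tensl k U _ _ c g)
  | |- @lin ?k ?U ?W (fun x => tens ?c (@?g x)) => apply (@lin_tensr k U _ _ c g)
  | |- @lin ?k ?U ?W (fun x => tlift ?f (@?g x)) => apply (@lin_tlift_arg k U W _ _ f g)
  | |- @lin ?k ?U ?W (fun x => tlift (@?f x) ?t) => apply (@lin_tlift_fun k U W _ _ f t)
  | |- @lin ?k ?U ?W (fun x => bigop _ _ (fun i => BigBody i _ _ (@?f i x))) => apply (@lin_sum k U W _ f)
  end.
Ltac lin_gen :=
  match goal with
  | |- @lin ?k ?U ?W (fun x => ?F (@?g x)) =>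
      notid g; apply (@lin_comp k U _ W F g)
  | |- @lin ?k ?U ?W (fun x => ?F (@?g x) ?c) => notid g; apply (@lin_comp k U _ W (fun y => F y c) g)
  | |- @lin ?k ?U ?W (fun x => ?F (@?g x) ?c ?d) => notid g; apply (@lin_comp k U _ W (fun y => F y c d) g)
  end.
Ltac lin_hyps :=
  match goal with
  | H : lin _ |- _ => exact H
  | H : forall a, lin (@?P a) |- _ => apply H
  | H : forall a b, lin (@?P a b) |- _ => apply H
  | H : forall a b c, lin (@?P a b c) |- _ => apply H
  | H : forall a, linear (@?P a) |- _ => apply H
  | H : linear _ |- _ => exact H
  | H : is_bilinear _ |- _ => apply (proj1 H)
  | H : is_bilinear _ |- _ => apply (proj2 H)
  end.
Ltac lins := cbv beta; first
  [ lin_struct; lins | lin_hyps | exact (@lin_lfun _ _ _ _) | exact (@tlift_is_linear _ _ _ _ _)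
  | lin_gen; lins ].

Section Tl.
Variable k : fieldType.
Implicit Types A B C D : vectType k.

Lemma eq_tl A B (W : lmodType k) (f g : A -> B -> W) t :
  (forall a b, f a b = g a b) -> tlift f t = tlift g t.
Proof. by move=> fg; apply: eq_tlift. Qed.

Lemma tl_pair A B (W : lmodType k) (f : A -> B -> W) t :
  tlift f t = \sum_p fun_of_matrix t p.1 p.2 *:
                f (vbasis fullv)`_p.1 (vbasis fullv)`_p.2.
Proof. by rewrite /tlift pair_bigA. Qed.

Lemma tlC A B C D (W : lmodType k) (f : A -> B -> C -> D -> W) s t :
  tlift (fun a b => tlift (fun c d => f a b c d) t) s
  = tlift (fun c d => tlift (fun a b => f a b c d) s) t.
Proof.
rewrite !tl_pair.
under eq_bigr => p _ do rewrite tl_pair scaler_sumr.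
rewrite exchange_big /=; apply: eq_bigr => q _.
by rewrite tl_pair scaler_sumr; apply: eq_bigr => p _; rewrite !scalerA mulrC.
Qed.

Lemma lin_tl A B (V W : lmodType k) (F : V -> W) (f : A -> B -> V) t :
  lin F -> F (tlift f t) = tlift (fun a b => F (f a b)) t.
Proof.
move=> lF; rewrite /tlift linS //; apply: eq_bigr => i _; rewrite linS //.
by apply: eq_bigr => j _; rewrite linZ.
Qed.

Lemma tl_tens A B C D (W : lmodType k) (f : A -> B -> W) (g : C -> D -> A)
  (h : C -> D -> B) t : is_bilinear f ->
  tlift f (tlift (fun c d => g c d ⊗ h c d) t) = tlift (fun c d => f (g c d) (h c d)) t.
Proof.
move=> bf; rewrite (@lin_tl _ _ _ _ (tlift f)); last exact: tlift_is_linear.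
by apply: eq_tl => a b; rewrite tliftE.
Qed.

Lemma tl_id A B (t : tensor A B) : tlift (fun a b => a ⊗ b) t = t.
Proof. exact: esym (tensor_span t). Qed.

Lemma tlM (A B : falgType k) (W : lmodType k) (f : A -> B -> W) (s t : tensor A B) :
  is_bilinear f ->
  tlift f (s * t) = tlift (fun a b => tlift (fun c d => f (a * c) (b * d)) t) s.
Proof.
move=> bf; rewrite -[s * t]/(tens_mul s t) /tens_mul.
rewrite (@lin_tl _ _ _ _ (tlift f)); last exact: tlift_is_linear.
by apply: eq_tl => a b; rewrite tl_tens.
Qed.

End Tl.

(** * Hopf algebra identities in Sweedler form *)

Notation "'\sw_' ( a , b <- t ) E" := (tlift (fun a b => E) t)
  (at level 41, E at level 41, a name, b name, t at level 30,
   format "'[' '\sw_' ( a ,  b  <-  t ) '/  '  E ']'").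
Notation Δ := comul.
Notation S := antipode.

Definition trilin (k : fieldType) (A B C W : lmodType k) (f : A -> B -> C -> W) :=
  (forall b c, lin (fun a => f a b c)) /\ (forall a c, lin (fun b => f a b c))
  /\ (forall a b, lin (fun c => f a b c)).

Ltac multilin := first [
  (split; [ | split ]; intros; lins) | (split; intros; lins) | (intros; lins) ].

Section HopfBasics.
Variables (k : fieldType) (H : hopfAlgType k).
Implicit Types (h x y a b : H).
Variable W : lmodType k.

Lemma coassoc (f : H -> H -> H -> W) h : trilin f ->
  \sw_(a, b <- Δ h) \sw_(a1, a2 <- Δ a) f a1 a2 b
  = \sw_(a, b <- Δ h) \sw_(b1, b2 <- Δ b) f a b1 b2.
Proof.
move=> [f1 [f2 f3]].
pose F (t : tensor H H) c := \sw_(a, b <- t) f a b c.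
have bF : is_bilinear F by rewrite /F; split; lins.
have := congr1 (tlift F) (comulA h).
rewrite tl_tens // => ->.
rewrite (@lin_tl k _ _ _ _ (tlift F)); last exact: tlift_is_linear.
apply: eq_tl => a b; rewrite tl_tens //.
by apply: eq_tl => b1 b2; rewrite /F tliftE //; split; lins.
Qed.

Lemma swcounitl (f : H -> W) h : lin f ->
  \sw_(a, b <- Δ h) (counit a : k) *: f b = f h.
Proof.
by move=> lf; rewrite -[in RHS](counitl h) (@lin_tl k _ _ _ _ f) //;
   apply: eq_tl => a b; rewrite linZ.
Qed.
Lemma swcounitr (f : H -> W) h : lin f ->
  \sw_(a, b <- Δ h) (counit b : k) *: f a = f h.
Proof.
by move=> lf; rewrite -[in RHS](counitr h) (@lin_tl k _ _ _ _ f) //;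
   apply: eq_tl => a b; rewrite linZ.
Qed.
Lemma swSl (f : H -> W) h : lin f ->
  \sw_(a, b <- Δ h) f (S a * b) = (counit h : k) *: f 1.
Proof. by move=> lf; rewrite -(@lin_tl k _ _ _ _ f) // antipodel linZ. Qed.
Lemma swSr (f : H -> W) h : lin f ->
  \sw_(a, b <- Δ h) f (a * S b) = (counit h : k) *: f 1.
Proof. by move=> lf; rewrite -(@lin_tl k _ _ _ _ f) // antipoder linZ. Qed.

(** In the names of these contractions, l or r says which of two adjacent
    factors carries the antipode, and the digits which of three legs are
    multiplied. *)
Lemma sw3Sl12 (f : H -> H -> W) h : is_bilinear f ->
  \sw_(a, b <- Δ h) \sw_(b1, b2 <- Δ b) f (S a * b1) b2 = f 1 h.
Proof.
move=> [f1 f2]; rewrite -(@coassoc (fun a b c => f (S a * b) c)); last by multilin.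
rewrite -[RHS](@swcounitl (f 1)); last by lins.
apply: eq_tl => a b.
by rewrite (@swSl (f^~ b)) //; lins.
Qed.
Lemma sw3Sr12 (f : H -> H -> W) h : is_bilinear f ->
  \sw_(a, b <- Δ h) \sw_(b1, b2 <- Δ b) f (a * S b1) b2 = f 1 h.
Proof.
move=> [f1 f2]; rewrite -(@coassoc (fun a b c => f (a * S b) c)); last by multilin.
rewrite -[RHS](@swcounitl (f 1)); last by lins.
apply: eq_tl => a b.
by rewrite (@swSr (f^~ b)) //; lins.
Qed.
Lemma sw3Sr23 (f : H -> H -> W) h : is_bilinear f ->
  \sw_(a, b <- Δ h) \sw_(b1, b2 <- Δ b) f a (b1 * S b2) = f h 1.
Proof.
move=> [f1 f2]; rewrite -[RHS](@swcounitr (f^~ 1)); last by lins.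
apply: eq_tl => a b.
by rewrite (@swSr (f a)) //; lins.
Qed.
Lemma swM (f : H -> H -> W) x y : is_bilinear f ->
  \sw_(a, b <- Δ (x * y)) f a b =
  \sw_(a, b <- Δ x) \sw_(c, d <- Δ y) f (a * c) (b * d).
Proof. by move=> bf; rewrite comulM tlM. Qed.
Lemma sw1 (f : H -> H -> W) : is_bilinear f -> \sw_(a, b <- Δ (1 : H)) f a b = f 1 1.
Proof. by move=> bf; rewrite comul1 -tens1 tliftE. Qed.

End HopfBasics.

Section Antipode.
Variables (k : fieldType) (H : hopfAlgType k).
Implicit Types (h x y a b : H).

Lemma S1 : S (1 : H) = 1.
Proof.
have := antipodel (1 : H); rewrite (@sw1 k H _ (fun a b => S a * b)); last by multilin.
by rewrite mulr1 counit1 scale1r.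
Qed.

(** S(ab) and S(b)S(a) are both inverse to the product map under convolution:
    contract Σ S(b₁) S(a₁) a₂ b₂ S(a₃ b₃) on either side. *)
Lemma SM a b : S (a * b) = S b * S a.
Proof.
pose E := \sw_(a1, a2 <- Δ a) \sw_(b1, b2 <- Δ b)
   (S b1 * S a1 * \sw_(x, y <- Δ (a2 * b2)) (x * S y)).
transitivity E; last first.
  rewrite /E.
  transitivity (\sw_(a1, a2 <- Δ a) \sw_(b1, b2 <- Δ b)
     ((counit a2 : k) *: ((counit b2 : k) *: (S b1 * S a1)))).
    apply: eq_tl => a1 a2; apply: eq_tl => b1 b2.
    by rewrite antipoder counitM -scalerAr mulr1 scalerA.
  transitivity (\sw_(a1, a2 <- Δ a) (counit a2 : k) *: (S b * S a1)).
    apply: eq_tl => a1 a2.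
    rewrite -(@lin_tl k _ _ _ _ (fun y => (counit a2 : k) *: y)); last by lins.
    by rewrite (@swcounitr k H _ (fun b1 => S b1 * S a1)) //; lins.
  by rewrite (@swcounitr k H _ (fun a1 => S b * S a1)) //; lins.
rewrite /E.
transitivity (\sw_(b1, b2 <- Δ b) \sw_(u, v <- Δ b2)
  \sw_(a1, a2 <- Δ a) \sw_(x, y <- Δ a2) (S b1 * (S a1 * x) * u * S (y * v))).
  rewrite -[S (a * b)]mul1r -(@sw3Sl12 k H _ (fun c d => c * S (a * d))); last by multilin.
  apply: eq_tl => b1 b2; apply: eq_tl => u v.
  rewrite (@sw3Sl12 k H _ (fun c d => S b1 * c * u * S (d * v))); last by multilin.
  by rewrite mulr1.
rewrite [RHS]tlC; apply: eq_tl => b1 b2; rewrite tlC; apply: eq_tl => a1 a2.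
rewrite (@swM k H _ (fun x y => x * S y)); last by multilin.
rewrite (@lin_tl k _ _ _ _ (fun y => S b1 * S a1 * y)); last by lins.
rewrite tlC; apply: eq_tl => x y.
rewrite (@lin_tl k _ _ _ _ (fun y => S b1 * S a1 * y)); last by lins.
by apply: eq_tl => u v; rewrite !mulrA.
Qed.

(** Again by uniqueness of convolution inverses, now among the maps from H to
    H ⊗ H: D is a left inverse of Δ, and Δ ∘ S is a right one. *)
Lemma comulS h : Δ (S h) = \sw_(a, b <- Δ h) (S b ⊗ S a).
Proof.
pose D h : tensor H H := \sw_(a, b <- Δ h) (S b ⊗ S a).
have lD : lin D by rewrite /D; lins.
have DΔ x : \sw_(a, b <- Δ x) (D a * Δ b) = (counit x : k) *: 1.
  transitivity (\sw_(a, z <- Δ x) \sw_(b, y <- Δ z) \sw_(c, d <- Δ y)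
     ((S b * c) ⊗ (S a * d))).
    rewrite -(@coassoc k H _ (fun a b y => \sw_(c, d <- Δ y)
     ((S b * c) ⊗ (S a * d)))); last by multilin.
    apply: eq_tl => a y; rewrite /D (@lin_tl k _ _ _ _ (fun t : tensor H H => t * Δ y)); last by lins.
    apply: eq_tl => b c; rewrite -[in LHS](tl_id (Δ y)).
    rewrite (@lin_tl k _ _ _ _ (fun t : tensor H H => (S c ⊗ S b) * t)); last by lins.
    by apply: eq_tl => u v; rewrite tensM.
  transitivity (\sw_(a, z <- Δ x) ((1 : H) ⊗ (S a * z))).
    apply: eq_tl => a z.
    by rewrite (@sw3Sl12 k H _ (fun u v : H => u ⊗ (S a * v))) //; multilin.
  by rewrite (@swSl k H _ (fun u : H => (1 : H) ⊗ u)) //; multilin.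
rewrite -/(D h).
transitivity (\sw_(a, b <- Δ h) \sw_(x, y <- Δ b) (D a * Δ x * Δ (S y))).
  rewrite -(@coassoc k H _ (fun a b y : H => D a * Δ b * Δ (S y))); last by multilin.
  rewrite -[LHS](@swcounitl k H _ (fun y : H => Δ (S y))); last by lins.
  apply: eq_tl => a b; rewrite -(@lin_tl k _ _ _ _ (fun t : tensor H H => t * Δ (S b))); last by lins.
  by rewrite DΔ -scalerAl mul1r.
rewrite -[RHS](@swcounitr k H _ D) //; apply: eq_tl => a b.
under eq_tl => x y do rewrite -mulrA -comulM.
rewrite (@swSr k H _ (fun u : H => D a * Δ u)); last by lins.
by rewrite comul1 mulr1.
Qed.

Lemma counitS h : counit (S h) = counit h.
Proof.
have := congr1 (@counit k H) (antipodel h).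
rewrite (@lin_tl k _ _ _ _ (@counit k H)); last by lins.
rewrite linearZ /= counit1 => E.
rewrite -[LHS](@swcounitr k H _ (fun x => counit (S x))); last by lins.
transitivity (\sw_(a, b <- Δ h) (counit (S a * b) : k^o)).
  by apply: eq_tl => a b; rewrite counitM mulrC.
by rewrite E; exact: mulr1.
Qed.

Lemma swS (W : lmodType k) (f : H -> H -> W) h : is_bilinear f ->
  \sw_(a, b <- Δ (S h)) f a b = \sw_(a, b <- Δ h) f (S b) (S a).
Proof. by move=> bf; rewrite comulS tl_tens. Qed.

Lemma swSS (W : lmodType k) (f : H -> H -> W) h : is_bilinear f ->
  \sw_(a, b <- Δ (S (S h))) f a b = \sw_(a, b <- Δ h) f (S (S a)) (S (S b)).
Proof.
move=> [f1 f2]; rewrite swS; last by split.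
by rewrite (@swS W (fun a b => f (S b) (S a))) //; multilin.
Qed.

End Antipode.

(** * Traces, and an integral of the dual *)

(** Defined for bare functions, so that operators given by Sweedler sums need
    not be bundled. *)
Definition trL (k : fieldType) (V : vectType k) (f : V -> V) : k :=
  \sum_i coord (vbasis fullv) i (f (vbasis fullv)`_i).

Section Trace.
Variable k : fieldType.
Implicit Types U V : vectType k.

Lemma tl_sum (A B : vectType k) (W : lmodType k) (I : finType)
  (f : I -> A -> B -> W) t :
  \sum_i tlift (f i) t = \sw_(a, b <- t) \sum_i f i a b.
Proof.
under eq_bigr => i _ do rewrite tl_pair.
by rewrite exchange_big tl_pair /=; apply: eq_bigr => p _; rewrite scaler_sumr.
Qed.

Lemma lin_basis V (W : lmodType k) (G : V -> W) x : lin G ->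
  \sum_i coord (vbasis (fullv : {vspace V})) i x *: G (vbasis fullv)`_i = G x.
Proof.
move=> lG; rewrite {2}(coord_vbasis (memvf x)) linS //.
by apply: eq_bigr => i _; rewrite linZ.
Qed.

Lemma eq_trL V (f g : V -> V) : f =1 g -> trL f = trL g.
Proof. by move=> fg; apply: eq_bigr => i _; rewrite fg. Qed.

(** The trace of Σ φ_i ⊗ v_i is Σ φ_i(v_i) even if the v_i are not a
    basis, so that traces may be read off any expansion of the identity. *)
Lemma trL_rank1 V (I : finType) (f : V -> V) (phi : I -> V -> k^o) (v : I -> V) :
  (forall i, lin (phi i)) -> (forall x, f x = \sum_i (phi i x : k) *: v i) ->
  trL f = \sum_i phi i (v i).
Proof.
move=> lphi fE; rewrite /trL; under eq_bigr => j _.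
  rewrite fE linear_sum /=; under eq_bigr => i _ do rewrite linearZ /=.
  over.
rewrite exchange_big /=; apply: eq_bigr => i _.
rewrite {2}(coord_vbasis (memvf (v i))) (linS _ (lphi i)).
by apply: eq_bigr => j _; rewrite linZ // mulrC.
Qed.

Lemma trL_tl V (A B : vectType k) (t : tensor A B) (f : V -> V)
  (phi : A -> B -> V -> k^o) (v : A -> B -> V) :
  (forall a b, lin (phi a b)) ->
  (forall x, f x = \sw_(a, b <- t) (phi a b x : k) *: v a b) ->
  trL f = \sw_(a, b <- t) (phi a b (v a b) : k^o).
Proof.
move=> lphi fE; rewrite tl_pair.
rewrite (@trL_rank1 _ _ f (fun p x => fun_of_matrix t p.1 p.2 *:
   phi (vbasis fullv)`_p.1 (vbasis fullv)`_p.2 x)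
  (fun p => v (vbasis fullv)`_p.1 (vbasis fullv)`_p.2)) //; first by lins.
by move=> x; rewrite fE tl_pair; apply: eq_bigr => p _; rewrite scalerA.
Qed.

Lemma trL_lin U V (f : U -> V -> V) : (forall v, lin (f^~ v)) ->
  lin (fun u => trL (f u) : k^o).
Proof.
move=> lf a x y; rewrite /trL scaler_sumr -big_split; apply: eq_bigr => i _ /=.
by rewrite lf linearP.
Qed.

Lemma trL_sumtl V (A B : vectType k) (t : tensor A B) (G : A -> B -> V -> V) :
  trL (fun x => \sw_(a, b <- t) G a b x) = \sw_(a, b <- t) (trL (G a b) : k^o).
Proof.
rewrite tl_pair /trL; under eq_bigr => i _ do rewrite tl_pair linear_sum.
rewrite exchange_big /=; apply: eq_bigr => p _.
by rewrite scaler_sumr; apply: eq_bigr => i _; rewrite linearZ.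
Qed.

Lemma trLC U V (f : U -> V) (g : V -> U) : lin f -> lin g ->
  trL (fun x => f (g x)) = trL (fun y => g (f y)).
Proof.
move=> lf lg; apply: (@trL_rank1 _ _ _ (fun i x => coord (vbasis fullv) i (g x))
   (fun i => f (vbasis fullv)`_i)) => [i|x].
  by move=> a x y; rewrite lg linearP.
rewrite {1}(coord_vbasis (memvf (g x))) linS //.
by apply: eq_bigr => i _; rewrite linZ.
Qed.

Lemma trL_id V : trL (fun x : V => x) = (\dim {:V})%:R.
Proof.
rewrite /trL; under eq_bigr => i _ do
  rewrite coord_free ?(basis_free (vbasisP _)) // eqxx.
by rewrite sumr_const card_ord.
Qed.

(** This is where traces become natural numbers. *)
Lemma trL_idem V (f : V -> V) : lin f -> (forall x, f (f x) = f x) ->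
  trL f = (\dim (limg (linfun f)))%:R.
Proof.
move=> lf ff; set I := limg _; set X := vbasis I.
have fI x : f x \in I by rewrite -(lin_linfunE lf) memv_img ?memvf.
have fid x : x \in I -> f x = x.
  by case/memv_imgP => y _ ->; rewrite (lin_linfunE lf) ff.
rewrite (@trL_rank1 _ _ _ (fun i x => coord X i (f x)) (fun i => X`_i)).
- transitivity (\sum_(i < \dim I) (1 : k)); last by rewrite sumr_const card_ord.
  apply: eq_bigr => i _.
  rewrite fid; last by apply: vbasis_mem; rewrite mem_nth // size_tuple.
  by rewrite coord_free ?(basis_free (vbasisP _)) // eqxx.
- by move=> i a x y; rewrite lf linearP.
- by move=> x; apply: coord_vbasis.
Qed.

End Trace.

Section TraceHopf.
Variables (k : fieldType) (H : hopfAlgType k).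

Local Notation B := (vbasis (fullv : {vspace H})).

(** Expanding x₁ in a basis writes x ↦ F(x₁, x₂) as a sum of composites, in each
    of which the two factors are then exchanged. *)
Lemma trL_sw (F : H -> H -> H) : is_bilinear F ->
  trL (fun x : H => \sw_(a, b <- Δ x) F a b) =
  trL (fun y : H => \sum_(i < \dim {:H}) \sw_(a, b <- Δ (F B`_i y)) coord B i a *: b).
Proof.
move=> [F1 F2].
transitivity (\sum_(i < \dim {:H}) trL (fun x : H => F B`_i (\sw_(a, b <- Δ x) coord B i a *: b))).
  rewrite /trL exchange_big /=; apply: eq_bigr => j _; rewrite -linear_sum /=.
  congr (coord _ _ _).
  under [RHS]eq_bigr => i _ do rewrite (@lin_tl k _ _ _ _ (F B`_i) _ _ (F2 _)).
  rewrite tl_sum; apply: eq_tl => a b; rewrite -[LHS](lin_basis _ (F1 b)).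
  by apply: eq_bigr => i _; rewrite (linZ _ _ (F2 _)).
rewrite [RHS]/trL; under [RHS]eq_bigr => j _ do rewrite linear_sum /=.
rewrite [RHS]exchange_big /=; apply: eq_bigr => i _.
apply: (@trLC k H H (F B`_i)
  (fun x => \sw_(a, b <- Δ x) coord B i a *: b) (F2 _)).
by lins.
Qed.

(** An integral of H*, equal to the regular character when S² = 1. The twist by
    S² makes it a left integral in general. *)
Definition lam : dual_space H := linfun (fun h => trL (fun x : H => h * S (S x)) : k^o).
Lemma lamE h : lam h = trL (fun x : H => h * S (S x)).
Proof.
rewrite /lam (@lin_linfunE k _ _ (fun h => trL (fun x : H => h * S (S x)) : k^o)) //.
by apply: (@trL_lin k H H) => v; lins.
Qed.

(** Let F(z, y) = Σ p(w₁ S(z)) w₂ with w = h S²(y). In the trace of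
    x ↦ F(x₁, x₂) the factors S²(x₂) and S(x₁) cancel, leaving p(h₁) λ(h₂).
    Computed by [trL_sw] instead, the same trace involves w₁ S(w₂) w₃, which
    leaves p(1) λ(h). *)
Lemma lam_left p h : lin (p : H -> k^o) ->
  \sw_(a, b <- Δ h) (p a * lam b : k^o) = p 1 * lam h.
Proof.
move=> lp.
pose F z y : H := \sw_(w, v <- Δ (h * S (S y))) (p (w * S z) : k) *: v.
have bF : is_bilinear F by rewrite /F; multilin.
transitivity (trL (fun x : H => \sw_(a, b <- Δ x) F a b)).
  transitivity (trL (fun x : H => \sw_(a, b <- Δ h) (p a : k) *: (b * S (S x)))).
    rewrite trL_sumtl; apply: eq_tl => a b; rewrite lamE /trL mulr_sumr.
    by apply: eq_bigr => i _; rewrite linearZ.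
  apply: (@eq_trL k) => x; rewrite /F.
  transitivity (\sw_(a, b <- Δ h) \sw_(x1, x2 <- Δ x) \sw_(y1, y2 <- Δ x2)
    (p (a * (S (x1 * S y1))) : k) *: (b * S (S y2))).
    apply: eq_tl => a b.
    rewrite (@sw3Sr12 k H _ (fun u v => (p (a * S u) : k) *: (b * S (S v)))); last by multilin.
    by rewrite S1 mulr1.
  rewrite tlC; apply: eq_tl => x1 x2.
  rewrite (@swM k H _ (fun w v => (p (w * S x1) : k) *: v)); last by multilin.
  apply: eq_tl => a b.
  rewrite (@swSS k H _ (fun c d => (p (a * c * S x1) : k) *: (b * d))); last by multilin.
  by apply: eq_tl => y1 y2; rewrite SM mulrA.
rewrite trL_sw //.
transitivity (trL (fun x : H => p 1 *: (h * S (S x)))); last first.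
  by rewrite /trL lamE mulr_sumr; apply: eq_bigr => i _; rewrite linearZ.
apply: (@eq_trL k) => x; rewrite /F; set y := h * _.
transitivity (\sw_(w, v <- Δ y) \sw_(a, b <- Δ v) (p (w * S a) : k) *: b); last first.
  by rewrite (@sw3Sr12 k H _ (fun u v => (p u : k) *: v)) //; multilin.
have lg (i : 'I_(\dim {:H})) :
  lin (fun z : H => \sw_(a, b <- Δ z) coord B i a *: b) by lins.
under eq_bigr => i _ do rewrite (lin_tl _ _ (lg i)).
rewrite tl_sum; apply: eq_tl => w v.
transitivity (\sum_(i < \dim {:H}) \sw_(a, b <- Δ v)
    ((p (w * S B`_i) : k) *: (coord B i a *: b))).
  apply: eq_bigr => i _; rewrite (linZ _ _ (lg i)).
  by apply: (@lin_tl k _ _ _ _ (fun z : H => (p (w * S B`_i) : k) *: z)); lins.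
rewrite tl_sum; apply: eq_tl => a b.
rewrite -(@lin_basis k H H (fun a => (p (w * S a) : k) *: b) a); last by lins.
by apply: eq_bigr => i _; rewrite !scalerA mulrC.
Qed.
End TraceHopf.

(** * Frobenius structure and the fourth power of the antipode *)

Lemma eq_dual (k : fieldType) (V : vectType k) (x y : V) :
  (forall p : V -> k^o, lin p -> p x = p y) -> x = y.
Proof.
move=> pq; rewrite (coord_vbasis (memvf x)) (coord_vbasis (memvf y)).
apply: eq_bigr => i _; congr (_ *: _).
by apply: (pq (coord (vbasis fullv) i)) => a u v; rewrite linearP.
Qed.

Section Frobenius.
Variables (k : fieldType) (H : hopfAlgType k).
Implicit Types (h x y a b c : H).
Local Notation lam := (@lam k H).

Lemma lam_leftE h : \sw_(a, b <- Δ h) (lam b : k) *: a = (lam h : k) *: (1 : H).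
Proof.
apply: (@eq_dual k H) => p lp; rewrite (@lin_tl k _ _ _ _ p) // linZ //.
transitivity (p 1 * lam h : k^o); last by rewrite mulrC.
by rewrite -lam_left //; apply: eq_tl => a b; rewrite linZ // mulrC.
Qed.

(** A cyclic permutation moves a past the S² in the definition of λ. *)
Lemma lam_twist_trace a b : lam (a * b) = lam (b * S (S a)).
Proof.
rewrite !lamE; transitivity (trL (fun x : H => a * (b * S (S x)))).
  by apply: (@eq_trL k) => x; rewrite mulrA.
rewrite (@trLC k H H (fun y => a * y) (fun x => b * S (S x))); [|by lins|by lins].
by apply: (@eq_trL k) => x; rewrite !SM mulrA.
Qed.

Variables (L : H) (intL : idempotent_integral L).

Lemma counitL : counit L = 1.
Proof.
case: intL => hL _ LL L0; move: (hL L); rewrite LL => /esym/eqP.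
rewrite -subr_eq0 -[X in _ - X]scale1r -scalerBl scaler_eq0 (negPf L0) orbF subr_eq0.
by move/eqP.
Qed.

Lemma lamL : lam L = 1.
Proof.
case: intL => hL Lh _ _; rewrite lamE.
rewrite (@trL_rank1 k H 'I_1 _ (fun _ x => counit (S (S x))) (fun=> L)).
- by rewrite big_ord1 !counitS counitL.
- by move=> _; lins.
- by move=> x; rewrite big_ord1 Lh.
Qed.

(** Two contractions of Σ S(h₁) h₂ Λ₁ ⊗ h₃ Λ₂, one of which absorbs
    h₂ ⊗ h₃ = Δ(h₂) into Λ. *)
Lemma swL_l (W : lmodType k) (f : H -> H -> W) h : is_bilinear f ->
  \sw_(a, b <- Δ L) f (S h * a) b = \sw_(a, b <- Δ L) f a (h * b).
Proof.
case: intL => hL _ _ _ [f1 f2].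
transitivity (\sw_(x, y <- Δ h) \sw_(u, v <- Δ y) \sw_(a, b <- Δ L)
    f (S x * u * a) (v * b)); last first.
  rewrite (@sw3Sl12 k H _ (fun x v => \sw_(a, b <- Δ L) f (x * a) (v * b))); last by multilin.
  by under eq_tl => a b do rewrite mul1r.
rewrite -[LHS](@swcounitr k H _ (fun x => \sw_(a, b <- Δ L) f (S x * a) b)); last by lins.
apply: eq_tl => x y; rewrite -(@linZ k (tensor H H) W (tlift _)); last exact: tlift_is_linear.
rewrite -linearZ -hL (@swM k H _ (fun a b => f (S x * a) b)); last by multilin.
by apply: eq_tl => u v; apply: eq_tl => a b; rewrite mulrA.
Qed.

Lemma swL_r (W : lmodType k) (f : H -> H -> W) h : is_bilinear f ->
  \sw_(a, b <- Δ L) f (a * h) b = \sw_(a, b <- Δ L) f a (b * S h).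
Proof.
case: intL => _ Lh _ _ [f1 f2].
transitivity (\sw_(x, y <- Δ h) \sw_(u, v <- Δ y) \sw_(a, b <- Δ L)
    f (a * x) (b * (u * S v))).
  rewrite (@sw3Sr23 k H _ (fun x v => \sw_(a, b <- Δ L) f (a * x) (b * v))); last by multilin.
  by under [RHS]eq_tl => a b do rewrite mulr1.
rewrite -(@coassoc k H _ (fun x u v => \sw_(a, b <- Δ L) f (a * x) (b * (u * S v)))); last by multilin.
rewrite -[RHS](@swcounitl k H _ (fun x => \sw_(a, b <- Δ L) f a (b * S x))); last by lins.
apply: eq_tl => x y; rewrite -(@linZ k (tensor H H) W (tlift _)); last exact: tlift_is_linear.
rewrite -linearZ -Lh (@swM k H _ (fun a b => f a (b * S y))); last by multilin.
by rewrite tlC; apply: eq_tl => u v; apply: eq_tl => a b; rewrite mulrA.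
Qed.

(** Λ and λ form a Frobenius system: the Λ₁ and the functionals
    h ↦ λ(Λ₂ S(h)) are dual families. *)
Lemma frobenius_l h : \sw_(a, b <- Δ L) (lam (b * S h) : k) *: a = h.
Proof.
rewrite -(@swL_r _ (fun a b : H => (lam b : k) *: a)); last by multilin.
under eq_tl => a b do rewrite scalerAl.
rewrite -(@lin_tl k H H H H (fun x => x * h)); last by lins.
by rewrite lam_leftE lamL scale1r mul1r.
Qed.

Lemma S_eq0 h : S h = 0 -> h = 0.
Proof.
move=> Sh; rewrite -(frobenius_l h) Sh tl_pair big1 // => p _.
by rewrite mulr0 linear0 scale0r scaler0.
Qed.

Lemma S_inj : injective (S : H -> H).
Proof.
move=> x y xy; apply/eqP; rewrite -subr_eq0; apply/eqP/S_eq0.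
by rewrite linearB /= xy subrr.
Qed.

Lemma S_surj h : exists x, h = S x.
Proof.
have k0 : lker (S : 'End(H)) == 0%VS by apply/lker0P; exact: S_inj.
by exists ((S^-1)%VF h); rewrite lker0_lfunVK.
Qed.

Lemma SL : S L = L.
Proof.
case: intL => hL Lh _ _.
have: L * S L = S L.
  have [x Lx] := S_surj L.
  by rewrite {1}Lx -SM Lh linearZ /= -counitS -Lx counitL scale1r.
by rewrite Lh counitS counitL scale1r => <-.
Qed.

Lemma lam_right h : \sw_(a, b <- Δ h) (lam (S a) : k) *: b = (lam (S h) : k) *: (1 : H).
Proof.
apply: S_inj; rewrite linearZ /= S1 -lam_leftE.
rewrite (@swS k H H (fun a b => (lam b : k) *: a)); last by multilin.
rewrite (@lin_tl k _ _ _ _ (fun x => S x)); last by lins.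
by apply: eq_tl => a b; rewrite linearZ.
Qed.

(** Write h = S(x) and expand μ(Λ) x along Λ by means of μ. Applying the
    right integral λ ∘ S to the expansion leaves μ(S(x)), and applying it to
    μ(Λ) x leaves μ(Λ) λ(S(x)). *)
Lemma left_integral_uniq (mu : H -> k^o) : lin mu ->
  (forall h, \sw_(a, b <- Δ h) (mu b : k) *: a = (mu h : k) *: (1 : H)) ->
  forall h, mu h = (mu L : k) * lam h.
Proof.
move=> lmu muE h; have [x ->] := S_surj h.
(* frobenius_l with mu in place of lam *)
have mu_h y : \sw_(a, b <- Δ L) (mu (b * S y) : k) *: a = (mu L : k) *: y.
  rewrite -(@swL_r _ (fun a b => (mu b : k) *: a)); last by multilin.
  under eq_tl => a b do rewrite scalerAl.
  rewrite -(@lin_tl k H H H H (fun x => x * y)); last by lins.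
  by rewrite muE -scalerAl mul1r.
have <- : lam (S ((mu L : k) *: x)) = (mu L : k) * lam (S x) by rewrite !linearZ.
rewrite -mu_h !(@lin_tl k _ _ _ _ (fun y : H => lam (S y))); last by lins.
have e1 : \sw_(a, b <- Δ L) (lam (S a) : k) *: b = 1 by rewrite lam_right SL lamL scale1r.
rewrite -[S x]mul1r -{1}e1 (@lin_tl k _ _ _ _ (fun y : H => mu (y * S x))); last by lins.
by apply: eq_tl => a b; rewrite -scalerAl linZ // !linearZ /= mul1r; exact: mulrC.
Qed.

Lemma lam_nondeg x : (forall a, lam (x * a) = 0) -> x = 0.
Proof.
move=> x0; apply: S_eq0; rewrite -(frobenius_l (S x)) tl_pair big1 // => p _.
by rewrite -lam_twist_trace x0 scale0r scaler0.
Qed.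

(** The distinguished grouplike element: it measures how far the left
    integral λ is from being a right integral. *)
Definition modular_elt : H := \sw_(a, b <- Δ L) (lam a : k) *: b.
Local Notation g := modular_elt.

(** For every p the functional h ↦ λ(h₁) p(h₂) is again a left integral,
    hence a multiple of λ. *)
Lemma lam_modular_elt h : \sw_(a, b <- Δ h) (lam a : k) *: b = (lam h : k) *: g.
Proof.
apply: (@eq_dual k H) => p lp.
pose mu h : k^o := \sw_(a, b <- Δ h) (lam a * p b : k^o).
have lmu : lin mu by rewrite /mu; lins.
have muE x : \sw_(a, b <- Δ x) (mu b : k) *: a = (mu x : k) *: (1 : H).
  transitivity (\sw_(a, b <- Δ x) \sw_(b1, b2 <- Δ b) ((lam b1 * p b2 : k) *: a)).
    apply: eq_tl => a b.
    by rewrite (@lin_tl k _ _ _ _ (fun y : k^o => (y : k) *: a)); last by lins.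
  rewrite -(@coassoc k H _ (fun a b1 b2 => (lam b1 * p b2 : k) *: a)); last by multilin.
  rewrite (@lin_tl k _ _ _ _ (fun y : k^o => (y : k) *: (1 : H))); last by lins.
  apply: eq_tl => a b; rewrite mulrC -scalerA -lam_leftE.
  rewrite (@lin_tl k _ _ _ _ (fun y : H => (p b : k) *: y)); last by lins.
  by apply: eq_tl => u v; rewrite scalerA mulrC.
have muEp x : mu x = p (\sw_(a, b <- Δ x) (lam a : k) *: b).
  by rewrite (@lin_tl k _ _ _ _ p) //; apply: eq_tl => a b; rewrite linZ.
by rewrite -muEp (left_integral_uniq lmu muE) linZ // muEp mulrC.
Qed.

Lemma comul_modular_elt : Δ g = g ⊗ g.
Proof.
rewrite /modular_elt (@lin_tl k _ _ _ _ (@comul k H)); last by lins.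
transitivity (\sw_(a, b <- Δ L) \sw_(b1, b2 <- Δ b) ((lam a : k) *: (b1 ⊗ b2))).
  apply: eq_tl => a b; rewrite linearZ /= -[in LHS](tl_id (Δ b)).
  by rewrite (@lin_tl k _ _ _ _ (fun y : tensor H H => (lam a : k) *: y)) //; lins.
rewrite -(@coassoc k H _ (fun a b1 b2 => (lam a : k) *: (b1 ⊗ b2))); last by multilin.
rewrite (@lin_tl k _ _ _ _ (fun y : H => g ⊗ y)); last by lins.
apply: eq_tl => a b.
transitivity ((\sw_(u, v <- Δ a) (lam u : k) *: v) ⊗ b).
  rewrite (@lin_tl k _ _ _ _ (fun y : H => y ⊗ b)); last by lins.
  by apply: eq_tl => u v; rewrite [RHS](@linZ k _ _ (fun y : H => y ⊗ b)) //; lins.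
rewrite lam_modular_elt (@linZ k _ _ (fun y : H => y ⊗ b)); last by lins.
by rewrite [RHS](@linZ k _ _ (fun y : H => g ⊗ y)) //; lins.
Qed.

Lemma counit_modular_elt : counit g = 1.
Proof.
rewrite /modular_elt (@lin_tl k _ _ _ _ (@counit k H)); last by lins.
transitivity (\sw_(a, b <- Δ L) (counit b : k) *: lam a).
  by apply: eq_tl => a b; rewrite linearZ; exact: mulrC.
by rewrite (@swcounitr k H _ (fun x => lam x)) ?lamL //; lins.
Qed.

Lemma modular_eltV : S g * g = 1.
Proof.
have := antipodel g; rewrite comul_modular_elt tliftE ?counit_modular_elt ?scale1r //.
by multilin.
Qed.
Lemma modular_eltVr : g * S g = 1.
Proof.
have := antipoder g; rewrite comul_modular_elt tliftE ?counit_modular_elt ?scale1r //.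
by multilin.
Qed.
Lemma SSmodular_elt : S (S g) = g.
Proof.
have e : S (S g) * S g = 1 by rewrite -SM modular_eltVr S1.
by rewrite -[LHS]mulr1 -modular_eltV mulrA e mul1r.
Qed.

(** The functional λ(· g) is a right integral, so the left-hand side is a left
    integral in h; both sides are 1 at Λ. *)
Lemma lam_S h : lam (S h * g) = lam h.
Proof.
have r w : \sw_(a, b <- Δ w) (lam (a * g) : k) *: b = (lam (w * g) : k) *: (1 : H).
  rewrite -[LHS]mulr1 -modular_eltVr mulrA (@lin_tl k _ _ _ _ (fun y : H => y * g)); last by lins.
  transitivity ((\sw_(a, b <- Δ (w * g)) (lam a : k) *: b) * S g).
    congr (_ * _); rewrite (@swM k H H (fun a b : H => (lam a : k) *: b)); last by multilin.
    apply: eq_tl => a b; rewrite comul_modular_elt tliftE; last by multilin.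
    by rewrite scalerAl.
  by rewrite lam_modular_elt -scalerAl modular_eltVr.
pose mu h : k^o := lam (S h * g).
have lmu : lin mu by rewrite /mu; lins.
have muE x : \sw_(a, b <- Δ x) (mu b : k) *: a = (mu x : k) *: (1 : H).
  apply: S_inj; rewrite linearZ /= S1 -r.
  rewrite (@swS k H H (fun a b => (lam (a * g) : k) *: b)); last by multilin.
  rewrite (@lin_tl k _ _ _ _ (fun x => S x)); last by lins.
  by apply: eq_tl => a b; rewrite linearZ.
have muL : mu L = 1.
  by rewrite /mu SL; case: intL => _ Lh _ _; rewrite Lh linearZ /= counit_modular_elt lamL; exact: mulr1.
by rewrite -[LHS]/(mu h) (left_integral_uniq lmu muE) muL mul1r.
Qed.

(** Radford's formula for S⁴, when H has a two-sided integral. The twist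
    S² is determined by λ through [lam_twist_trace]; computing it through
    λ(S(h) g) as well, which is λ by [lam_S], gives its inverse up to
    conjugation by g. *)
Lemma antipode4_conj c : S (S (S (S c))) = S g * c * g.
Proof.
suff e : c = g * S (S (S (S c))) * S g.
  by rewrite {2}e !mulrA modular_eltV mul1r -mulrA modular_eltV mulr1.
apply/eqP; rewrite -subr_eq0; apply/eqP/lam_nondeg => a.
rewrite mulrBl linearB /= lam_twist_trace.
rewrite -[lam (a * _)]lam_S SM -mulrA lam_twist_trace.
suff -> : lam (g * S (S (S (S c))) * S g * a) =
          lam (S a * g * S (S (S (S (S c))))) by rewrite subrr.
rewrite -[LHS]lam_S !SM SSmodular_elt -!mulrA modular_eltV mulr1.
by rewrite !mulrA.
Qed.

End Frobenius.

(** * The Drinfeld element and grouplike elements *)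

Section Drinfeld.
Variables (k : fieldType) (H : hopfAlgType k).
Implicit Types (h x y a b c : H).
Variables (L : H) (intL : idempotent_integral L).
Variables (r : tensor H H) (Rr : is_universal_R r).

Lemma R_comul (W : lmodType k) (f : H -> H -> W) h : is_bilinear f ->
  \sw_(a, b <- r) \sw_(c, d <- Δ h) f (a * c) (b * d)
  = \sw_(a, b <- r) \sw_(c, d <- Δ h) f (d * a) (c * b).
Proof.
move=> bf; case: Rr => _ Rh _ _; rewrite -tlM // Rh tlM //.
rewrite [LHS]tl_tens; last by case: bf => f1 f2; multilin.
by rewrite tlC.
Qed.

Lemma R_VR (W : lmodType k) (f : H -> H -> W) : is_bilinear f ->
  \sw_(a, b <- r) \sw_(c, d <- r^-1) f (a * c) (b * d) = f 1 1.
Proof.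
move=> bf; case: Rr => ur _ _ _.
by rewrite -tlM // divrr // -tens1 tliftE.
Qed.

Definition drinfeld : H := \sw_(a, b <- r) (S b * a).
Local Notation u := drinfeld.

(** Both sides are values of Σ S²(h₃) S(R² h₂) R¹ h₁: either contract
    h₂ with h₃, or exchange h₁ and h₂ by R Δ = Δᵒᵖ R and then contract them. *)
Lemma drinfeldE h : u * h = S (S h) * u.
Proof.
transitivity (\sw_(x, y <- Δ h) \sw_(a, b <- r) \sw_(c, d <- Δ x)
   (S (S y) * S (b * d) * (a * c))).
  rewrite tlC.
  transitivity (\sw_(a, b <- r) (S b * a * h)).
    by rewrite (@lin_tl k _ _ _ _ (fun y : H => y * h)) //; lins.
  apply: eq_tl => a b.
  rewrite (@coassoc k H _ (fun c d y => S (S y) * S (b * d) * (a * c))); last by multilin.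
  rewrite -[LHS]mul1r -S1 -(@sw3Sr23 k H H (fun x y => S y * (S b * a * x))); last by multilin.
  by apply: eq_tl => x y; apply: eq_tl => c d; rewrite !SM !mulrA.
transitivity (\sw_(x, y <- Δ h) \sw_(a, b <- r) \sw_(c, d <- Δ x)
   (S (S y) * S (c * b) * (d * a))).
  apply: eq_tl => x y; apply: (@R_comul _ (fun a b => S (S y) * S b * a)).
  by multilin.
rewrite tlC.
transitivity (\sw_(a, b <- r) (S (S h) * (S b * a))); last first.
  by rewrite -(@lin_tl k _ _ _ _ (fun y : H => S (S h) * y)) //; lins.
apply: eq_tl => a b.
rewrite (@coassoc k H _ (fun c d y => S (S y) * S (c * b) * (d * a))); last by multilin.
transitivity (\sw_(x, y <- Δ h) \sw_(c, d <- Δ y) (S (S d) * (S b * (S x * c * a)))).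
  by apply: eq_tl => x y; apply: eq_tl => c d; rewrite SM !mulrA.
rewrite (@sw3Sl12 k H H (fun x y => S (S y) * (S b * (x * a)))); last by multilin.
by rewrite mul1r.
Qed.

(** The inverse is Σ S⁻¹(R̄²) R̄¹, where R̄ = R⁻¹. *)
Lemma drinfeld_inv : exists2 v, u * v = 1 & v * u = 1.
Proof.
have k0 : lker (S : 'End(H)) == 0%VS by apply/lker0P; exact: S_inj intL.
pose T : 'End(H) := (S^-1)%VF.
have ST x : S (T x) = x by rewrite lker0_lfunVK.
pose v := \sw_(c, d <- r^-1) (T d * c).
have uv : u * v = 1.
  rewrite /v (@lin_tl k _ _ _ _ (fun y : H => u * y)); last by lins.
  rewrite -[RHS]mulr1 -{1}S1 -(@R_VR _ (fun a b => S b * a)); last by multilin.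
  rewrite tlC; apply: eq_tl => c d; rewrite mulrA drinfeldE ST /u.
  rewrite -mulrA (@lin_tl k _ _ _ _ (fun y : H => S d * (y * c))); last by lins.
  by apply: eq_tl => a b; rewrite SM !mulrA.
exists v => //.
(* left multiplication by v is injective, hence onto: v is a two-sided inverse *)
pose Lv : 'End(H) := linfun (fun x => v * x).
have LvE x : Lv x = v * x by rewrite /Lv lin_linfunE //; lins.
have kv : lker Lv == 0%VS.
  apply/lker0P => x y; rewrite !LvE => /(congr1 ( *%R u)).
  by rewrite !mulrA uv !mul1r.
have vw : v * ((Lv^-1)%VF 1) = 1 by rewrite -LvE lker0_lfunVK.
have uw : u = (Lv^-1)%VF 1 by rewrite -[LHS]mulr1 -{1}vw mulrA uv mul1r.
by rewrite uw; exact: vw.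
Qed.
End Drinfeld.

Section GroupLike.
Variables (k : fieldType) (H : hopfAlgType k) (g g' : H).
Hypotheses (gg : Δ g = g ⊗ g) (g'g : g' * g = 1).

(** In a first linear dependence g^m = Σ c_i g^i, i < m, comultiplication
    gives c_i c_j = δ_ij c_i, so that g^m = g^i for some i < m. *)
Lemma grouplike_order : exists2 N, (0 < N)%N & g ^+ N = 1.
Proof.
have comulX i : Δ (g ^+ i) = g ^+ i ⊗ g ^+ i.
  elim: i => [|i IH]; first by rewrite !expr0 comul1.
  by rewrite !exprS comulM gg IH tensM.
have X0 i : g ^+ i != 0.
  apply/eqP => gi; have : g' ^+ i * g ^+ i = 1.
    elim: i {gi} => [|i IH]; first by rewrite mulr1.
    by rewrite exprSr exprS mulrA -[_ * g' * g]mulrA g'g mulr1.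
  by rewrite gi mulr0 => /esym/eqP; rewrite oner_eq0.
pose P m := ~~ free [seq g ^+ i | i <- iota 0 m].
have exP : exists m, P m.
  exists (\dim {:H}).+1; rewrite /P; apply/negP => /eqP.
  rewrite size_map size_iota => fr.
  set s := [seq _ | i <- _] in fr.
  by have := dimvS (subvf (span s)); rewrite fr ltnn.
have [m Pm minm] := ex_minnP exP.
case: m Pm minm => [|m] Pm minm; first by rewrite /P /= nil_free in Pm.
have fX : free [seq g ^+ i | i <- iota 0 m].
  by apply/negPn/negP => /minm; rewrite ltnn.
pose X := in_tuple [seq g ^+ i | i <- iota 0 m].
have sX : size X = m by rewrite size_map size_iota.
have gX : g ^+ m \in <<X>>%VS.
  apply: contraNT Pm => gX.
  rewrite -addn1 iotaD map_cat /= add0n (perm_free (_ : perm_eq _ (g ^+ m :: X))).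
    by rewrite free_cons gX.
  by rewrite perm_catC.
pose c i := coord X i (g ^+ m).
have gE : g ^+ m = \sum_i c i *: X`_i by apply: coord_span.
have lim (i : 'I_(size [seq g ^+ i | i <- iota 0 m])) : (i < m)%N.
  by have := ltn_ord i; rewrite {2}size_map size_iota.
have Xi (i : 'I_(size [seq g ^+ i | i <- iota 0 m])) : X`_i = g ^+ i.
  by rewrite (nth_map 0%N) ?size_iota ?nth_iota.
pose C l : dual_space H := linfun (coord X l : H -> k^o).
have CE l x : C l x = coord X l x by rewrite lfunE.
(* apply the (i, j)-th coordinate to Δ(g ^ m) = g ^ m ⊗ g ^ m *)
have cc i j : c i * c j = c i *+ (i == j).
  have bil : is_bilinear (fun a b : H => C i a * C j b : k^o) by multilin.
  have := congr1 (tlift (fun a b : H => C i a * C j b : k^o)) (comulX m).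
  rewrite tliftE // !CE => /esym; rewrite {1}/c -/(c j) => ->.
  rewrite gE !linear_sum /= (bigD1 i) //= big1 ?addr0.
    rewrite !linearZ /= Xi comulX tliftE // -Xi !CE !coord_free //.
    by case: (i =P j) => [->|/eqP ij]; rewrite ?eqxx ?(negPf ij) mul1r ?mulr0n ?mulr1n; [exact: mulr1|exact: mulr0].
  move=> l li; rewrite !linearZ /= Xi comulX tliftE // -Xi !CE !coord_free //.
  by rewrite (negPf li) mul0r; exact: mulr0.
have [i ci] : exists i, c i != 0.
  apply/existsP; apply: contraT; rewrite negb_exists => /forallP c0.
  have /eqP[] := X0 m; rewrite gE big1 // => i _.
  by have := c0 i; rewrite negbK => /eqP ->; rewrite scale0r.
have gmi : g ^+ m = g ^+ i.
  rewrite gE (bigD1 i) //= big1 ?addr0.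
    have := cc i i; rewrite eqxx mulr1n -{3}[c i]mulr1 => /(mulfI ci) ->.
    by rewrite scale1r Xi.
  move=> j ji; have := cc i j; rewrite eq_sym (negPf ji) => /eqP.
  by rewrite mulf_eq0 (negPf ci) => /eqP ->; rewrite scale0r.
have im := lim i.
exists (m - i)%N; first by rewrite subn_gt0.
have gK j : g' ^+ j * g ^+ j = 1.
  elim: j => [|j IH]; first by rewrite mulr1.
  by rewrite exprSr exprS mulrA -[_ * g' * g]mulrA g'g mulr1.
rewrite -[LHS]mul1r -(gK i) -mulrA -exprD subnKC ?gmi ?gK //.
exact: ltnW.
Qed.
End GroupLike.

(** * Representations and their characters *)

Section LinAlg.
Variable k : fieldType.

(** P1 and Q1 are coordinates on U, P2 and Q2 coordinates on the quotient
    by U; the operators that preserve U are block triangular in them. *)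
Lemma invariant_blocks m (U : 'M[k]_m) : U != 0 -> ~~ row_full U ->
  exists r s (P1 : 'M[k]_(r, m)) (Q1 : 'M[k]_(m, r))
         (P2 : 'M[k]_(s, m)) (Q2 : 'M[k]_(m, s)),
  [/\ (0 < r < m)%N, (0 < s < m)%N,
      P1 *m Q1 = 1%:M /\ P2 *m Q2 = 1%:M
    & forall A : 'M[k]_m, (U *m A <= U)%MS ->
      [/\ P1 *m A = P1 *m A *m Q1 *m P1,
          A *m Q2 = Q2 *m P2 *m A *m Q2
        & \tr A = \tr (P1 *m A *m Q1) + \tr (P2 *m A *m Q2)]].
Proof.
move=> U0 nU.
have [P2 PQ2] : exists P2 : 'M[k]_(_, _), P2 *m col_base (cokermx U) = 1%:M.
  by apply/row_fullP; apply: col_base_full.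
have [Br rB] : exists Br, row_base (cokermx U) *m Br = 1%:M.
  by apply/row_freeP; apply: row_base_free.
set Q2 := col_base _ in PQ2; have QR : Q2 *m row_base (cokermx U) = cokermx U by exact: mulmx_base.
pose P1 := row_base U; pose Q1 := pinvmx P1.
have rU : (0 < \rank U)%N by rewrite lt0n mxrank_eq0.
have Um : (\rank U < m)%N by rewrite ltn_neqAle rank_leq_row andbT.
have killU p (D : 'M[k]_(p, m)) : (D <= U)%MS -> D *m Q2 = 0.
  rewrite submxE => /eqP DU.
  by rewrite -[D *m Q2]mulmx1 -rB mulmxA -[D *m Q2 *m _]mulmxA QR DU mul0mx.
exists (\rank U), (\rank (cokermx U)), P1, Q1, P2, Q2.
split.
- by rewrite rU Um.
- by rewrite mxrank_coker subn_gt0 Um ltn_subrL rU (leq_trans rU (ltnW Um)).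
- by split=> //; apply: mulmxVp; apply: row_base_free.
move=> A UA.
have P1U : (P1 <= U)%MS by rewrite eq_row_base.
have P1A : P1 *m A = P1 *m A *m Q1 *m P1.
  rewrite mulmxKpV // eq_row_base; apply: submx_trans UA; exact: submxMr.
have DU : (1%:M - Q2 *m P2 <= U)%MS.
  have : (1%:M - Q2 *m P2) *m Q2 = 0.
    by rewrite mulmxBl mul1mx -mulmxA PQ2 mulmx1 subrr.
  by move=> D0; rewrite submxE; apply/eqP; rewrite -(congr1 (mulmx _) QR) mulmxA D0 mul0mx.
have DAQ : (1%:M - Q2 *m P2) *m A *m Q2 = 0.
  by apply: killU; apply: submx_trans UA; apply: submxMr.
have AQ : A *m Q2 = Q2 *m P2 *m A *m Q2.
  by move/eqP: DAQ; rewrite !mulmxBl mul1mx subr_eq0 => /eqP.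
split=> //.
(* 1 - Q2 P2 projects onto U, which P1 and Q1 coordinatize *)
have trD : \tr (A *m (1%:M - Q2 *m P2)) = \tr (P1 *m A *m Q1).
  have -> : 1%:M - Q2 *m P2 = (1%:M - Q2 *m P2) *m Q1 *m P1.
    by rewrite mulmxKpV // eq_row_base.
  have e : P1 *m A *m (1%:M - Q2 *m P2) = P1 *m A.
    rewrite mulmxBr mulmx1 mulmxA (killU _ (P1 *m A)) ?mul0mx ?subr0 //.
    by apply: submx_trans UA; apply: submxMr.
  by rewrite mulmxA mxtrace_mulC !mulmxA e.
have -> : \tr (P2 *m A *m Q2) = \tr (A *m (Q2 *m P2)).
  by rewrite -mulmxA mxtrace_mulC -mulmxA.
by rewrite -trD -mxtraceD -mulmxDr subrK mulmx1.
Qed.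
End LinAlg.

Section Repr.
Variables (k : closedFieldType) (H : hopfAlgType k).

Lemma eigenvalue_ex m (A : 'M[k]_m.+1) : exists c, eigenvalue A c.
Proof.
have /closed_rootP[c rc] : size (char_poly A) != 1 by rewrite size_char_poly.
by exists c; rewrite eigenvalue_root_char.
Qed.

Lemma schur m (rho : {lrmorphism H -> 'M[k]_m.+1}) a :
  irreducible_repr rho -> (forall x, a * x = x * a) ->
  exists c, rho a = c%:M.
Proof.
move=> irr ca; have [c ec] := eigenvalue_ex (rho a)^T; exists c.
pose U := eigenspace (rho a)^T c.
have UM h : (U *m (rho h)^T <= U)%MS.
  apply/eigenspaceP; rewrite -mulmxA -trmx_mul -[rho a *m _]rmorphM ca rmorphM.
  rewrite [rho h * _]/(_ *m _) trmx_mul mulmxA.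
  by have /eigenspaceP -> := submx_refl U; rewrite -scalemxAl.
have /eigenspaceP : (1%:M <= U)%MS by rewrite sub1mx; apply: irr.
by rewrite mul1mx => /(congr1 trmx); rewrite trmxK => ->; rewrite scalemx1 tr_scalar_mx.
Qed.

(** Covers subrepresentations and quotients: on the former Q P may be
    inserted after the first factor, on the latter before the second. *)
Lemma restrict_repr m s (rho : {lrmorphism H -> 'M[k]_m.+1})
    (P : 'M[k]_(s.+1, m.+1)) (Q : 'M[k]_(m.+1, s.+1)) :
  P *m Q = 1%:M ->
  (forall a b, P *m (rho a)^T *m Q *m P *m (rho b)^T *m Q = P *m (rho a)^T *m (rho b)^T *m Q) ->
  exists rho' : {lrmorphism H -> 'M[k]_s.+1},
    forall h, rho' h = (P *m (rho h)^T *m Q)^T.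
Proof.
move=> PQ PQM; pose f h := (P *m (rho h)^T *m Q)^T.
have fl : linear f.
  by move=> a x y; rewrite /f linearP /= linearP /= mulmxDr mulmxDl -scalemxAr -scalemxAl linearP.
have fm : monoid_morphism f.
  split=> [|a b]; first by rewrite /f rmorph1 trmx1 mulmx1 PQ trmx1.
  transitivity ((P *m (rho b)^T *m Q *m (P *m (rho a)^T *m Q))^T).
    by rewrite /f rmorphM -mulmxE; congr (_^T); rewrite trmx_mul !mulmxA PQM.
  by rewrite trmx_mul mulmxE.
pose F := HB.pack_for {lrmorphism H -> 'M[k]_s.+1} f
  (GRing.isLinear.Build k H 'M[k]_s.+1 *:%R f fl)
  (GRing.isMonoidMorphism.Build H 'M[k]_s.+1 f fm).
by exists F.
Qed.

(** By induction along a composition series, since the trace is additive over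
    an invariant subspace and its quotient. *)
Lemma character_decomp n (chi : 'I_n.+1 -> dual_space H) (hchi : enum_irr chi)
    m (rho : {lrmorphism H -> 'M[k]_m.+1}) :
  exists c : 'I_n.+1 -> nat, forall h, \tr (rho h) = \sum_i (c i)%:R * chi i h.
Proof.
have [j] := ubnP m; elim: j m rho => // j IH m rho mj.
have [irr|nirr] := pselect (irreducible_repr rho).
  case: hchi => _ chiP _.
  have trlin : linear (fun h => \tr (rho h) : k^o).
    by move=> a x y; rewrite !linearP.
  have [i chii] : exists i, chi i = linfun (fun h => \tr (rho h) : k^o).
    apply/chiP; exists m, rho; split=> // h.
    by rewrite lin_linfunE.
  exists (fun l => (l == i) : nat) => h; rewrite (bigD1 i) //= big1 ?addr0.
    by rewrite eqxx mul1r chii lin_linfunE.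
  by move=> l /negPf ->; rewrite mul0r.
have {nirr}[U [UM U0 nU]] : exists U : 'M[k]_m.+1,
   [/\ forall h, (U *m (rho h)^T <= U)%MS, U != 0 & ~~ row_full U].
  apply: contrapT => nex; apply: nirr => U UM U0; apply/negPn/negP => nU.
  by apply: nex; exists U.
have [[|r] [[|s] [P1 [Q1 [P2 [Q2 [/andP[//]rp rm /andP[//]sp sm [PQ1 PQ2] tri]]]]]]] :=
  invariant_blocks U0 nU.
have [a b|r1 r1E] := restrict_repr PQ1 (rho := rho).
  by have [<- _ _] := tri _ (UM a).
have [a b|r2 r2E] := restrict_repr PQ2 (rho := rho).
  by have [_ e _] := tri _ (UM b); rewrite -!mulmxA [in RHS]e !mulmxA.
have [c1 c1E] := IH _ r1 (leq_trans rm mj).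
have [c2 c2E] := IH _ r2 (leq_trans sm mj).
exists (fun i => (c1 i + c2 i)%N) => h.
have [_ _ trE] := tri _ (UM h).
rewrite -mxtrace_tr trE -[\tr (P1 *m _ *m _)]mxtrace_tr -[\tr (P2 *m _ *m _)]mxtrace_tr.
rewrite -r1E -r2E c1E c2E -big_split; apply: eq_bigr => i _ /=.
by rewrite natrD mulrDl.
Qed.

Lemma regular_repr : exists m (rho : {lrmorphism H -> 'M[k]_m.+1}),
  forall h, \tr (rho h) = trL (fun x : H => h * x).
Proof.
have [m [e be]] : exists m (e : m.+1.-tuple H), basis_of fullv e.
  move: (vbasis _) (vbasisP (fullv : {vspace H})).
  case: (\dim _) => [|m] e be; last by exists m, e.
  have := memvf (1 : H); rewrite -(span_basis be) tuple0 span_nil memv0.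
  by rewrite oner_eq0.
pose f h : 'M[k]_m.+1 := \matrix_(i, j) coord e i (h * e`_j).
have eE x : x = \sum_i coord e i x *: e`_i by apply: coord_basis (memvf x).
have fl : linear f.
  move=> a x y; apply/matrixP=> i j.
  by rewrite !mxE mulrDl -scalerAl linearP.
have fm : monoid_morphism f.
  split=> [|a b]; apply/matrixP=> i j; rewrite !mxE.
    by rewrite mul1r coord_free ?(basis_free be) // eq_sym.
  rewrite -mulrA {1}(eE (b * e`_j)) mulr_sumr linear_sum; apply: eq_bigr => l _.
  by rewrite !mxE -scalerAr linearZ /= mulrC.
pose F := HB.pack_for {lrmorphism H -> 'M[k]_m.+1} f
  (GRing.isLinear.Build k H 'M[k]_m.+1 *:%R f fl)
  (GRing.isMonoidMorphism.Build H 'M[k]_m.+1 f fm).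
exists m, F => h; rewrite (@trL_rank1 k H _ _ (fun i x => coord e i (h * x)) (fun i => e`_i)).
- by apply: eq_bigr => i _; rewrite mxE.
- by move=> i a x y; rewrite mulrDr -scalerAr linearP.
- by move=> x; apply: eE.
Qed.
End Repr.

(** * The trace form of a semisimple Hopf algebra *)

Section TraceForm.
Variables (k : closedFieldType) (chark : [pchar k] =i pred0).
Variables (H : hopfAlgType k) (ssH : semisimple H).
Implicit Types (a b h x y z : H).
Local Notation B := (vbasis (fullv : {vspace H})).
Local Notation d := (\dim {:H}).

Lemma natr_eq0 m : (m%:R == 0 :> k) = (m == 0%N).
Proof. by have /pcharf0P := chark. Qed.

Definition regchar : dual_space H := linfun (fun h => trL (fun x : H => h * x) : k^o).
Local Notation X := regchar.

Lemma regcharE h : X h = trL (fun x : H => h * x).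
Proof.
rewrite /X (@lin_linfunE k _ _ (fun h => trL (fun x : H => h * x) : k^o)) //.
by apply: (@trL_lin k H H) => v; lins.
Qed.

Lemma regcharC a b : X (a * b) = X (b * a).
Proof.
rewrite !regcharE; transitivity (trL (fun x : H => a * (b * x))).
  by apply: (@eq_trL k) => x; rewrite mulrA.
rewrite (@trLC k H H (fun y => a * y) (fun x => b * x)); [|by lins|by lins].
by apply: (@eq_trL k) => x; rewrite mulrA.
Qed.

(** By semisimplicity the left ideal H a is H e for an idempotent e, and
    X(e) = 0 says that a space of dimension dim(e H) is zero. *)
Lemma regchar_nondeg a : (forall h, X (a * h) = 0) -> a = 0.
Proof.
move=> Xa; pose f : 'End(H) := linfun (fun x => x * a).
have fE x : f x = x * a by rewrite /f lin_linfunE //; lins.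
have lid : is_left_ideal (limg f).
  move=> h x /memv_imgP[y _ ->]; rewrite fE mulrA -fE; exact/memv_img/memvf.
have [J [lJ IJ IJ0]] := ssH lid.
have : 1 \in (limg f + J)%VS by rewrite IJ memvf.
case/memv_addP => e eI [e' eJ e1].
(* e is a right unit of the left ideal H a, and X e is the dimension of e H *)
have eid x : x \in limg f -> x = x * e.
  move=> xI; have xe' : x * e' = x - x * e by rewrite -[X in X - _]mulr1 e1 mulrDr addrC addKr.
  apply/eqP; rewrite -subr_eq0 -xe' -memv0 -IJ0 memv_cap lJ // andbT xe'.
  by apply: memvB => //; apply: lid.
have Xe : X e = 0.
  by case/memv_imgP: eI => h _ ->; rewrite fE regcharC Xa.
move: Xe; rewrite regcharE trL_idem; [|by lins|by move=> x; rewrite mulrA -eid].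
move/eqP; rewrite natr_eq0 dimv_eq0 => /eqP l0.
have e0 : e = 0.
  apply/eqP; rewrite -memv0 -l0.
  have le : lin (fun x => e * x) by lins.
  by rewrite -{1}[e]mulr1 -(lin_linfunE le); exact/memv_img/memvf.
by rewrite [LHS]eid ?e0 ?mulr0 // -[a]mul1r -fE; exact/memv_img/memvf.
Qed.

Lemma dual_basis : exists y : 'I_d -> H,
  (forall z, z = \sum_(i < d) (X (y i * z) : k) *: B`_i) /\
  (forall z, z = \sum_(i < d) (X (B`_i * z) : k) *: y i).
Proof.
pose G : 'M[k]_d := \matrix_(i, j) X (B`_i * B`_j).
have uG : G \in unitmx.
  rewrite -row_free_unit -kermx_eq0; apply/rowV0P => v /sub_kermxP vG.
  have : \sum_(i < d) v 0 i *: B`_i = 0.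
    apply: regchar_nondeg => h; rewrite (coord_vbasis (memvf h)) mulr_sumr linear_sum big1 // => j _.
    rewrite -scalerAr linearZ /= mulr_suml linear_sum /=.
    under eq_bigr => i _ do rewrite -scalerAl linearZ /=.
    have := congr1 (fun M : 'rV[k]_d => M 0 j) vG; rewrite !mxE /= => e.
    apply: etrans (mulr0 (coord B j h)); congr (_ * _); rewrite -[RHS]e.
    by apply: eq_bigr => i _; rewrite mxE.
  move/freeP: (basis_free (vbasisP (fullv : {vspace H}))) => /(_ (fun i => v 0 i)) fr /fr v0.
  by apply/rowP => i; rewrite mxE v0.
pose y i := \sum_(j < d) invmx G i j *: B`_j.
have yB i (j : 'I_d) : X (y i * B`_j) = (i == j)%:R.
  rewrite /y mulr_suml linear_sum /=.
  have := congr1 (fun M : 'M[k]_d => M i j) (mulVmx uG); rewrite !mxE => <-.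
  by apply: eq_bigr => l _; rewrite -scalerAl linearZ mxE.
have zE z : z = \sum_(i < d) (X (y i * z) : k) *: B`_i.
  rewrite [LHS](coord_vbasis (memvf z)); apply: eq_bigr => i _; congr (_ *: _).
  rewrite [in RHS](coord_vbasis (memvf z)) mulr_sumr linear_sum /= (bigD1 i) //=.
  rewrite -scalerAr linearZ /= yB eqxx big1 ?addr0; first by rewrite [RHS]mulr1.
  by move=> j ji; rewrite -scalerAr linearZ /= yB eq_sym (negPf ji) [LHS]mulr0.
exists y; split=> // z; apply/eqP; rewrite -subr_eq0; apply/eqP/regchar_nondeg => h.
rewrite mulrBl linearB /= mulr_suml linear_sum /= {1}(zE h) mulr_sumr linear_sum /=.
apply/eqP; rewrite subr_eq0; apply/eqP/eq_bigr => i _.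
rewrite -scalerAr -scalerAl !linearZ /= [X (z * _)]regcharC; exact: mulrC.
Qed.

(** The map is c(b) = Σ x_i b y_i, for families x_i, y_i dual for the trace form
    of X. *)
Lemma casimir : exists c : H -> H,
  [/\ forall a b, a * c b = c b * a,
      forall a b, trL (fun x : H => a * x * b) = X (a * c b)
    & forall (p : dual_space H) b, (forall x y, p (x * y) = p (y * x)) -> p (c b) = p b].
Proof.
have [y [zE zE']] := dual_basis.
have tr1 (f : H -> H) : lin f -> trL f = \sum_(i < d) X (y i * f B`_i).
  move=> lf; rewrite (@trL_rank1 k H 'I_d f (fun (i : 'I_d) x => X (y i * x)) (fun i : 'I_d => f B`_i)) //.
    by move=> i; lins.
  by move=> x; rewrite {1}(zE x) linS //; apply: eq_bigr => i _; rewrite linZ.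
have tr2 (f : H -> H) : lin f -> trL f = \sum_(i < d) X (B`_i * f (y i)).
  move=> lf; rewrite (@trL_rank1 k H 'I_d f (fun (i : 'I_d) x => X (B`_i * x)) (fun i => f (y i))) //.
    by move=> i; lins.
  by move=> x; rewrite {1}(zE' x) linS //; apply: eq_bigr => i _; rewrite linZ.
have c1 : \sum_(i < d) y i * B`_i = 1.
  apply/eqP; rewrite -subr_eq0; apply/eqP/regchar_nondeg => h.
  rewrite mulrBl linearB /= mul1r [X in _ - X]regcharE tr2; last by lins.
  rewrite mulr_suml linear_sum /=; apply/eqP; rewrite subr_eq0; apply/eqP/eq_bigr => i _.
  by rewrite -mulrA regcharC mulrA.
exists (fun b => \sum_(i < d) B`_i * b * y i); split=> [a b|a b|p b pC].
- rewrite mulr_sumr mulr_suml.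
  transitivity (\sum_(i < d) \sum_(j < d) (X (y j * (a * B`_i)) : k) *: (B`_j * b * y i)).
    apply: eq_bigr => i _; rewrite !mulrA {1}(zE (a * B`_i)) !mulr_suml.
    by apply: eq_bigr => j _; rewrite !scalerAl.
  rewrite exchange_big /=; apply: eq_bigr => j _.
  rewrite -[RHS]mulrA [in RHS](zE' (y j * a)) mulr_sumr; apply: eq_bigr => i _.
  by rewrite -scalerAr [in RHS]regcharC -[in RHS](mulrA (y j)).
- rewrite tr1; last by lins.
  rewrite mulr_sumr linear_sum; apply: eq_bigr => i _.
  by rewrite regcharC !mulrA.
- rewrite linear_sum /= -[b in RHS]mul1r -c1 mulr_suml linear_sum.
  by apply: eq_bigr => i _; rewrite pC !mulrA.
Qed.

Variables (n : nat) (chi : 'I_n.+1 -> dual_space H) (hchi : enum_irr chi).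

Lemma chi_repr i : exists m (rho : {lrmorphism H -> 'M[k]_m.+1}),
  irreducible_repr rho /\ forall h, chi i h = \tr (rho h).
Proof. by case: hchi => _ P _; apply/P; exists i. Qed.

Lemma chiC i a b : chi i (a * b) = chi i (b * a).
Proof.
have [m [rho [_ chiE]]] := chi_repr i.
by rewrite !chiE !rmorphM -!mulmxE mxtrace_mulC.
Qed.

Lemma chi1 i : exists m : nat, chi i 1 = m.+1%:R.
Proof.
have [m [rho [_ chiE]]] := chi_repr i; exists m.
by rewrite chiE rmorph1 mxtrace1.
Qed.

Lemma chi1_neq0 i : chi i 1 != 0.
Proof. by have [m ->] := chi1 i; rewrite natr_eq0. Qed.

Lemma chi_central i a h : (forall x, a * x = x * a) ->
  chi i (a * h) = chi i a * chi i h / chi i 1.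
Proof.
move=> ca; have [m [rho [irr chiE]]] := chi_repr i.
have [c rc] := schur irr ca.
apply: (canRL (mulfK (chi1_neq0 i))).
have rM : rho (a * h) = c *: rho h by rewrite rmorphM /= rc -mulmxE mul_scalar_mx.
rewrite !chiE rM rc rmorph1 linearZ /=.
by rewrite mxtrace1 mxtrace_scalar -[c *+ _]mulr_natr mulrAC.
Qed.

Lemma regchar_decomp : exists mu : 'I_n.+1 -> nat,
  forall h, X h = \sum_i (mu i)%:R * chi i h.
Proof.
have [m [rho rhoE]] := regular_repr H.
have [mu muE] := character_decomp hchi rho.
by exists mu => h; rewrite regcharE -rhoE muE.
Qed.

(** The left-hand side is X(a c(b)) with c(b) central, so Schur's lemma
    evaluates each character of it. What matters later is that the coefficients
    are non-negative and rational. *)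
Lemma trace_two_sided (mu : 'I_n.+1 -> nat) :
  (forall h, X h = \sum_i (mu i)%:R * chi i h) -> forall a b,
  trL (fun x : H => a * x * b) = \sum_i (mu i)%:R / chi i 1 * (chi i a * chi i b).
Proof.
move=> muE a b; have [c [cc trc pc]] := casimir.
rewrite trc muE; apply: eq_bigr => i _.
have cc' x : c b * x = x * c b by rewrite cc.
rewrite cc chi_central // pc; last by move=> x y; exact: chiC.
by rewrite [chi i b * _]mulrC -[RHS]mulrA; congr (_ * _); exact: mulrC.
Qed.

Lemma central_eq0 z : (forall x, z * x = x * z) -> (forall i, chi i z = 0) -> z = 0.
Proof.
move=> cz z0; apply: regchar_nondeg => h; have [mu ->] := regchar_decomp.
by rewrite big1 // => i _; rewrite chi_central // z0 !mul0r mulr0.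
Qed.

(** A tracial p is X(a ·) for an element a, which is then central and acts by a
    scalar in each irreducible representation. *)
Lemma tracial_span (p : dual_space H) : (forall x y, p (x * y) = p (y * x)) ->
  p \in character_algebra chi.
Proof.
move=> pC; have [y [zE _]] := dual_basis; have [mu muE] := regchar_decomp.
pose a := \sum_(i < d) (p B`_i : k) *: y i.
have pE h : p h = X (a * h).
  rewrite {1}(zE h) /a mulr_suml !linear_sum; apply: eq_bigr => i _.
  by rewrite -scalerAl !linearZ; exact: mulrC.
have ca x : a * x = x * a.
  apply/eqP; rewrite -subr_eq0; apply/eqP/regchar_nondeg => h.
  by rewrite mulrBl linearB /= -!mulrA -pE regcharC -mulrA -pE pC subrr.
have -> : p = \sum_i ((mu i)%:R * (chi i a / chi i 1) : k) *: chi i.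
  apply/lfunP => h; rewrite pE muE sum_lfunE; apply: eq_bigr => i _.
  by rewrite scale_lfunE chi_central //= -[RHS]/(_ * _) -!mulrA; congr (_ * (_ * _)); rewrite mulrC.
apply: memv_suml => i _; apply: memvZ; apply: memv_span; exact: codom_f.
Qed.

Lemma span_tracial (p : dual_space H) : p \in character_algebra chi ->
  forall x y, p (x * y) = p (y * x).
Proof.
move=> /coord_span -> x y; rewrite !sum_lfunE; apply: eq_bigr => j _.
rewrite !scale_lfunE; congr (_ *: _).
have /codomP[i ->] : (codom chi)`_j \in codom chi.
  by apply: mem_nth; rewrite size_codom.
exact: chiC.
Qed.

Variables (L : H) (intL : idempotent_integral L).

(** Λ is central and acts by a scalar; if that scalar is non-zero then
    hΛ = ε(h)Λ forces the representation to be ε. *)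
Lemma chiL i : i != ord0 -> chi i L = 0.
Proof.
case: intL => hL Lh LL L0 i0; apply/eqP; apply: contraT => cL.
have [m [rho [irr chiE]]] := chi_repr i.
have [c rc] : exists c, rho L = c%:M by apply: schur irr _ => x; rewrite hL Lh.
have c0 : c != 0.
  by apply: contraNneq cL => c0; rewrite chiE rc c0 mxtrace_scalar mul0rn.
have rE h : rho h = (counit h)%:M.
  have e1 : rho (h * L) = c *: rho h by rewrite rmorphM /= rc -mulmxE mul_mx_scalar.
  have e2 : rho (h * L) = (counit h : k) *: c%:M by rewrite hL linearZ /= rc.
  apply: (scalerI c0); rewrite -e1 e2 !scale_scalar_mx; congr (_%:M); exact: mulrC.
have m0 : m = 0%N.
  have U0 : (delta_mx 0 0 : 'M[k]_m.+1) != 0.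
    by apply/eqP => /matrixP/(_ 0 0)/eqP; rewrite !mxE eqxx oner_eq0.
  have := irr (delta_mx 0 0) _ U0; rewrite /row_full mxrank_delta => full.
  have /eqP[] // : (1%N == m.+1); apply: full => h.
  by rewrite rE tr_scalar_mx mul_mx_scalar scalemx_sub.
move: rho irr chiE rc c0 rE; rewrite m0 => rho _ chiE _ _ rE.
case: hchi => injchi _ chi0; case/eqP: i0; apply: injchi; rewrite chi0.
by apply/lfunP => h; rewrite chiE rE mxtrace_scalar.
Qed.

End TraceForm.

(** * The trace of the squared antipode does not vanish *)

Section RootsOfUnity.

Lemma prim_root_ex (k : closedFieldType) M : [pchar k] =i pred0 -> (0 < M)%N ->
  exists w : k, M.-primitive_root w.
Proof.
move=> chark M0; pose p : {poly k} := 'X^M - 1.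
have sp : size p = M.+1 by rewrite size_XnsubC.
have [r pr] := closed_field_poly_normal p.
have mp : lead_coef p = 1 by apply/eqP; apply: monicXnsubC.
rewrite mp scale1r in pr.
have ur : uniq r.
  rewrite -separable_prod_XsubC -pr separable_poly.unlock; apply/coprimepP => q qp qp'.
  rewrite -size_poly_eq1 -dvdp1; have Mk : M%:R != 0 :> k by have/pcharf0P := chark => ->; rewrite -lt0n.
  have e : M%:R *: 1 = 'X * p^`() - p *+ M :> {poly k}.
    rewrite /p derivB derivXn -polyC1 derivC subr0 mulrnAr -exprS prednK // mulrnBl opprB addrCA subrr addr0.
    by rewrite scaler_nat.
  by rewrite -(dvdpZr _ _ Mk) e dvdp_sub // ?dvdp_mull // -mulr_natr dvdp_mulr.
have /hasP[w _ pw] : has M.-primitive_root r.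
  apply: cyclic.has_prim_root => //.
    by apply/allP => x; rewrite -root_prod_XsubC -pr.
  by move: sp; rewrite pr size_prod_XsubC => -[->].
by exists w.
Qed.

(** A rescaling of A is of finite order, hence diagonalizable with
    eigenvalues w^e, and the inverse rescaling of B has the eigenvalues
    w^(M - e). *)
Lemma trace_root_of_unity (k : closedFieldType) m M (w : k) (A B : 'M[k]_m.+1) c :
  M.-primitive_root w -> A * B = 1 -> A ^+ M = c%:M ->
  exists2 e : 'I_m.+1 -> nat, forall i, (e i <= M)%N &
    \tr A * \tr B = (\sum_i w ^+ e i) * (\sum_i w ^+ (M - e i)).
Proof.
move=> pw AB AM; have M0 := prim_order_gt0 pw.
have c0 : c != 0.
  apply/eqP => c0; have : A ^+ M * B ^+ M = 1.
    rewrite -exprMn_comm ?AB ?expr1n // /GRing.comm AB.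
    by apply/esym/(mulmx1C AB).
  by rewrite AM c0 -scalemx1 scale0r mul0r => /esym/eqP; rewrite oner_eq0.
have [s sM] : exists s, s ^+ M = c.
  have /closed_rootP[s] : size ('X^M - c%:P) != 1 by rewrite size_XnsubC // eqSS -lt0n.
  by rewrite rootE !hornerE subr_eq0 => /eqP sc; exists s.
have s0 : s != 0 by apply: contraNneq c0 => s0; rewrite -sM s0 expr0n gtn_eqF.
(* s normalizes A to A' with A' ^ M = 1, without changing tr A * tr B *)
pose A' := s^-1 *: A; pose B' := s *: B.
have A'M : A' ^+ M = 1 by rewrite exprZn AM exprVn sM scale_scalar_mx mulVf.
have A'B' : A' * B' = 1 by rewrite /A' /B' -scalerAl -scalerAr scalerA mulVf // scale1r.
suff [e eM eE] : exists2 e : 'I_m.+1 -> nat, forall i, (e i <= M)%N &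
    \tr A' * \tr B' = (\sum_i w ^+ e i) * (\sum_i w ^+ (M - e i)).
  by exists e => //; rewrite -eE !linearZ /= mulrACA mulVf // mul1r.
have [P uP /(diagonalizable_forLR uP)[D AD]] : diagonalizable A'.
  apply/diagonalizableP; exists [seq w ^+ i | i <- index_iota 0 M].
    rewrite map_inj_in_uniq ?iota_uniq // => i j.
    rewrite !mem_index_iota /= => iM jM /eqP.
    by rewrite (eq_prim_root_expr pw) !modn_small // => /eqP.
  rewrite big_map (factor_Xn_sub_1 pw); apply: mxminpoly_min.
  by rewrite rmorphB rmorphXn /= horner_mx_X rmorph1 A'M subrr.
have PA : P *m A' = diag_mx D *m P.
  by rewrite AD mxpoly.conjVmx // !mulmxA mulmxV // mul1mx.
have rA i : row i P *m A' = D 0 i *: row i P.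
  by rewrite -row_mul PA; apply/rowP => j; rewrite mul_diag_mx !mxE.
have r0 i : row i P != 0.
  apply/eqP => ri; have : row i P *m invmx P = 0 by rewrite ri mul0mx.
  rewrite -row_mul mulmxV // => /rowP/(_ i); rewrite !mxE eqxx => /eqP.
  by rewrite oner_eq0.
have rAl l i : row i P *m A' ^+ l = D 0 i ^+ l *: row i P.
  elim: l => [|l IH]; first by rewrite !expr0 mulmx1 scale1r.
  by rewrite exprS -mulmxE mulmxA rA -scalemxAl IH scalerA exprS.
have DM i : D 0 i ^+ M = 1.
  apply/eqP; rewrite -subr_eq0; apply/eqP.
  have /eqP := rAl M i; rewrite A'M mulmx1 eq_sym -subr_eq0 -[X in _ - X]scale1r -scalerBl.
  by rewrite scaler_eq0 (negPf (r0 i)) orbF => /eqP.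
have De i : {e : 'I_M | D 0 i = w ^+ e} by apply: prim_rootP.
pose e i : nat := sval (De i).
have eM i : (e i <= M)%N by apply: ltnW; exact: ltn_ord.
have eE i : D 0 i = w ^+ e i by rewrite /e; case: (De i).
have Die i : D 0 i * w ^+ (M - e i) = 1.
  by rewrite eE -exprD subnKC // (prim_expr_order pw).
have PB : P *m B' = diag_mx (\row_i w ^+ (M - e i)) *m P.
  apply/row_matrixP => i; rewrite row_mul.
  have -> : row i P *m B' = w ^+ (M - e i) *: (D 0 i *: row i P *m B').
    by rewrite -scalemxAl scalerA mulrC Die scale1r.
  rewrite -rA -mulmxA [A' *m B']A'B' mulmx1.
  by apply/rowP => j; rewrite mul_diag_mx !mxE.
exists e => //; congr (_ * _).
  rewrite AD mxpoly.conjVmx // -mulmxA mxtrace_mulC mulmxK // mxtrace_diag.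
  by apply: eq_bigr => i _; rewrite eE.
have -> : B' = invmx P *m diag_mx (\row_i w ^+ (M - e i)) *m P.
  by rewrite -mulmxA -PB mulKmx.
rewrite -mulmxA mxtrace_mulC mulmxK // mxtrace_diag.
by apply: eq_bigr => i _; rewrite mxE.
Qed.

(** For a complex root of unity w each summand is q_i |Σ w^e|², and the one with
    dm i = 1 and q_i > 0 is positive. To reduce to this case, note that the sum is
    P(w) for a rational polynomial P: a common root of P and X^M - 1 in K makes
    their gcd non-constant, so that they have a common complex root as well. *)
Lemma cyclo_pos (K : fieldType) (phi : {rmorphism rat -> K}) M (w : K) (I : finType)
  (q : I -> rat) (dm : I -> nat) (e : forall i, 'I_(dm i) -> nat) :
  (0 < M)%N -> w ^+ M = 1 -> (forall i, 0 <= q i) -> (forall i l, (e i l <= M)%N) ->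
  (exists2 i, 0 < q i & dm i = 1%N) ->
  \sum_i phi (q i) * ((\sum_l w ^+ e i l) * (\sum_l w ^+ (M - e i l))) != 0.
Proof.
move=> M0 wM q0 eM [i0 qi0 di0].
pose P : {poly rat} := \sum_i q i *: ((\sum_l 'X^(e i l)) * (\sum_l 'X^(M - e i l))).
have PE (L : fieldType) (psi : {rmorphism rat -> L}) (z : L) :
  (map_poly psi P).[z] = \sum_i psi (q i) * ((\sum_l z ^+ e i l) * (\sum_l z ^+ (M - e i l))).
  rewrite rmorph_sum /= horner_sum; apply: eq_bigr => i _.
  rewrite map_polyZ hornerZ rmorphM hornerM /= !rmorph_sum !horner_sum /=.
  by congr (_ * (_ * _)); apply: eq_bigr => l _; rewrite map_polyXn hornerXn.
rewrite -PE; apply/negP => Pw.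
pose Q : {poly rat} := 'X^M - 1.
have QE (L : fieldType) (psi : {rmorphism rat -> L}) (z : L) :
  root (map_poly psi Q) z = (z ^+ M == 1).
  by rewrite rmorphB /= map_polyXn rmorph1 rootE !hornerE subr_eq0.
have rG : root (map_poly phi (gcdp P Q)) w.
  by rewrite gcdp_map root_gcd QE wM eqxx andbT.
(* w is a root of the gcd, so the gcd has a root in any closed field *)
have G1 : size (gcdp P Q) != 1%N.
  apply/eqP => /eqP/size_poly1P[c c0 Gc]; move: rG; rewrite Gc map_polyC rootE hornerC.
  by rewrite fmorph_eq0 (negPf c0).
have /closed_rootP[z] : size (map_poly (ratr : rat -> algC) (gcdp P Q)) != 1%N.
  by rewrite size_map_poly.
rewrite gcdp_map root_gcd QE => /andP[/eqP Pz /eqP zM].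
have zn : `|z| = 1.
  have /eqP := congr1 (fun x => `|x|) zM; rewrite normrX normr1 => /eqP e1.
  by apply/eqP; rewrite -(pexpr_eq1 M0) // e1.
have zz l : (l <= M)%N -> z ^+ (M - l) = (z ^+ l)^*.
  move=> lM; have zl0 : z ^+ l != 0 by rewrite expf_neq0 // -normr_gt0 zn ltr01.
  apply: (mulfI zl0); rewrite -exprD subnKC // zM -normCK normrX zn !expr1n //.
move: Pz; rewrite PE => Pz.
have tE i : (\sum_l z ^+ e i l) * (\sum_l z ^+ (M - e i l)) = `|\sum_l z ^+ e i l| ^+ 2.
  rewrite normCK rmorph_sum; congr (_ * _); apply: eq_bigr => l _; exact: zz.
have nn i : true -> 0 <= ratr (q i) * ((\sum_l z ^+ e i l) * (\sum_l z ^+ (M - e i l))).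
  by move=> _; rewrite tE mulr_ge0 ?ler0q // exprn_ge0.
have /eqP : ratr (q i0) * ((\sum_l z ^+ e i0 l) * (\sum_l z ^+ (M - e i0 l))) = 0.
  exact: (psumr_eq0P nn Pz isT).
rewrite tE mulf_eq0 expf_eq0 /= normr_eq0 fmorph_eq0 gt_eqF //=.
have lP : (0 < dm i0)%N by rewrite di0.
rewrite (bigD1 (Ordinal lP)) //= big1 ?addr0.
  by rewrite expf_eq0 -normr_eq0 zn oner_eq0 andbF.
move=> l /eqP[]; apply/val_inj => /=.
by have := ltn_ord l; rewrite {2}di0 ltnS leqn0 => /eqP.
Qed.
End RootsOfUnity.

Section SquareAntipode.
Variables (k : closedFieldType) (chark : [pchar k] =i pred0).
Variables (phi : {rmorphism rat -> k}).
Variables (H : hopfAlgType k) (ssH : semisimple H).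
Variables (r : tensor H H) (Rr : is_universal_R r).
Variables (L : H) (intL : idempotent_integral L).
Variables (n : nat) (chi : 'I_n.+1 -> dual_space H) (hchi : enum_irr chi).
Local Notation d := (\dim {:H}).
Implicit Types (a b h x y z : H).

Lemma natr_injk m1 m2 : m1%:R = m2%:R :> k -> m1 = m2.
Proof.
by rewrite -!(rmorph_nat phi) => /fmorph_inj/eqP; rewrite eqr_nat => /eqP.
Qed.

Lemma regcharL : regchar H L = 1.
Proof.
case: intL => _ Lh _ _; rewrite regcharE.
rewrite (@trL_rank1 k H 'I_1 _ (fun _ x => counit x) (fun=> L)).
- by rewrite big_ord1 (counitL intL).
- by move=> _; lins.
- by move=> x; rewrite big_ord1 Lh.
Qed.

(** λ(1) is the trace of S², which is conjugation by u, so it equals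
    Σ_i (mu_i / χ_i(1)) χ_i(u) χ_i(u⁻¹). By Radford's formula g u² is central,
    and g commutes with u and has finite order N; hence u^(2N) is central and
    acts by a scalar in every irreducible representation, which puts
    [trace_root_of_unity] and then [cyclo_pos] into force. *)
Lemma lam1_neq0 : lam H 1 != 0.
Proof.
have [v uv vu] := drinfeld_inv intL Rr; set u := drinfeld r in uv vu.
have uE h : u * h = S (S h) * u := drinfeldE Rr h.
have SSE h : S (S h) = u * h * v by rewrite uE -mulrA uv mulr1.
have [N N0 gN] := grouplike_order (comul_modular_elt intL) (modular_eltV intL).
set g := modular_elt L in gN.
have ug : u * g = g * u by rewrite uE SSmodular_elt.
pose w := g * u ^+ 2.
have cw c : w * c = c * w.
  have gg : g * S g = 1 := modular_eltVr intL.
  have := antipode4_conj intL c; rewrite !SSE -/g => e.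
  have {}e : u ^+ 2 * c = S g * c * g * u ^+ 2.
    rewrite -e expr2 !mulrA -[_ * v * u]mulrA vu mulr1.
    by rewrite -[_ * v * u]mulrA vu mulr1.
  by rewrite /w -mulrA e !mulrA gg mul1r.
have uN x : u ^+ (2 * N) * x = x * u ^+ (2 * N).
  have -> : u ^+ (2 * N) = w ^+ N.
    rewrite /w exprMn_comm; last by apply: commrX; exact: esym ug.
    by rewrite gN mul1r exprM.
  by apply/commr_sym/commrX; exact: esym (cw x).
have M0 : (0 < 2 * N)%N by rewrite muln_gt0.
have [om pom] := prim_root_ex chark M0.
have [mu muE] := regchar_decomp hchi.
have /all_sig[dm dmE] : forall i, {m | chi i 1 = m.+1%:R}.
  by move=> i; apply: cid; apply: chi1.
have eP i : exists e : 'I_(dm i).+1 -> nat, (forall l, (e l <= 2 * N)%N) /\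
  chi i u * chi i v = (\sum_l om ^+ e l) * (\sum_l om ^+ (2 * N - e l)).
  have [m [rho [irr chiE]]] := chi_repr hchi i.
  have dmm : dm i = m.
    by have := dmE i; rewrite chiE rmorph1 mxtrace1 => /natr_injk[].
  have [c cE] := schur irr uN.
  have rAB : rho u * rho v = 1 by rewrite -rmorphM uv rmorph1.
  have rAM : rho u ^+ (2 * N) = c%:M by rewrite -rmorphXn.
  have [e eM trE] := trace_root_of_unity pom rAB rAM.
  by rewrite dmm; exists e; split=> //; rewrite !chiE trE.
have /all_sig[e eE] i := cid (eP i).
have -> : lam H 1 = \sum_i phi ((mu i)%:R / (dm i).+1%:R) *
   ((\sum_l om ^+ e i l) * (\sum_l om ^+ (2 * N - e i l))).
  rewrite lamE; transitivity (trL (fun x => u * x * v)).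
    by apply: (@eq_trL k) => x; rewrite mul1r SSE.
  rewrite (trace_two_sided chark ssH hchi muE); apply: eq_bigr => i _.
  by have [_ <-] := eE i; rewrite fmorph_div !rmorph_nat dmE.
apply: (@cyclo_pos k phi (2 * N) om _ (fun i => (mu i)%:R / (dm i).+1%:R)
  (fun i => (dm i).+1) e M0 (prim_expr_order pom)).
- by move=> i /=; rewrite divr_ge0 ?ler0n.
- by move=> i l; have [] := eE i.
have chi0 : chi ord0 = counit by case: hchi.
have dm0 : dm ord0 = 0%N.
  by have := dmE ord0; rewrite chi0 counit1 => /(natr_injk (m1 := 1%N))[].
(* the trivial character occurs in X, since X(L) = 1 and chi i L = 0 for the
   other i *)
exists ord0; last by rewrite dm0.
rewrite dm0 divr1 ltr0n lt0n; apply/eqP => mu0.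
have /eqP := regcharL; rewrite muE (bigD1 ord0) //= mu0 mul0r add0r big1.
  by rewrite eq_sym oner_eq0.
by move=> i i0; rewrite (chiL hchi intL i0) mulr0.
Qed.

End SquareAntipode.

(** * The antipode is an involution *)

(** r and t are the dimensions of the eigenspaces of s for 1 and -1 in the
    image of Q. *)
Lemma trace_involution (k : fieldType) (V : vectType k) (Q s : V -> V) :
  2%:R != 0 :> k -> lin Q -> lin s -> (forall x, Q (Q x) = Q x) ->
  (forall x, Q (s x) = s (Q x)) -> (forall x, s (s x) = x) ->
  exists r t : nat, [/\ trL (fun x => s (Q x)) = r%:R - t%:R, trL Q = r%:R + t%:R,
    t = 0%N -> forall x, s (Q x) = Q x
    & forall x, Q x != 0 -> s (Q x) = Q x -> (0 < r)%N].
Proof.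
move=> two lQ ls QQ Qs ss.
(* for e = 1 and e = -1, the projection onto the e-eigenspace of s in the image of Q *)
pose f (e : k) x := 2%:R^-1 *: (Q x + e *: s (Q x)).
have lf e : lin (f e) by rewrite /f; lins.
have fQ e x : f e (Q x) = f e x by rewrite /f QQ.
have fs e x : e * e = 1 -> f e (s x) = e *: f e x.
  move=> ee; rewrite /f Qs ss [RHS]scalerA [e * _]mulrC -scalerA; congr (_ *: _).
  by rewrite scalerDr scalerA ee scale1r addrC.
have ff e x : e * e = 1 -> f e (f e x) = f e x.
  move=> ee; rewrite {2}/f (linZ _ _ (lf e)) (linD _ _ (lf e)) (linZ _ _ (lf e)).
  rewrite fs // fQ scalerA ee scale1r -[f e x in X in _ *: X]scale1r -scalerDl.
  by rewrite scalerA -natr1 mulVf ?scale1r.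
have trf e : trL (f e) = 2%:R^-1 * (trL Q + e * trL (fun x => s (Q x))).
  rewrite /trL mulr_sumr -big_split mulr_sumr; apply: eq_bigr => i _ /=.
  by rewrite linearZ /= linearD /= linearZ.
have half2 (a : k) : 2%:R^-1 * (a + a) = a.
  by rewrite -mulr2n -[a *+ 2]mulr_natl mulrA mulVf // mul1r.
have p1 : (1 : k) * 1 = 1 by rewrite mulr1.
have m1 : (-1 : k) * -1 = 1 by rewrite mulrNN mulr1.
have tp := trL_idem (lf 1) (fun x => ff 1 x p1).
have tm := trL_idem (lf (-1)) (fun x => ff (-1) x m1).
exists (\dim (limg (linfun (f 1)))), (\dim (limg (linfun (f (-1))))).
rewrite -tp -tm !trf mul1r mulN1r; split.
- by rewrite -mulrBr opprB [X in X + _]addrC addrACA subrr addr0 half2.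
- by rewrite -mulrDr addrACA subrr addr0 half2.
- move/eqP; rewrite dimv_eq0 => /eqP l0 x.
  have : f (-1) x = 0.
    by apply/eqP; rewrite -memv0 -l0 -(lin_linfunE (lf _)); exact/memv_img/memvf.
  move/eqP; rewrite /f scaler_eq0 invr_eq0 (negPf two) /= scaleN1r subr_eq0.
  by move/eqP.
- move=> x Qx sQx; rewrite lt0n dimv_eq0; apply: contraNneq Qx => l0.
  have : f 1 x = 0.
    by apply/eqP; rewrite -memv0 -l0 -(lin_linfunE (lf _)); exact/memv_img/memvf.
  move/eqP; rewrite /f scale1r sQx -mulr2n -scaler_nat scalerA mulVf // scale1r.
  by [].
Qed.

Section SS.
Variables (k : closedFieldType) (chark : [pchar k] =i pred0).
Variables (phi : {rmorphism rat -> k}).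
Variables (H : hopfAlgType k) (ssH : semisimple H).
Variables (r : tensor H H) (Rr : is_universal_R r).
Variables (L : H) (intL : idempotent_integral L).
Variables (n : nat) (chi : 'I_n.+1 -> dual_space H) (hchi : enum_irr chi).
Local Notation d := (\dim {:H}).
Implicit Types (a b h x y z : H).

(** The functional λ is non-zero at 1, and [lam_modular_elt] at h = 1 reads
    λ(1) 1 = λ(1) g. *)
Lemma antipode4_id (c : H) : S (S (S (S c))) = c.
Proof.
have l1 := lam1_neq0 chark phi ssH Rr intL hchi.
have g1 : modular_elt L = 1.
  apply: (scalerI l1); rewrite -(lam_modular_elt intL) (@sw1 k H H (fun a b => (lam H a : k) *: b)) //.
  by multilin.
by rewrite (antipode4_conj intL) g1 S1 mul1r mulr1.
Qed.

(** The Frobenius expansion of x turns the trace into Σ p(Λ₁) λ(Λ₃ S³(Λ₂)), and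
    S⁴ = 1 makes Λ₃ S³(Λ₂) the image under S³ of Λ₂ S(Λ₃). *)
Lemma trL_twist (p : dual_space H) :
  trL (fun x => \sw_(a, b <- Δ x) (p a : k) *: S (S b)) = p L * lam H 1.
Proof.
rewrite (@trL_tl k H H H (Δ L) _ (fun a b x => lam H (b * S x))
   (fun a b => \sw_(x, y <- Δ a) (p x : k) *: S (S y))); first last.
- move=> x; rewrite -{1}(frobenius_l intL x).
  have lf : lin (fun x : H => \sw_(a, b <- Δ x) (p a : k) *: S (S b)) by lins.
  rewrite (lin_tl _ _ lf); apply: eq_tl => a b.
  by rewrite (linZ _ _ lf).
- by move=> a b; lins.
transitivity (\sw_(a, b <- Δ L) \sw_(x, y <- Δ a) ((p x : k^o) * lam H (b * S (S (S y))) : k^o)).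
  apply: (@eq_tl k H H k^o) => a b; rewrite (@lin_tl k _ _ _ _ (fun z : H => lam H (b * S z))); last by lins.
  by apply: (@eq_tl k H H k^o) => x y; rewrite !(linearZ, scalerAr) /=  -scalerAr !linearZ.
rewrite (@coassoc k H k^o (fun x y b => (p x : k^o) * lam H (b * S (S (S y))) : k^o)); last by multilin.
rewrite -(S1 H).
transitivity (\sw_(a, b <- Δ L) \sw_(b1, b2 <- Δ b)
   ((p a : k^o) * lam H (S (S (S (b1 * S b2)))) : k^o)).
  apply: (@eq_tl k H H k^o) => a b; apply: (@eq_tl k H H k^o) => b1 b2.
  by rewrite !SM antipode4_id.
rewrite (@sw3Sr23 k H k^o (fun a b => (p a : k^o) * lam H (S (S (S b))) : k^o)); last by multilin.
by rewrite !S1.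
Qed.

Variables (p0 : dual_space H) (p0C : forall x y, p0 (x * y) = p0 (y * x)).
Hypotheses (p0p0 : p0 ∗ p0 = p0) (p0L : p0 L = (d%:R)^-1).

(** Let Q be the projection x ↦ Σ p0(x₁) x₂, which commutes with S². By
    [trL_twist] the trace of S² is d times that of S² Q, and both are differences
    of dimensions of eigenspaces for 1 and -1. So Tr(S²) is a non-zero multiple
    of d = dim H, and since S²(1) = 1 it can only be d; no eigenvalue -1 is
    left. *)
Lemma antipode_involutive x : S (S x) = x.
Proof.
have [v uv vu] := drinfeld_inv intL Rr; set u := drinfeld r in uv vu.
have uE h : u * h = S (S h) * u := drinfeldE Rr h.
have SSE h : S (S h) = u * h * v by rewrite uE -mulrA uv mulr1.
have p0SS h : p0 (S (S h)) = p0 h by rewrite SSE p0C mulrA vu mul1r.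
have two : 2%:R != 0 :> k by rewrite (natr_eq0 chark).
pose Q x : H := \sw_(a, b <- Δ x) (p0 a : k) *: b.
have lQ : lin Q by rewrite /Q; lins.
have lS : lin (fun x : H => S (S x)) by lins.
have QQ y : Q (Q y) = Q y.
  rewrite {2}/Q (lin_tl _ _ lQ).
  transitivity (\sw_(a, b <- Δ y) \sw_(b1, b2 <- Δ b) ((p0 a * p0 b1 : k) *: b2)).
    apply: eq_tl => a b; rewrite (linZ _ _ lQ) /Q.
    rewrite (@lin_tl k _ _ _ _ (fun z : H => (p0 a : k) *: z)); last by lins.
    by apply: eq_tl => b1 b2; rewrite scalerA.
  rewrite -(@coassoc k H H (fun a b1 b2 => ((p0 a * p0 b1 : k) *: b2))); last by multilin.
  apply: eq_tl => a b; rewrite -[in RHS]p0p0 convE.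
  by rewrite (@lin_tl k _ _ _ _ (fun z : k^o => (z : k) *: b)) //; lins.
have QS y : Q (S (S y)) = S (S (Q y)).
  rewrite /Q (@swSS k H H (fun a b => (p0 a : k) *: b)); last by multilin.
  rewrite (lin_tl _ _ lS); apply: eq_tl => a b.
  by rewrite p0SS (linZ _ _ lS).
have [r1 [t1 [tr1 _ _ _]]] := trace_involution two lQ lS QQ QS antipode4_id.
have [r2 [t2 [tr2 tr2' t20 r20]]] := trace_involution two (@lin_id k H) lS (fun _ => erefl) (fun _ => erefl) antipode4_id.
have lam1 : lam H 1 = r2%:R - t2%:R.
  by rewrite -tr2 lamE; apply: (@eq_trL k) => y; rewrite mul1r.
have d2 : d = (r2 + t2)%N.
  by apply: (natr_injk phi); rewrite natrD -tr2' trL_id.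
have e1 : p0 L * lam H 1 = r1%:R - t1%:R.
  rewrite -trL_twist -tr1; apply: (@eq_trL k) => y.
  by rewrite /Q (lin_tl _ _ lS); apply: eq_tl => a b; rewrite (linZ _ _ lS).
have r2P : (0 < r2)%N by apply: (r20 1); rewrite ?oner_eq0 ?S1.
have d0 : d%:R != 0 :> k by rewrite (natr_eq0 chark) d2 -lt0n ltn_addr.
have l1 := lam1_neq0 chark phi ssH Rr intL hchi.
have e2 : (r2 + d * t1 = d * r1 + t2)%N.
  apply: (natr_injk phi); rewrite !natrD !natrM.
  move: e1; rewrite p0L lam1 => /(congr1 ( *%R d%:R)); rewrite mulVKf // mulrBr => e.
  by apply/eqP; rewrite -subr_eq addrAC e subrK.
have t2r2 : r2 <> t2 by move=> rt; move: l1; rewrite lam1 rt subrr eqxx.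
(* r2 - t2 = d (r1 - t1) is non-zero and d = r2 + t2, so r1 - t1 is 1 or -1 and
   one of r2, t2 vanishes; it is t2, because r2 > 0 *)
apply: t20; move: e2 d2 t2r2 r2P; clear.
move: d => D; case: (ltngtP r1 t1) => [lt|gt|->]; last by lia.
- have [c ->] : exists c, t1 = (r1 + c.+1)%N by exists (t1 - r1.+1)%N; lia.
  by nia.
- have [c ->] : exists c, r1 = (t1 + c.+1)%N by exists (r1 - t1.+1)%N; lia.
  by nia.
Qed.

End SS.

(** * Integrals when the antipode is an involution *)

Section Involutory.
Variables (k : closedFieldType) (H : hopfAlgType k).
Hypothesis SS : forall x : H, S (S x) = x.
Implicit Types (a b h x y z : H) (p q : dual_space H).

Section Contraction.
Variable W : lmodType k.

(** S² = 1 allows the two legs to be multiplied in the opposite order, as one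
    sees by replacing h with S(h). *)
Lemma swTr (f : H -> W) h : lin f ->
  \sw_(a, b <- Δ h) f (b * S a) = (counit h : k) *: f 1.
Proof.
move=> lf; rewrite -[h]SS (@swS k H W (fun a b => f (b * S a))); last by multilin.
under eq_tl => a b do rewrite SS.
by rewrite (swSl _ lf) SS counitS.
Qed.
Lemma swTl (f : H -> W) h : lin f ->
  \sw_(a, b <- Δ h) f (S b * a) = (counit h : k) *: f 1.
Proof.
move=> lf; rewrite -[h]SS (@swS k H W (fun a b => f (S b * a))); last by multilin.
under eq_tl => a b do rewrite SS.
by rewrite (swSr _ lf) SS counitS.
Qed.
Lemma sw3Tl12 (f : H -> H -> W) h : is_bilinear f ->
  \sw_(a, b <- Δ h) \sw_(b1, b2 <- Δ b) f (S b1 * a) b2 = f 1 h.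
Proof.
move=> [f1 f2]; rewrite -(@coassoc k H W (fun a b c => f (S b * a) c)); last by multilin.
rewrite -[RHS](@swcounitl k H W (f 1)); last by lins.
apply: eq_tl => a b; by rewrite (@swTl (f^~ b)) //; lins.
Qed.
End Contraction.

Lemma lamC a b : lam H (a * b) = lam H (b * a).
Proof. by rewrite lam_twist_trace SS. Qed.

Lemma lam1 : lam H 1 = (\dim {:H})%:R.
Proof. by rewrite lamE -trL_id; apply: (@eq_trL k) => x; rewrite SS mul1r. Qed.

Variables (L : H) (intL : idempotent_integral L).
Hypothesis lam1_neq0 : lam H 1 != 0.

Lemma modular_elt1 : modular_elt L = 1.
Proof.
apply: (scalerI lam1_neq0); rewrite -(lam_modular_elt intL) (@sw1 k H H (fun a b => (lam H a : k) *: b)) //.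
by multilin.
Qed.

Lemma lamS h : lam H (S h) = lam H h.
Proof. by rewrite -[RHS](lam_S intL) modular_elt1 mulr1. Qed.

Lemma lam_rightE h : \sw_(a, b <- Δ h) (lam H a : k) *: b = (lam H h : k) *: (1 : H).
Proof. by rewrite (lam_modular_elt intL) modular_elt1. Qed.

Lemma frobenius_r h : \sw_(a, b <- Δ L) (lam H (S h * a) : k) *: b = h.
Proof.
rewrite (@swL_l k H L intL H (fun a b => (lam H a : k) *: b)); last by multilin.
under eq_tl => a b do rewrite scalerAr.
rewrite -(@lin_tl k H H H H (fun x => h * x)); last by lins.
by rewrite lam_rightE (lamL intL) scale1r mulr1.
Qed.

(** Λ is cocommutative: its two legs are dual families for the form
    (x, y) ↦ λ(S(x) y), which is symmetric because λ is a trace and λ ∘ S = λ. *)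
Lemma swL_flip (W : lmodType k) (f : H -> H -> W) : is_bilinear f ->
  \sw_(a, b <- Δ L) f a b = \sw_(a, b <- Δ L) f b a.
Proof.
move=> [f1 f2].
transitivity (\sw_(a, b <- Δ L) \sw_(c, e <- Δ L) (lam H (S c * a) : k) *: f e b).
  apply: eq_tl => a b; rewrite -{1}(frobenius_r a) (@lin_tl k _ _ _ _ (fun x => f x b)); last by lins.
  apply: eq_tl => c e; rewrite (@linZ k _ _ (fun x => f x b)); last by lins.
  by congr (_ *: _); rewrite -lamS SM SS.
rewrite tlC; apply: eq_tl => c e.
transitivity (f e (\sw_(a, b <- Δ L) (lam H (S c * a) : k) *: b)); last by rewrite frobenius_r.
rewrite (@lin_tl k _ _ _ _ (f e)); last by lins.
by apply: eq_tl => a b; rewrite (linZ _ _ (f2 _)).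
Qed.

Lemma trL_rhit p : trL (fun x => \sw_(a, b <- Δ x) (p b : k) *: a) = lam H 1 * p L.
Proof.
have lf : lin (fun x : H => \sw_(a, b <- Δ x) (p b : k) *: a) by lins.
rewrite (@trL_tl k H H H (Δ L) _ (fun a b x => lam H (S x * a))
   (fun a b => \sw_(x, y <- Δ b) (p y : k) *: x)); first last.
- move=> x; rewrite -{1}(frobenius_r x) (lin_tl _ _ lf); apply: eq_tl => a b.
  by rewrite (linZ _ _ lf).
- by move=> a b; lins.
transitivity (\sw_(a, b <- Δ L) \sw_(x, y <- Δ b) (lam H (S x * a) * (p y : k^o) : k^o)).
  apply: (@eq_tl k H H k^o) => a b.
  rewrite (@lin_tl k _ _ _ _ (fun z : H => lam H (S z * a))); last by lins.
  apply: (@eq_tl k H H k^o) => x y; rewrite linearZ -scalerAl linearZ; exact: mulrC.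
by rewrite (@sw3Tl12 k^o (fun a b => lam H a * (p b : k^o) : k^o)) //; multilin.
Qed.

(** Averaging over the adjoint action, which projects H onto its centre. *)
Definition adL h : H := \sw_(a, b <- Δ L) (a * h * S b).

Lemma adL_central h x : x * adL h = adL h * x.
Proof.
rewrite /adL (@lin_tl k _ _ _ _ (fun z : H => x * z)); last by lins.
rewrite [RHS](@lin_tl k _ _ _ _ (fun z : H => z * x)); last by lins.
transitivity (\sw_(a, b <- Δ L) (a * h * S (S x * b))).
  rewrite -(@swL_l k H L intL H (fun a b => a * h * S b)); last by multilin.
  by apply: eq_tl => a b; rewrite SS !mulrA.
by apply: eq_tl => a b; rewrite SM SS !mulrA.
Qed.

Lemma tracial_adL p h : (forall x y, p (x * y) = p (y * x)) -> p (adL h) = p h.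
Proof.
move=> pC; rewrite /adL (@lin_tl k _ _ _ _ p); last by lins.
transitivity (\sw_(a, b <- Δ L) (p (S b * a * h) : k^o)).
  by apply: (@eq_tl k H H k^o) => a b; rewrite pC mulrA.
rewrite (@swTl k^o (fun x => p (x * h))); last by lins.
by rewrite (counitL intL) scale1r mul1r.
Qed.

Lemma hit_central p x : (forall x y, p (x * y) = p (y * x)) ->
  (L ↼ p) * x = x * (L ↼ p).
Proof.
move=> pC; rewrite /hit (@lin_tl k _ _ _ _ (fun z : H => z * x)); last by lins.
rewrite [RHS](@lin_tl k _ _ _ _ (fun z : H => x * z)); last by lins.
transitivity (\sw_(a, b <- Δ L) (p a : k) *: (b * S (S x))).
  by apply: eq_tl => a b; rewrite -scalerAl SS.
rewrite -(@swL_r k H L intL H (fun a b => (p a : k) *: b)); last by multilin.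
transitivity (\sw_(a, b <- Δ L) (p (S x * a) : k) *: b).
  by apply: eq_tl => a b; rewrite pC.
rewrite (@swL_l k H L intL H (fun a b => (p a : k) *: b)); last by multilin.
by apply: eq_tl => a b; rewrite scalerAr.
Qed.

Lemma commutator_opE z : commutator_op L z = \sw_(a, b <- Δ z) (a * adL (S b)).
Proof.
apply: eq_tl => a b; rewrite /adL (@lin_tl k _ _ _ _ (fun z : H => a * z)); last by lins.
by apply: eq_tl => x y; rewrite !mulrA.
Qed.

End Involutory.

Section DualAlgebra.
Variables (k : fieldType) (H : hopfAlgType k).
Implicit Types (a b h x y z : H) (p q s : dual_space H).

(** For semisimple H these are the elements of the character algebra, see
    [tracial_span] and [span_tracial]. *)
Definition tracial p := forall x y, p (x * y) = p (y * x).

Lemma hconvA p q s : p ∗ (q ∗ s) = (p ∗ q) ∗ s.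
Proof.
apply/lfunP => h; rewrite !convE.
transitivity (\sw_(a, b <- Δ h) \sw_(b1, b2 <- Δ b) (p a * (q b1 * s b2) : k^o)).
  apply: eq_tl => a b; rewrite convE.
  by rewrite (@lin_tl k _ _ _ _ (fun z : k^o => p a * z : k^o)) //; lins.
rewrite -(@coassoc k H _ (fun a b c => p a * (q b * s c) : k^o)); last by multilin.
apply: eq_tl => a b; rewrite convE.
rewrite (@lin_tl k _ _ _ _ (fun z : k^o => z * s b : k^o)); last by lins.
by apply: (@eq_tl k H H k^o) => x y; rewrite mulrA.
Qed.

Lemma conv1p p : counit ∗ p = p.
Proof. by apply/lfunP => h; rewrite convE (@swcounitl k H k^o p) //; lins. Qed.

Lemma conv_linearl p : lin (fun q => q ∗ p).
Proof.
move=> c u v; apply/lfunP=> h; rewrite add_lfunE scale_lfunE !convE.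
rewrite -tlift_linearf; apply: eq_tl => x y.
by rewrite add_lfunE scale_lfunE mulrDl; congr (_ + _); exact/esym/mulrA.
Qed.

Lemma conv_tracial p q : tracial p -> tracial q -> tracial (p ∗ q).
Proof.
move=> pC qC x y; rewrite !convE.
rewrite (@swM k H k^o (fun a b => p a * q b)); last by multilin.
rewrite (@swM k H k^o (fun a b => p a * q b)); last by multilin.
rewrite tlC; apply: eq_tl => a b; apply: (@eq_tl k H H k^o) => c d.
by rewrite pC qC.
Qed.

Definition dualS p : dual_space H := linfun (fun h => p (S h)).
Lemma dualSE p h : dualS p h = p (S h).
Proof. by rewrite /dualS lin_linfunE //; lins. Qed.
Lemma dualS_tracial p : tracial p -> tracial (dualS p).
Proof. by move=> pC x y; rewrite !dualSE !SM pC. Qed.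
Lemma dualS_conv p q : dualS (p ∗ q) = dualS q ∗ dualS p.
Proof.
apply/lfunP => h; rewrite dualSE !convE.
rewrite (@swS k H k^o (fun a b => p a * q b)); last by multilin.
by apply: (@eq_tl k H H k^o) => a b; rewrite !dualSE mulrC.
Qed.

(** p ⊗ q is tracial on H ⊗ H, hence takes the same value at Δ(h) and at its
    conjugate by R, which is the opposite coproduct. *)
Lemma conv_comm (r : tensor H H) p q : is_universal_R r ->
  tracial p -> tracial q -> p ∗ q = q ∗ p.
Proof.
move=> Rr pC qC; apply/lfunP => h; rewrite !convE.
pose Phi (t : tensor H H) : k^o := \sw_(a, b <- t) (p a * q b : k^o).
have PhiC (s t : tensor H H) : Phi (s * t) = Phi (t * s).
  rewrite /Phi !tlM; [|by multilin|by multilin].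
  rewrite tlC; apply: (@eq_tl k H H k^o) => a b; apply: (@eq_tl k H H k^o) => c d.
  by rewrite pC qC.
case: Rr => ur Rh _ _.
transitivity (Phi (r^-1 * (r * Δ h))); first by rewrite mulKr.
rewrite PhiC Rh mulrK //.
rewrite /Phi tl_tens; last by multilin.
by apply: (@eq_tl k H H k^o) => a b; exact: mulrC.
Qed.

(** The left action p ⇀ x of H* on H. *)
Definition rhit p x : H := \sw_(a, b <- Δ x) (p b : k) *: a.

Lemma rhit_lin p : lin (rhit p). Proof. by rewrite /rhit; lins. Qed.

Lemma rhit_conv p q x : rhit p (rhit q x) = rhit (p ∗ q) x.
Proof.
rewrite {2}/rhit (lin_tl _ _ (rhit_lin p)).
transitivity (\sw_(a, b <- Δ x) \sw_(a1, a2 <- Δ a) (p a2 * q b : k) *: a1).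
  apply: eq_tl => a b; rewrite (linZ _ _ (rhit_lin p)) /rhit.
  rewrite (@lin_tl k _ _ _ _ (fun z : H => (q b : k) *: z)); last by lins.
  by apply: eq_tl => a1 a2; rewrite scalerA mulrC.
rewrite (@coassoc k H H (fun a1 a2 b => (p a2 * q b : k) *: a1)); last by multilin.
apply: eq_tl => a b; rewrite convE.
by rewrite (@lin_tl k _ _ _ _ (fun z : k^o => (z : k) *: a)) //; lins.
Qed.
End DualAlgebra.

(** * Primitive idempotents and class sums *)

Section Idempotents.
Variables (k : closedFieldType) (chark : [pchar k] =i pred0).
Variables (H : hopfAlgType k) (ssH : semisimple H).
Variables (r : tensor H H) (Rr : is_universal_R r).
Variables (L : H) (intL : idempotent_integral L).
Variables (n : nat) (chi F : 'I_n.+1 -> dual_space H).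
Hypotheses (hchi : enum_irr chi) (hF : enum_primitive_idempotents chi F).
Implicit Types (a b h x y z : H) (p q : dual_space H).

Lemma F_prim i : primitive_idempotent_in (character_algebra chi) (F i).
Proof. by case: hF => _ P _; apply/P; exists i. Qed.

Lemma F_tracial i : tracial (F i).
Proof. by case: (F_prim i) => [[Fi _] _ _]; exact: span_tracial Fi. Qed.

Lemma F_idem i : F i ∗ F i = F i.
Proof. by case: (F_prim i) => [[_ ?] _ _]. Qed.

Lemma F_neq0 i : F i != 0.
Proof. by case: (F_prim i). Qed.

Lemma tracial_conv_comm p q : tracial p -> tracial q -> p ∗ q = q ∗ p.
Proof. exact: conv_comm Rr. Qed.

(** The product e = F_i ∗ F_j is an idempotent below both factors, as tracial
    functionals commute; by primitivity it is zero or equal to both. *)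
Lemma F_orth i j : i != j -> F i ∗ F j = 0.
Proof.
move=> ij; pose e := F i ∗ F j.
have cF : F i ∗ F j = F j ∗ F i by apply: tracial_conv_comm; exact: F_tracial.
have ee : e ∗ e = e.
  by rewrite /e -hconvA [F j ∗ _]hconvA -cF -hconvA F_idem hconvA F_idem.
have eT : tracial e by apply: conv_tracial; exact: F_tracial.
have eR : e \in character_algebra chi by apply: (tracial_span chark ssH hchi eT).
have part l : e ∗ F l = e -> F l ∗ e = e -> e = 0 \/ F l = e.
  move=> el le; have [[FR _] _ prim] := F_prim l.
  have lB (u v w : dual_space H) : (u - v) ∗ w = u ∗ w - v ∗ w.
    rewrite (linD _ _ (conv_linearl w)) (linN _ (conv_linearl w)).
    by [].
  have lB' (u v w : dual_space H) : w ∗ (u - v) = w ∗ u - w ∗ v.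
    by rewrite (@linD k _ _ (fun q => w ∗ q) _ _ (conv_linearr w)) (@linN k _ _ (fun q => w ∗ q) _ (conv_linearr w)).
  have i1 : idempotent_in (character_algebra chi) e by split.
  have i2 : idempotent_in (character_algebra chi) (F l - e).
    split; first exact: memvB.
    by rewrite lB !lB' F_idem ee el le subrr subr0.
  have i3 : e ∗ (F l - e) = 0 by rewrite lB' el ee subrr.
  have i4 : (F l - e) ∗ e = 0 by rewrite lB le ee subrr.
  have i5 : F l = e + (F l - e) by rewrite addrC subrK.
  have [->|f0] := prim _ _ i1 i2 i3 i4 i5; first by left.
  by right; apply/eqP; rewrite -subr_eq0 f0.
have [//|Fi] : e = 0 \/ F i = e.
  apply: part; first by rewrite /e -hconvA -cF hconvA F_idem.
  by rewrite /e hconvA F_idem.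
have [//|Fj] : e = 0 \/ F j = e.
  apply: part; first by rewrite /e -hconvA F_idem.
  by rewrite /e cF hconvA F_idem.
by case: hF => inj _ _; case/eqP: ij; apply: inj; rewrite Fi Fj.
Qed.

Lemma F_convE i j : F i ∗ F j = if i == j then F i else 0.
Proof. by case: eqVneq => [->|/F_orth]; rewrite ?F_idem. Qed.

(** The F_i are independent, and as many as the characters that span R(H). *)
Lemma tracial_expand p : tracial p -> exists c : 'I_n.+1 -> k, p = \sum_i c i *: F i.
Proof.
move=> pT; have cl i : lin (fun q => q ∗ F i) by exact: conv_linearl.
pose X := codom_tuple F.
have XE (i : 'I_#|'I_n.+1|) : X`_i = F (enum_val i).
  by rewrite (enum_val_nth ord0) (nth_map ord0) // -cardE.
have fX : free X.
  apply/freeP => c c0 i; have := congr1 (fun q => q ∗ F (enum_val i)) c0.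
  rewrite (linS _ (cl _)) (bigD1 i) //= big1 ?addr0 => [|j ji].
    rewrite (linZ _ _ (cl _)) XE F_idem (lin0 (cl _)) => /eqP.
    by rewrite scaler_eq0 (negPf (F_neq0 _)) orbF => /eqP.
  by rewrite (linZ _ _ (cl _)) XE F_orth ?scaler0 // (inj_eq enum_val_inj).
have XR : (<<X>> <= character_algebra chi)%VS.
  apply/span_subvP => _ /codomP[i ->]; by case: (F_prim i) => [[]].
have eR : (<<X>> = character_algebra chi)%VS.
  apply/eqP; rewrite eqEdim XR /= (eqP fX) size_codom.
  by apply: leq_trans (dim_span _) _; rewrite size_codom.
have : p \in <<X>>%VS by rewrite eR; apply: (tracial_span chark ssH hchi pT).
move/coord_span => pE; exists (fun i => coord X (enum_rank i) p).
rewrite {1}pE (reindex_onto enum_rank enum_val) /=; last by move=> i _; rewrite enum_valK.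
under eq_bigl => i do rewrite enum_rankK eqxx.
by apply: eq_bigr => i _; rewrite XE enum_rankK.
Qed.

Lemma F_coef (c : 'I_n.+1 -> k) j : (\sum_i c i *: F i) ∗ F j = c j *: F j.
Proof.
have cl := @conv_linearl k H (F j).
rewrite (linS _ cl) (bigD1 j) //= big1 ?addr0 => [|i ij].
  by rewrite (linZ _ _ cl) F_idem.
by rewrite (linZ _ _ cl) F_orth ?scaler0.
Qed.

Lemma counit_tracial : tracial (counit : dual_space H).
Proof. by move=> x y; rewrite !counitM mulrC. Qed.

Lemma sum_F : \sum_i F i = counit.
Proof.
have [c cE] := tracial_expand counit_tracial; rewrite cE; apply: eq_bigr => i _.
by rewrite -F_coef -cE conv1p.
Qed.

Lemma central_F z : (forall x, z * x = x * z) -> (forall i, F i z = 0) -> z = 0.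
Proof.
move=> cz z0; apply: (central_eq0 chark ssH hchi) => // i.
have [c ->] := tracial_expand (chiC hchi i).
by rewrite sum_lfunE big1 // => j _; rewrite scale_lfunE z0; exact: mulr0.
Qed.

Lemma F0L : F ord0 L = (\dim {:H})%:R^-1.
Proof.
case: hF => _ _ ->; rewrite scale_lfunE /dual_integral sum_lfunE (bigD1 ord0) //= big1 ?addr0.
  have -> : chi ord0 = counit by case: hchi.
  by rewrite scale_lfunE counit1 (counitL intL) scale1r; exact: mulr1.
by move=> i i0; rewrite scale_lfunE (chiL hchi intL i0); exact: mulr0.
Qed.

Section WithSS.
Hypothesis SS : forall x : H, S (S x) = x.
Local Notation d := (\dim {:H}).

Lemma dim_neq0 : d%:R != 0 :> k.
Proof.
rewrite (natr_eq0 chark) dimv_eq0; apply/eqP => H0.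
by have := memvf (1 : H); rewrite H0 memv0 oner_eq0.
Qed.
Let l1 : lam H 1 != 0. Proof. by rewrite lam1 // dim_neq0. Qed.

(** F_0 ∗ λ is a multiple of F_0, because λ is tracial and F_0 is one of the
    orthogonal idempotents, and it is F_0(1) λ, because λ is an integral. The
    value at Λ gives the factor. *)
Lemma lam_F0 : lam H = d%:R *: F ord0.
Proof.
have lT : tracial (lam H) by move=> x y; apply: lamC.
have [c cE] := tracial_expand lT.
have Fl i : F i ∗ lam H = (F i 1 : k) *: lam H.
  apply/lfunP => h; rewrite convE lam_left ?scale_lfunE //; last by lins.
(* F_0(1) is the sum of the squares of the degrees, divided by d *)
have F01 : F ord0 1 != 0.
  case: hF => _ _ ->; rewrite scale_lfunE /dual_integral sum_lfunE.
  have dmE i := cid (chi1 hchi i); pose dm i := sval (dmE i).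
  have -> : \sum_i ((chi i 1 : k) *: chi i) 1 = (\sum_i (dm i).+1 * (dm i).+1)%N%:R :> k.
    rewrite natr_sum; apply: eq_bigr => i _.
    by rewrite scale_lfunE /dm; case: (dmE i) => m /= ->; rewrite natrM.
  rewrite -[_ *: _]/(_ * _) mulf_neq0 ?invr_neq0 ?dim_neq0 //.
  by rewrite (natr_eq0 chark) (bigD1 ord0) //= addSn.
have e : c ord0 *: F ord0 = (F ord0 1 : k) *: lam H.
  by rewrite -Fl tracial_conv_comm ?cE ?F_coef // -?cE //; exact: F_tracial.
have e' : c ord0 * d%:R^-1 = F ord0 1.
  have := congr1 (fun q : dual_space H => q L) e.
  by rewrite !scale_lfunE F0L (lamL intL) => e2; rewrite -[RHS]mulr1; exact: e2.
apply: (scalerI F01); rewrite -e scalerA -e' mulfVK //.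
exact: dim_neq0.
Qed.

(** The index i* with F_{i*} = F_i ∘ S; the default value never occurs, by
    [F_star]. *)
Definition star i : 'I_n.+1 := xget ord0 [set j | F j = dualS (F i)].

Lemma dualSK p : dualS (dualS p) = p.
Proof. by apply/lfunP => h; rewrite !dualSE SS. Qed.

Lemma F_star i : F (star i) = dualS (F i).
Proof.
suff [j jE] : exists j, F j = dualS (F i).
  by rewrite /star; case: xgetP => [l -> //|/(_ j)/(_ jE)].
case: (hF) => _ primE _; apply/primE.
have TS p : p \in character_algebra chi -> dualS p \in character_algebra chi.
  by move=> pR; apply: (tracial_span chark ssH hchi); apply: dualS_tracial; exact: span_tracial pR.
have [[FR FF] F0 prim] := F_prim i; split.
- by split; [exact: TS|rewrite -dualS_conv FF].
- apply: contra_neq F0 => F0; rewrite -[F i]dualSK F0.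
  by apply/lfunP => h; rewrite dualSE !lfunE.
move=> e f [eR ee] [fR ff] ef fe Fe.
have lS (u v : dual_space H) : dualS (u + v) = dualS u + dualS v.
  by apply/lfunP => h; rewrite add_lfunE !dualSE add_lfunE.
have z0 : dualS 0 = 0 :> dual_space H by apply/lfunP => h; rewrite dualSE !lfunE.
have i1 : idempotent_in (character_algebra chi) (dualS e).
  by split; [exact: TS|rewrite -dualS_conv ee].
have i2 : idempotent_in (character_algebra chi) (dualS f).
  by split; [exact: TS|rewrite -dualS_conv ff].
have i3 : dualS e ∗ dualS f = 0 by rewrite -dualS_conv fe.
have i4 : dualS f ∗ dualS e = 0 by rewrite -dualS_conv ef.
have i5 : F i = dualS e + dualS f by rewrite -lS -Fe dualSK.
have [e0|f0] := prim _ _ i1 i2 i3 i4 i5.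
- by left; rewrite -[e]dualSK e0.
- by right; rewrite -[f]dualSK f0.
Qed.

(** The projection of H onto the i-th conjugacy class, see [conj_classE]. *)
Definition cproj i : H -> H := rhit (F i).

Lemma cproj_lin i : lin (cproj i). Proof. exact: rhit_lin. Qed.

Lemma cproj_idem i x : cproj i (cproj i x) = cproj i x.
Proof. by rewrite /cproj rhit_conv F_idem. Qed.

Lemma cprojE i : trL (cproj i) = d%:R * F i L.
Proof. by rewrite (trL_rhit SS intL l1) (lam1 SS). Qed.

(** Λ is cocommutative, so F_i ∗ p may be evaluated at its second leg, where F_i
    splits off as F_i ⇀. *)
Lemma hit_cproj i p : L ↼ (F i ∗ p) = cproj i (\sw_(a, b <- Δ L) (p b : k) *: a).
Proof.
rewrite /hit (swL_flip SS intL l1); last by multilin.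
rewrite (lin_tl _ _ (cproj_lin i)).
transitivity (\sw_(a, b <- Δ L) \sw_(b1, b2 <- Δ b) (F i b1 * p b2 : k) *: a).
  apply: eq_tl => a b; rewrite convE.
  by rewrite (@lin_tl k _ _ _ _ (fun z : k^o => (z : k) *: a)) //; lins.
rewrite -(@coassoc k H H (fun a b1 b2 => (F i b1 * p b2 : k) *: a)); last by multilin.
apply: eq_tl => a b; rewrite (linZ _ _ (cproj_lin i)) /cproj /rhit.
rewrite (@lin_tl k _ _ _ _ (fun z : H => (p b : k) *: z)); last by lins.
by apply: eq_tl => a1 a2; rewrite scalerA mulrC.
Qed.

(** By the Frobenius expansion every element of H is Σ p(Λ₂) Λ₁ for some p. *)
Lemma conj_classE i : conjugacy_class L (F i) = limg (linfun (cproj i)).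
Proof.
apply/vspaceP => x; apply/idP/idP.
  move=> /conjugacy_classP[p ->]; rewrite hit_cproj.
  by rewrite -(lin_linfunE (cproj_lin i)); exact/memv_img/memvf.
case/memv_imgP => y _ ->; rewrite (lin_linfunE (cproj_lin i)).
apply/conjugacy_classP.
pose p : dual_space H := linfun (fun b => lam H (b * S y) : k^o).
have pE b : p b = lam H (b * S y) by rewrite /p lin_linfunE //; lins.
exists p; rewrite hit_cproj; congr cproj.
rewrite -[LHS](frobenius_l intL); apply: eq_tl => a b.
by rewrite pE.
Qed.

Definition class_dim i : nat := \dim (conjugacy_class L (F i)).

Lemma class_dimE i : (class_dim i)%:R = d%:R * F i L :> k.
Proof.
by rewrite -cprojE /class_dim conj_classE (trL_idem (cproj_lin i) (cproj_idem i)).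
Qed.

Lemma class_dim_neq0 i : (class_dim i)%:R != 0 :> k.
Proof.
rewrite (natr_eq0 chark) /class_dim dimv_eq0 conj_classE; apply: contra_neq (F_neq0 i) => c0.
apply/lfunP => x; rewrite -[LHS](@swcounitl k H k^o (F i)); last by lins.
have : cproj i x = 0.
  apply/eqP; rewrite -memv0 -c0 -(lin_linfunE (cproj_lin i)); exact/memv_img/memvf.
move/(congr1 (@counit k H)); rewrite linear0 /cproj /rhit (@lin_tl k _ _ _ _ (@counit k H)); last by lins.
rewrite lfunE /= => <-; apply: (@eq_tl k H H k^o) => a b.
by rewrite linearZ; exact: mulrC.
Qed.

Lemma class_dim_le i : (class_dim i <= d)%N.
Proof. by rewrite /class_dim; apply/dimvS/subvf. Qed.

Lemma FL_neq0 i : F i L != 0.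
Proof. by have := class_dim_neq0 i; rewrite class_dimE mulf_eq0 negb_or => /andP[]. Qed.

Local Notation eta i := (normalized_class_sum L (F i)).

Lemma etaE i : eta i = (F i L)^-1 *: (L ↼ F i).
Proof.
rewrite /normalized_class_sum -/(class_dim i) class_dimE /class_sum.
rewrite (@linZ k _ _ (fun q => L ↼ q)); last exact: hit_linearr.
by rewrite scalerA invfM mulrAC mulVf ?mul1r // dim_neq0.
Qed.

Lemma etaE' i : eta i = (F i L)^-1 *: \sw_(a, b <- Δ L) (F i b : k) *: a.
Proof. by rewrite etaE /hit (swL_flip SS intL l1) //; multilin. Qed.

Lemma eta_central i x : eta i * x = x * eta i.
Proof.
by rewrite etaE -scalerAl -scalerAr (hit_central SS intL) //; exact: F_tracial.
Qed.

Lemma F_eta j i : F j (eta i) = (i == j)%:R.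
Proof.
rewrite etaE linearZ /= /hit (@lin_tl k _ _ _ _ (F j)); last by lins.
have -> : \sw_(a, b <- Δ L) F j ((F i a : k) *: b) = (F i ∗ F j) L.
  by rewrite convE; apply: (@eq_tl k H H k^o) => a b; rewrite linearZ.
rewrite F_convE; case: eqVneq => [->|ij]; first exact: mulVf (FL_neq0 j).
by rewrite lfunE; exact: mulr0.
Qed.

Lemma central_eta z : (forall x, z * x = x * z) -> z = \sum_i (F i z : k) *: eta i.
Proof.
move=> cz; apply/eqP; rewrite -subr_eq0; apply/eqP/central_F => [x|j].
  rewrite mulrBl mulrBr mulr_suml mulr_sumr cz; congr (_ - _); apply: eq_bigr => i _.
  by rewrite -scalerAl -scalerAr eta_central.
rewrite linearB linear_sum (bigD1 j) //= big1 => [|i ij].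
  by rewrite linearZ /= F_eta eqxx addr0 -[X in _ - X]/(_ * _) mulr1 subrr.
by rewrite linearZ /= F_eta (negPf ij); exact: mulr0.
Qed.

Lemma counit_eta i : counit (eta i) = 1 :> k.
Proof.
rewrite -sum_F sum_lfunE (bigD1 i) //= F_eta eqxx big1 ?addr0 // => j ji.
by rewrite F_eta eq_sym (negPf ji).
Qed.

Lemma adL_eta h : adL L h = \sum_i (F i h : k) *: eta i.
Proof.
rewrite [LHS]central_eta; last by move=> x; rewrite (adL_central SS intL).
by apply: eq_bigr => i _; rewrite (tracial_adL SS intL) //; exact: F_tracial.
Qed.

(** By [adL_eta], T(η_i) = Σ_j (F_j∘S ⇀ η_i) η_j. As η_i is a multiple of
    F_i ⇀ Λ and F_j ∘ S is F_{j*}, only the term with j* = i survives. *)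
Lemma commutator_eta i : commutator_op L (eta i) = eta i * eta (star i).
Proof.
rewrite commutator_opE.
transitivity (\sum_j (\sw_(a, b <- Δ (eta i)) (dualS (F j) b : k) *: a) * eta j).
  under eq_tl => a b do rewrite adL_eta mulr_sumr.
  rewrite -tl_sum; apply: eq_bigr => j _.
  rewrite [RHS](@lin_tl k _ _ _ _ (fun z : H => z * eta j)); last by lins.
  by apply: eq_tl => a b; rewrite dualSE -scalerAl -scalerAr.
have e j : \sw_(a, b <- Δ (eta i)) (dualS (F j) b : k) *: a
   = if star j == i then eta i else 0.
  rewrite -/(rhit _ _) etaE' (linZ _ _ (rhit_lin _)) -/(rhit _ L) rhit_conv -F_star F_convE.
  case: eqVneq => [->|_]; first by [].
  rewrite /rhit tl_pair big1 ?scaler0 // => p _.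
  by rewrite lfunE scale0r scaler0.
have starK j : star (star j) = j.
  by case: hF => inj _ _; apply: inj; rewrite !F_star dualSK.
rewrite (bigD1 (star i)) //= big1 ?addr0 => [|j ji]; first by rewrite e starK eqxx.
rewrite e; case: eqP => [ij|_]; last by rewrite mul0r.
by move: ji; rewrite -ij starK eqxx.
Qed.

(** Since d F_0 = λ, this amounts to λ(η_i η_{i*}), which is evaluated by
    moving η_{i*} across the legs of Λ in η_i, and then using that λ is a right
    integral. *)
Lemma F0_commutator_eta i : F ord0 (commutator_op L (eta i)) = (class_dim i)%:R^-1.
Proof.
rewrite commutator_eta; apply: (mulfI dim_neq0).
transitivity (lam H (eta i * eta (star i))).
  by rewrite lam_F0 scale_lfunE.
rewrite etaE' -scalerAl linearZ /=.
rewrite (@lin_tl k _ _ _ _ (fun z : H => lam H (z * eta (star i)))); last by lins.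
transitivity ((F i L)^-1 * \sw_(a, b <- Δ L) (lam H (a * eta (star i)) * F i b : k^o)).
  congr (_ * _); apply: (@eq_tl k H H k^o) => a b.
  by rewrite -scalerAl linearZ; exact: mulrC.
rewrite (@swL_r k H L intL k^o (fun a b => lam H a * F i b)); last by multilin.
transitivity ((F i L)^-1 * F i (S (eta (star i)))).
  congr (_ * _); move: (S _) => y.
  transitivity (F i ((\sw_(a, b <- Δ L) (lam H a : k) *: b) * y)).
    rewrite (@lin_tl k _ _ _ _ (fun z : H => F i (z * y))); last by lins.
    by apply: (@eq_tl k H H k^o) => a b; rewrite -scalerAl linearZ.
  by rewrite (lam_rightE intL l1) (lamL intL) scale1r mul1r.
rewrite -dualSE -F_star F_eta eqxx class_dimE mulr1 invfM mulrA mulfV ?mul1r //.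
exact: dim_neq0.
Qed.

Lemma class_dim0 : class_dim ord0 = 1%N.
Proof.
have := class_dimE ord0; rewrite F0L mulfV ?dim_neq0 //; have := class_dim_neq0 ord0.
case: (class_dim ord0) => [|m]; first by rewrite eqxx.
by move=> _ /eqP; rewrite -subr_eq0 -natr1 addrK (natr_eq0 chark) => /eqP ->.
Qed.

End WithSS.
End Idempotents.

(** * Identities for the universal R-matrix *)

Section UniversalR.
Variables (k : closedFieldType) (H : hopfAlgType k).
Hypothesis SS : forall x : H, S (S x) = x.
Variables (r : tensor H H) (Rr : is_universal_R r).
Implicit Types (h v w x y : H).

Section Legs.
Variables (W : lmodType k) (f : H -> H -> H -> W).
Hypothesis tf : trilin f.

Let G (t : tensor H H) z := \sw_(x, y <- t) f x y z.
Let bG : is_bilinear G. Proof. by case: tf => [f1 [f2 f3]]; rewrite /G; multilin. Qed.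
Let lG : lin (tlift G). Proof. exact: tlift_is_linear. Qed.
Let GE x y z : G (x ⊗ y) z = f x y z.
Proof. by case: tf => [f1 [f2 f3]]; rewrite /G tliftE //; multilin. Qed.
Let GM t x y z : G (t * (x ⊗ y)) z = \sw_(a, b <- t) f (a * x) (b * y) z.
Proof.
case: tf => [f1 [f2 f3]]; rewrite /G tlM; last by multilin.
by apply: eq_tl => a b; rewrite tliftE //; multilin.
Qed.

Lemma R_id_comul :
  \sw_(x, y <- r) \sw_(y1, y2 <- Δ y) f x y1 y2
  = \sw_(a, b <- r) \sw_(c, e <- r) f (a * c) e b.
Proof.
case: tf => [f1 [f2 f3]].
case: Rr => _ _ _ /(congr1 (tlift G)); rewrite (lin_tl _ _ lG) => e.
transitivity (tlift G (leg13 r * leg12 r)).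
  rewrite -e; apply: eq_tl => x y; rewrite (lin_tl _ _ lG).
  by apply: eq_tl => y1 y2; rewrite tliftE // GE.
rewrite tlM // /leg13 tl_tens; last by multilin.
apply: eq_tl => a b; rewrite /leg12 tliftE; last by multilin.
rewrite mulr1 /G tlM; last by multilin.
rewrite tliftE; last by multilin.
by apply: eq_tl => c e'; rewrite mul1r.
Qed.

Lemma R_comul_id :
  \sw_(x, y <- r) \sw_(x1, x2 <- Δ x) f x1 x2 y
  = \sw_(a, b <- r) \sw_(c, e <- r) f a c (b * e).
Proof.
case: tf => [f1 [f2 f3]].
case: Rr => _ _ /(congr1 (tlift G)) + _; rewrite (lin_tl _ _ lG) => e.
transitivity (tlift G (leg13 r * leg23 r)).
  by rewrite -e; apply: eq_tl => x y; rewrite tliftE.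
rewrite tlM // /leg13 tl_tens; last by multilin.
apply: eq_tl => a b; rewrite /leg23 tl_tens; last by multilin.
by apply: eq_tl => c e'; rewrite GM tliftE ?mulr1 ?mul1r //; multilin.
Qed.
End Legs.

(** Let ρ be the left-hand side. Applying ε in the middle of
    (id ⊗ Δ)(R) = R₁₃ R₁₂ gives R = R (ρ ⊗ 1), and R is invertible. *)
Lemma R_counit : \sw_(a, b <- r) (counit b : k) *: a = 1.
Proof.
set rho := tlift _ _.
have ur : r \is a GRing.unit by case: Rr.
have rE : r = r * (rho ⊗ 1).
  rewrite -[LHS]tl_id.
  transitivity (\sw_(x, y <- r) \sw_(y1, y2 <- Δ y) ((counit y1 : k) *: (x ⊗ y2))).
    apply: eq_tl => x y; rewrite (@swcounitl k H _ (fun y => x ⊗ y)) //; lins.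
  rewrite (@R_id_comul _ (fun x y1 y2 => (counit y1 : k) *: (x ⊗ y2))); last by multilin.
  rewrite -[in RHS](tl_id r) (@lin_tl k _ _ _ _ (fun t : tensor H H => t * (rho ⊗ 1))); last by lins.
  apply: eq_tl => a b; rewrite tensM mulr1 /rho.
  rewrite (@lin_tl k _ _ _ _ (fun t : H => (a * t) ⊗ b)); last by lins.
  apply: eq_tl => c e; rewrite -scalerAr (@linZ k _ _ (fun t : H => t ⊗ b)) //; lins.
have : rho ⊗ 1 = 1 ⊗ 1 :> tensor H H.
  by apply: (mulrI ur); rewrite -rE tens1 mulr1.
move/(congr1 (tlift (fun a b : H => (counit b : k) *: a))).
rewrite !tliftE; [|by multilin|by multilin].
by rewrite counit1 !scale1r.
Qed.

(** By (id ⊗ Δ)(R) = R₁₃ R₁₂, multiplying R by the right-hand side gives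
    Σ R¹ ⊗ (R²)₂ S((R²)₁), which S² = 1 contracts to ε. *)
Lemma R_inv : r^-1 = \sw_(a, b <- r) (a ⊗ S b).
Proof.
have ur : r \is a GRing.unit by case: Rr.
apply: (mulrI ur); rewrite divrr // -tens1.
rewrite -[X in X * _](tl_id r) (@lin_tl k _ _ _ _ (fun t : tensor H H => t * _)); last by lins.
transitivity (\sw_(a, b <- r) \sw_(c, e <- r) ((a * c) ⊗ (b * S e))); last first.
  apply: eq_tl => a b; rewrite (@lin_tl k _ _ _ _ (fun t : tensor H H => (a ⊗ b) * t)); last by lins.
  by apply: eq_tl => c e; rewrite tensM.
rewrite -(@R_id_comul _ (fun x y1 y2 => x ⊗ (y2 * S y1))); last by multilin.
transitivity ((\sw_(a, b <- r) (counit b : k) *: a) ⊗ (1 : H)); first by rewrite R_counit.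
symmetry; rewrite [RHS](@lin_tl k _ _ _ _ (fun t : H => t ⊗ (1 : H))); last by lins.
apply: eq_tl => x y; rewrite (@swTr k H SS _ (fun t => x ⊗ t)); last by lins.
by rewrite [RHS](@linZ k _ _ (fun t : H => t ⊗ (1 : H))) //; lins.
Qed.

Section Inverse.
Variables (W : lmodType k) (f : H -> H -> W).
Hypothesis bf : is_bilinear f.

Lemma R_RS : \sw_(a, b <- r) \sw_(c, e <- r) f (a * c) (b * S e) = f 1 1.
Proof.
have ur : r \is a GRing.unit by case: Rr.
rewrite -(@tliftE k H H W f 1 1) // tens1 -(divrr ur) tlM //.
apply: eq_tl => a b; rewrite R_inv tl_tens //.
by case: bf => f1 f2; multilin.
Qed.

Lemma R_SR : \sw_(a, b <- r) \sw_(c, e <- r) f (a * c) (S b * e) = f 1 1.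
Proof.
have ur : r \is a GRing.unit by case: Rr.
rewrite -(@tliftE k H H W f 1 1) // tens1 -(mulVr ur) tlM // R_inv tl_tens //.
by case: bf => f1 f2; multilin.
Qed.

Lemma RS_comul h :
  \sw_(a, b <- r) \sw_(x, y <- Δ h) f (a * y) (S b * x)
  = \sw_(a, b <- r) \sw_(x, y <- Δ h) f (x * a) (y * S b).
Proof.
case: (bf) => f1 f2; case: Rr => ur Rh _ _.
have e : r^-1 * tflip (Δ h) = Δ h * r^-1.
  by apply: (mulrI ur); rewrite mulrA divrr // mul1r mulrA Rh mulrK.
transitivity (tlift f (r^-1 * tflip (Δ h))).
  rewrite tlM // R_inv tl_tens; last by multilin.
  by apply: eq_tl => a b; rewrite tl_tens //; multilin.
rewrite e tlM // tlC R_inv tl_tens //.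
by multilin.
Qed.
End Inverse.

(** The left adjoint action of h on v. *)
Definition ad h v : H := \sw_(a, b <- Δ h) (a * v * S b).

Lemma ad_bilinear : is_bilinear ad. Proof. by rewrite /ad; multilin. Qed.

Lemma adM h x v : ad (h * x) v = ad h (ad x v).
Proof.
rewrite {1}/ad swM; last by multilin.
apply: eq_tl => a b; rewrite /ad.
rewrite (@lin_tl k _ _ _ _ (fun t : H => a * t * S b)); last by lins.
by apply: eq_tl => c e; rewrite SM !mulrA.
Qed.

Lemma ad_tracial (p : dual_space H) h v : tracial p -> p (ad h v) = counit h * p v.
Proof.
move=> pC; rewrite /ad (@lin_tl k _ _ _ _ p); last by lins.
transitivity (\sw_(a, b <- Δ h) (p (S b * a * v) : k^o)).
  by apply: (@eq_tl k H H k^o) => a b; rewrite pC mulrA.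
by rewrite (@swTl k H SS k^o (fun x => p (x * v))) ?mul1r //; lins.
Qed.

(** H is a Yetter-Drinfeld module under its adjoint action and its coproduct. *)
Lemma comul_ad (W : lmodType k) (f : H -> H -> W) h v : is_bilinear f ->
  \sw_(a, b <- Δ (ad h v)) f a b = \sw_(x, y <- Δ h) \sw_(y1, y2 <- Δ y)
    \sw_(v1, v2 <- Δ v) f (x * v1 * S y2) (ad y1 v2).
Proof.
move=> [f1 f2]; have lf : lin (fun t : H => \sw_(a, b <- Δ t) f a b) by lins.
rewrite {1}/ad (lin_tl _ _ lf).
transitivity (\sw_(x, y <- Δ h) \sw_(x1, x2 <- Δ x) \sw_(y1, y2 <- Δ y)
  \sw_(v1, v2 <- Δ v) f (x1 * v1 * S y2) (x2 * v2 * S y1)).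
  apply: eq_tl => x y; rewrite -mulrA swM; last by multilin.
  apply: eq_tl => x1 x2; rewrite swM; last by multilin.
  rewrite tlC swS; last by multilin.
  by apply: eq_tl => y1 y2; apply: eq_tl => v1 v2; rewrite !mulrA.
rewrite (@coassoc k H W (fun x1 x2 y => \sw_(y1, y2 <- Δ y)
  \sw_(v1, v2 <- Δ v) f (x1 * v1 * S y2) (x2 * v2 * S y1))); last by multilin.
apply: eq_tl => x y.
rewrite -(@coassoc k H W (fun x2 y1 y2 => \sw_(v1, v2 <- Δ v)
   f (x * v1 * S y2) (x2 * v2 * S y1))); last by multilin.
apply: eq_tl => y1 y2; rewrite tlC; apply: eq_tl => v1 v2; rewrite /ad.
by rewrite (lin_tl _ _ (f2 _)).
Qed.

(** Splitting the action of y into its two factors makes a second copy of R.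
    One copy exchanges the legs of v by R Δ = Δᵒᵖ R; p is tracial, so the two
    copies can then be brought together, and they cancel by S. *)
Lemma braid_trace (p : dual_space H) v : tracial p ->
  \sw_(a, b <- Δ v) \sw_(x, y <- r) (p (x * a) : k) *: ad y b
  = \sw_(a, b <- Δ v) (p b : k) *: a.
Proof.
move=> pC.
transitivity (\sw_(a, b <- Δ v) \sw_(x, y <- r) \sw_(c, e <- r)
  (p (x * c * a) : k) *: (e * b * S y)).
  apply: eq_tl => a b.
  rewrite -(@R_id_comul _ (fun x y1 y2 => (p (x * a) : k) *: (y1 * b * S y2))); last by multilin.
  apply: eq_tl => x y; rewrite /ad.
  by rewrite (@lin_tl k _ _ _ _ (fun t : H => (p (x * a) : k) *: t)) //; lins.
transitivity (\sw_(x, y <- r) \sw_(c, e <- r) \sw_(a, b <- Δ v)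
  (p (x * (b * c)) : k) *: (a * e * S y)).
  rewrite tlC; apply: eq_tl => x y; rewrite tlC.
  rewrite -(@R_comul k H r Rr H (fun s t => (p (x * s) : k) *: (t * S y))); last by multilin.
  by apply: eq_tl => c e; apply: eq_tl => a b; rewrite mulrA.
transitivity (\sw_(a, b <- Δ v) \sw_(c, e <- r) \sw_(x, y <- r)
  (p (b * (c * x)) : k) *: (a * (e * S y))).
  rewrite tlC; under eq_tl => c e do rewrite tlC.
  rewrite tlC; apply: eq_tl => a b; apply: eq_tl => c e; apply: eq_tl => x y.
  by rewrite pC -!mulrA.
apply: eq_tl => a b.
by rewrite (@R_RS _ (fun s t => (p (b * s) : k) *: (a * t))) ?mulr1 //; multilin.
Qed.
End UniversalR.

(** * Three commuting families of operators on H ⊗ H *)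

Section MoreTl.
Variable k : fieldType.
Lemma tlC3 (A1 B1 A2 B2 A3 B3 : vectType k) (W : lmodType k)
  (E : A1 -> B1 -> A2 -> B2 -> A3 -> B3 -> W) s1 s2 s3 :
  \sw_(a, b <- s1) \sw_(c, d <- s2) \sw_(e, f <- s3) E a b c d e f
  = \sw_(e, f <- s3) \sw_(a, b <- s1) \sw_(c, d <- s2) E a b c d e f.
Proof. by rewrite [RHS]tlC; apply: eq_tl => a b; rewrite tlC. Qed.
Lemma tlC4 (A1 B1 A2 B2 A3 B3 A4 B4 : vectType k) (W : lmodType k)
  (E : A1 -> B1 -> A2 -> B2 -> A3 -> B3 -> A4 -> B4 -> W) s1 s2 s3 s4 :
  \sw_(a, b <- s1) \sw_(c, d <- s2) \sw_(e, f <- s3) \sw_(g, h <- s4) E a b c d e f g h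
  = \sw_(g, h <- s4) \sw_(a, b <- s1) \sw_(c, d <- s2) \sw_(e, f <- s3) E a b c d e f g h.
Proof. by rewrite [RHS]tlC; apply: eq_tl => a b; rewrite tlC3. Qed.

Lemma scale_tl (A B : vectType k) (W : lmodType k) (E : A -> B -> W) (c : k) t :
  c *: tlift E t = \sw_(a, b <- t) c *: E a b.
Proof. by apply: (@lin_tl k A B W W (fun x => c *: x)); lins. Qed.

(** The right-hand side is the trace of the partial trace over the first
    factor. *)
Lemma trL_tensor (A : vectType k) (G : tensor A A -> tensor A A) : lin G ->
  trL G = trL (fun v : A => \sum_(i < \dim {:A})
    \sw_(a, b <- G ((vbasis fullv)`_i ⊗ v)) (coord (vbasis (fullv : {vspace A})) i a *: b)).
Proof.
move=> lG; set B := vbasis _.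
rewrite (@trL_rank1 k _ _ G (fun p t => fun_of_matrix t p.1 p.2) (fun p => G (B`_p.1 ⊗ B`_p.2))).
- rewrite /trL; under [RHS]eq_bigr => j _ do rewrite linear_sum.
  rewrite exchange_big pair_bigA /=; apply: eq_bigr => [[i j]] _ /=.
  have lc (l : 'I_(\dim {:A})) : lin (coord B l : A -> k^o) by move=> a x y; rewrite linearP.
  rewrite (@lin_tl k _ _ _ _ (coord B j : A -> k^o)) // tl_pair (bigD1 (i, j)) //= big1 ?addr0.
    by rewrite linearZ /= !coord_free ?(basis_free (vbasisP _)) // !eqxx mul1r; exact/esym/mulr1.
  move=> [i' j'] /= ne; rewrite linearZ /= !coord_free ?(basis_free (vbasisP _)) //.
  case: eqP => [ei|_]; last by rewrite mul0r; exact: mulr0.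
  case: eqP => [ej|_]; last by rewrite mulr0; exact: mulr0.
  by move: ne; rewrite ei ej eqxx.
- by move=> p a x y; rewrite !mxE.
move=> t; rewrite -{1}(tl_id t) (lin_tl _ _ lG) tl_pair.
by [].
Qed.
End MoreTl.

Section Braiding.
Variables (k : closedFieldType) (H : hopfAlgType k).
Hypothesis SS : forall x : H, S (S x) = x.
Variables (r : tensor H H) (Rr : is_universal_R r).
Implicit Types (h v w x y : H) (p q f : dual_space H).
Local Notation HH := (tensor H H).
Local Notation ad := (@ad k H).

(** In Δ(h·v) = Σ h₁ v₁ S(h₃) ⊗ h₂·v₂ the functional f only sees h through an
    adjoint action, under which tracial functionals are invariant. *)
Lemma rhit_ad f h v : tracial f -> rhit f (ad h v) = ad h (rhit f v).
Proof.
move=> fC; rewrite /rhit comul_ad; last by multilin.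
transitivity (\sw_(x, y <- Δ h) \sw_(v1, v2 <- Δ v) (f v2 : k) *: (x * v1 * S y)).
  apply: eq_tl => x y.
  transitivity (\sw_(y1, y2 <- Δ y) (counit y1 : k) *:
      (\sw_(v1, v2 <- Δ v) (f v2 : k) *: (x * v1 * S y2))).
    apply: eq_tl => y1 y2; rewrite scale_tl; apply: eq_tl => v1 v2.
    by rewrite (ad_tracial SS _ _ fC) scalerA.
  by rewrite (@swcounitl k H H (fun y => \sw_(v1, v2 <- Δ v) (f v2 : k) *: (x * v1 * S y))) //; lins.
rewrite /ad; apply: eq_tl => x y.
rewrite (@lin_tl k _ _ _ _ (fun t : H => x * t * S y)); last by lins.
by apply: eq_tl => v1 v2; rewrite -scalerAr -scalerAl.
Qed.

(** The operator attached to p by the braiding of H with its adjoint module. It is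
    multiplicative in p, [theta_conv], because (Δ ⊗ id)(R) = R₁₃ R₂₃. *)
Definition theta p w v : HH :=
  \sw_(x, y <- r) \sw_(w1, w2 <- Δ w) (p (x * w2) : k) *: (w1 ⊗ ad y v).
Definition rho2 f w v : HH := w ⊗ rhit f v.

(** The operator attached to q by the coaction w ⊗ v ↦ (w₁ ⊗ v₂) ⊗ S(v₁) w₂ of H on
    H ⊗ H; it is multiplicative in q, [rho1_conv], by coassociativity of the
    coaction. *)
Definition rho1 q w v : HH :=
  \sw_(v1, v2 <- Δ v) \sw_(w1, w2 <- Δ w) (q (S v1 * w2) : k) *: (w1 ⊗ v2).

Lemma ad_lin1 v : lin (fun h => ad h v). Proof. exact: (ad_bilinear H).1. Qed.
Lemma ad_lin2 h : lin (ad h). Proof. exact: (ad_bilinear H).2. Qed.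
Hint Resolve ad_lin1 ad_lin2 rhit_lin : core.

Lemma theta_bil p : is_bilinear (theta p).
Proof. have a1 := ad_lin1; have a2 := ad_lin2; rewrite /theta; multilin. Qed.
Lemma rho2_bil f : is_bilinear (rho2 f).
Proof. have a := @rhit_lin k H; rewrite /rho2; multilin. Qed.
Lemma rho1_bil q : is_bilinear (rho1 q).
Proof. rewrite /rho1; multilin. Qed.

Lemma theta_conv p q w v : tlift (theta p) (theta q w v) = theta (p ∗ q) w v.
Proof.
have a1 := ad_lin1; have a2 := ad_lin2; have tb := theta_bil p.
transitivity (\sw_(x, y <- r) \sw_(w1, w2 <- Δ w) (q (x * w2) : k) *: theta p w1 (ad y v)).
  rewrite {2}/theta (@lin_tl k _ _ _ _ (tlift (theta p))); last exact: tlift_is_linear.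
  apply: eq_tl => x y; rewrite (@lin_tl k _ _ _ _ (tlift (theta p))); last exact: tlift_is_linear.
  by apply: eq_tl => w1 w2; rewrite linearZ /= tliftE.
transitivity (\sw_(x, y <- r) \sw_(a, b <- r) \sw_(w1, z <- Δ w) \sw_(z1, z2 <- Δ z)
   (p (a * z1) * q (x * z2) : k) *: (w1 ⊗ ad (b * y) v)).
  apply: eq_tl => x y.
  transitivity (\sw_(a, b <- r) \sw_(w1, w2 <- Δ w) \sw_(u1, u2 <- Δ w1)
     (p (a * u2) * q (x * w2) : k) *: (u1 ⊗ ad b (ad y v))).
    rewrite tlC; apply: eq_tl => w1 w2; rewrite /theta scale_tl; apply: eq_tl => a b.
    by rewrite scale_tl; apply: eq_tl => u1 u2; rewrite scalerA mulrC.
  apply: eq_tl => a b.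
  rewrite (@coassoc k H HH (fun u1 u2 w2 => (p (a * u2) * q (x * w2) : k) *: (u1 ⊗ ad b (ad y v)))); last by multilin.
  by apply: eq_tl => w1 z; apply: eq_tl => z1 z2; rewrite adM.
rewrite /theta.
transitivity (\sw_(x, y <- r) \sw_(x1, x2 <- Δ x) \sw_(w1, z <- Δ w) \sw_(z1, z2 <- Δ z)
   (p (x1 * z1) * q (x2 * z2) : k) *: (w1 ⊗ ad y v)).
  refine (etrans _ (esym (@R_comul_id k H r Rr HH (fun x1 x2 y =>
   \sw_(w1, z <- Δ w) \sw_(z1, z2 <- Δ z)
   (p (x1 * z1) * q (x2 * z2) : k) *: (w1 ⊗ ad y v)) _))); last by multilin.
  exact: tlC.
apply: eq_tl => x y; rewrite tlC; apply: eq_tl => w1 z; rewrite convE.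
rewrite (@swM k H k^o (fun a b => p a * q b)); last by multilin.
rewrite (@lin_tl k _ _ _ _ (fun c : k^o => (c : k) *: (w1 ⊗ ad y v))); last by lins.
apply: eq_tl => x1 x2.
by rewrite (@lin_tl k _ _ _ _ (fun c : k^o => (c : k) *: (w1 ⊗ ad y v))); last by lins.
Qed.

Lemma rho2_conv p q w v : tlift (rho2 p) (rho2 q w v) = rho2 (p ∗ q) w v.
Proof.
by have b := rho2_bil p; rewrite {2}/rho2 tliftE // /rho2 rhit_conv.
Qed.

Lemma rho1_conv p q w v : tlift (rho1 p) (rho1 q w v) = rho1 (p ∗ q) w v.
Proof.
have tb := rho1_bil p.
transitivity (\sw_(v1, v2 <- Δ v) \sw_(w1, w2 <- Δ w) (q (S v1 * w2) : k) *: rho1 p w1 v2).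
  rewrite {2}/rho1 (@lin_tl k _ _ _ _ (tlift (rho1 p))); last exact: tlift_is_linear.
  apply: eq_tl => x y; rewrite (@lin_tl k _ _ _ _ (tlift (rho1 p))); last exact: tlift_is_linear.
  by apply: eq_tl => w1 w2; rewrite linearZ /= tliftE.
transitivity (\sw_(a, z <- Δ v) \sw_(b, v2 <- Δ z) \sw_(u, e <- Δ w) \sw_(w1, c <- Δ u)
   (p (S b * c) * q (S a * e) : k) *: (w1 ⊗ v2)).
  apply: eq_tl => a z; rewrite tlC; apply: eq_tl => u e.
  rewrite /rho1 scale_tl; apply: eq_tl => b v2.
  by rewrite scale_tl; apply: eq_tl => w1 c; rewrite scalerA mulrC.
refine (etrans (esym (@coassoc k H HH (fun a b v2 => \sw_(u, e <- Δ w) \sw_(w1, c <- Δ u)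
   (p (S b * c) * q (S a * e) : k) *: (w1 ⊗ v2)) v _)) _); first by multilin.
rewrite /rho1; apply: eq_tl => v1 v2.
under eq_tl => a b do rewrite (@coassoc k H HH (fun w1 c e =>
   (p (S b * c) * q (S a * e) : k) *: (w1 ⊗ v2)) w (ltac:(multilin))).
rewrite tlC; apply: eq_tl => w1 w2; rewrite convE.
rewrite (@swM k H k^o (fun a b => p a * q b)); last by multilin.
rewrite (@swS k H k^o (fun a b => \sw_(c, d <- Δ w2) (p (a * c) * q (b * d) : k^o))); last by multilin.
rewrite (@lin_tl k _ _ _ _ (fun c : k^o => (c : k) *: (w1 ⊗ v2))); last by lins.
apply: eq_tl => x1 x2.
by rewrite (@lin_tl k _ _ _ _ (fun c : k^o => (c : k) *: (w1 ⊗ v2))); last by lins.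
Qed.

Lemma theta_rho2 p f w v : tracial f ->
  tlift (theta p) (rho2 f w v) = tlift (rho2 f) (theta p w v).
Proof.
move=> fC; have tb := theta_bil p; have rb := rho2_bil f.
rewrite {1}/rho2 tliftE // /theta.
rewrite (@lin_tl k _ _ _ _ (tlift (rho2 f))); last exact: tlift_is_linear.
apply: eq_tl => x y; rewrite (@lin_tl k _ _ _ _ (tlift (rho2 f))); last exact: tlift_is_linear.
by apply: eq_tl => w1 w2; rewrite linearZ /= tliftE // /rho2 rhit_ad.
Qed.

Lemma rho1_rho2 q f w v : tlift (rho1 q) (rho2 f w v) = tlift (rho2 f) (rho1 q w v).
Proof.
have tb := rho1_bil q; have rb := rho2_bil f; have rl := @rhit_lin k H.
rewrite {1}/rho2 tliftE // {2}/rho1.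
rewrite (@lin_tl k _ _ _ _ (tlift (rho2 f))); last exact: tlift_is_linear.
rewrite /rhit [LHS](@lin_tl k _ _ _ _ (rho1 q w)); last exact: tb.2.
transitivity (\sw_(a, b <- Δ v) \sw_(v1, v2 <- Δ a) \sw_(w1, w2 <- Δ w)
   (q (S v1 * w2) * f b : k) *: (w1 ⊗ v2)).
  apply: eq_tl => a b; rewrite (@linZ k _ _ (rho1 q w)); last exact: tb.2.
  rewrite /rho1 scale_tl; apply: eq_tl => v1 v2; rewrite scale_tl; apply: eq_tl => w1 w2.
  by rewrite scalerA mulrC.
rewrite (@coassoc k H HH (fun v1 v2 b => \sw_(w1, w2 <- Δ w)
   (q (S v1 * w2) * f b : k) *: (w1 ⊗ v2))); last by multilin.
apply: eq_tl => v1 v2; rewrite (@lin_tl k _ _ _ _ (tlift (rho2 f))); last exact: tlift_is_linear.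
rewrite tlC; apply: eq_tl => w1 w2; rewrite linearZ /= tliftE // /rho2 /rhit.
rewrite (@lin_tl k _ _ _ _ (fun t : H => w1 ⊗ t)); last by lins.
rewrite scale_tl; apply: eq_tl => a b.
by rewrite (@linZ k _ _ (fun t : H => w1 ⊗ t)) ?scalerA //; lins.
Qed.

Lemma theta_rho1E p q w v : tlift (theta p) (rho1 q w v) =
  \sw_(v1, v2 <- Δ v) \sw_(u1, z <- Δ w) \sw_(x, y <- r) \sw_(u2, w2 <- Δ z)
   (p (x * u2) * q (S v1 * w2) : k) *: (u1 ⊗ ad y v2).
Proof.
have tb := theta_bil p; have rb := rho1_bil q; have a1 := ad_lin1; have a2 := ad_lin2.
rewrite {1}/rho1 (@lin_tl k _ _ _ _ (tlift (theta p))); last exact: tlift_is_linear.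
apply: eq_tl => v1 v2; rewrite (@lin_tl k _ _ _ _ (tlift (theta p))); last exact: tlift_is_linear.
transitivity (\sw_(w1, w2 <- Δ w) \sw_(u1, u2 <- Δ w1) \sw_(x, y <- r)
   (p (x * u2) * q (S v1 * w2) : k) *: (u1 ⊗ ad y v2)).
  apply: eq_tl => w1 w2; rewrite linearZ /= tliftE // /theta tlC.
  rewrite scale_tl; apply: eq_tl => u1 u2; rewrite scale_tl; apply: eq_tl => x y.
  by rewrite scalerA mulrC.
refine (etrans (@coassoc k H HH (fun u1 u2 w2 => \sw_(x, y <- r)
   (p (x * u2) * q (S v1 * w2) : k) *: (u1 ⊗ ad y v2)) w _) _); first by multilin.
by apply: eq_tl => u1 z; rewrite tlC.
Qed.

(** On the right-hand side q meets the coproduct of an adjoint action, which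
    splits the second leg of R in three; (id ⊗ Δ)(R) = R₁₃ R₁₂ replaces this by
    three copies of R. The copies that reach q are moved by R Δ = Δᵒᵖ R and by
    the traciality of p and q until they are adjacent, and they are then inverse
    to each other. *)
Lemma theta_rho1 p q w v : tracial p -> tracial q ->
  tlift (theta p) (rho1 q w v) = tlift (rho1 q) (theta p w v).
Proof.
move=> pC qC; have tb := theta_bil p; have rb := rho1_bil q.
have a1 := ad_lin1; have a2 := ad_lin2.
rewrite theta_rho1E.
(* the summand, as a function of the first leg x of R and of the three legs y', y1, y2
   into which the second one gets split *)
pose K x y' y1 y2 : HH := \sw_(v1, v2 <- Δ v) \sw_(u1, z <- Δ w) \sw_(u2, w2 <- Δ z)
  (p (x * w2) * q (y2 * S v1 * S y' * u2) : k) *: (u1 ⊗ ad y1 v2).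
have K1 y' y1 y2 : lin (fun x => K x y' y1 y2) by rewrite /K; lins.
have K2 x y1 y2 : lin (fun y' => K x y' y1 y2) by rewrite /K; lins.
have K3 x y' y2 : lin (fun y1 => K x y' y1 y2) by rewrite /K; lins.
have K4 x y' y1 : lin (fun y2 => K x y' y1 y2) by rewrite /K; lins.
have KE x y' y1 y2 : K x y' y1 y2 = \sw_(v1, v2 <- Δ v) \sw_(u1, z <- Δ w) \sw_(u2, w2 <- Δ z)
  (p (x * w2) * q (y2 * S v1 * S y' * u2) : k) *: (u1 ⊗ ad y1 v2) by [].
clearbody K.
transitivity (\sw_(x, y <- r) \sw_(y', y'' <- Δ y) \sw_(y1, y2 <- Δ y'') K x y' y1 y2); last first.
  rewrite /theta (@lin_tl k _ _ _ _ (tlift (rho1 q))); last exact: tlift_is_linear.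
  apply: eq_tl => x y; rewrite (@lin_tl k _ _ _ _ (tlift (rho1 q))); last exact: tlift_is_linear.
  transitivity (\sw_(w1, w2 <- Δ w) \sw_(y', y'' <- Δ y) \sw_(y1, y2 <- Δ y'')
    \sw_(v1, v2 <- Δ v) \sw_(u1, u2 <- Δ w1)
      (p (x * w2) * q (y2 * S v1 * S y' * u2) : k) *: (u1 ⊗ ad y1 v2)); last first.
    apply: eq_tl => w1 w2; rewrite linearZ /= tliftE // /rho1.
    rewrite (@comul_ad k H HH (fun a b => \sw_(u1, u2 <- Δ w1) (q (S a * u2) : k) *: (u1 ⊗ b))); last by multilin.
    rewrite scale_tl; apply: eq_tl => y' y''; rewrite scale_tl; apply: eq_tl => y1 y2.
    rewrite scale_tl; apply: eq_tl => v1 v2; rewrite scale_tl; apply: eq_tl => u1 u2.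
    by rewrite scalerA !SM SS !mulrA.
  rewrite [RHS]tlC; apply: eq_tl => y' y''; rewrite [RHS]tlC; apply: eq_tl => y1 y2.
  rewrite [RHS]tlC KE; apply: eq_tl => v1 v2.
  refine (esym (@coassoc k H HH (fun u1 u2 w2 =>
    (p (x * w2) * q (y2 * S v1 * S y' * u2) : k) *: (u1 ⊗ ad y1 v2)) w _)).
  by multilin.
transitivity (\sw_(c, d <- r) \sw_(a, b <- r) \sw_(x, y <- r) K (a * x * c) d y b); last first.
  refine (esym (etrans (@R_id_comul k H r Rr HH (fun x y' y'' => \sw_(y1, y2 <- Δ y'') K x y' y1 y2) _) _)).
    by multilin.
  rewrite tlC; apply: eq_tl => c d.
  apply: (@R_id_comul k H r Rr HH (fun x y1 y2 => K (x * c) d y1 y2)).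
  split=> [y1 y2|]; last by split=> [x y2|x y1].
  by apply: (@lin_comp k H H HH (fun x => K x d y1 y2) (fun x => x * c)); lins.
transitivity (\sw_(c, d <- r) \sw_(a, b <- r) \sw_(x, y <- r)
  \sw_(v1, v2 <- Δ v) \sw_(u1, z <- Δ w) \sw_(u2, w2 <- Δ z)
  (p (a * x * c * w2) * q (b * S v1 * S d * u2) : k) *: (u1 ⊗ ad y v2)); last first.
  by apply: eq_tl => c d; apply: eq_tl => a b; apply: eq_tl => x y; rewrite KE.
transitivity (\sw_(v1, v2 <- Δ v) \sw_(u1, z <- Δ w) \sw_(x, y <- r)
  \sw_(a, b <- r) \sw_(c, d <- r) \sw_(u2, w2 <- Δ z)
  (p (a * x * c * w2) * q (b * S v1 * S d * u2) : k) *: (u1 ⊗ ad y v2)); last first.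
  rewrite [RHS]tlC4; apply: eq_tl => v1 v2; rewrite [RHS]tlC4; apply: eq_tl => u1 z.
  rewrite [RHS]tlC3; apply: eq_tl => x y; exact: tlC.
apply: eq_tl => v1 v2; apply: eq_tl => u1 z; apply: eq_tl => x y.
transitivity (\sw_(a, b <- r) \sw_(c, d <- r) \sw_(u2, w2 <- Δ z)
  (p (a * x * (u2 * c)) * q (b * S v1 * (w2 * S d)) : k) *: (u1 ⊗ ad y v2)); last first.
  apply: eq_tl => a b.
  refine (esym (etrans _ (@RS_comul k H SS r Rr HH (fun s t =>
    (p (a * x * s) * q (b * S v1 * t) : k) *: (u1 ⊗ ad y v2)) _ z))); last by multilin.
  by apply: eq_tl => c d; apply: eq_tl => u2 w2; rewrite !mulrA.
rewrite [RHS]tlC3; apply: eq_tl => u2 w2; rewrite [RHS]tlC.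
refine (esym (etrans _ (etrans (@R_SR k H SS r Rr HH (fun s t =>
   (p (s * x * u2) * q (t * S v1 * w2) : k) *: (u1 ⊗ ad y v2)) _) _))).
- apply: eq_tl => c d; apply: eq_tl => a b.
  have -> : p (c * a * x * u2) = p (a * x * (u2 * c)) by rewrite -!mulrA pC !mulrA.
  have -> // : q (S d * b * S v1 * w2) = q (b * S v1 * (w2 * S d)).
  by rewrite -!mulrA qC !mulrA.
- by multilin.
by rewrite !mul1r.
Qed.
End Braiding.

(** * Structure constants as traces of idempotents *)

Section TraceBraiding.
Variables (k : closedFieldType) (H : hopfAlgType k).
Hypothesis SS : forall x : H, S (S x) = x.
Variables (r : tensor H H) (Rr : is_universal_R r).
Variables (L : H) (intL : idempotent_integral L).
Hypothesis l1 : lam H 1 != 0.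
Variables p q f : dual_space H.
Hypotheses (pC : tracial p) (qC : tracial q) (fC : tracial f).
Hypotheses (pp : p ∗ p = p) (qq : q ∗ q = q) (ff : f ∗ f = f).
Local Notation HH := (tensor H H).

Let Th (t : HH) : HH := tlift (theta r p) t.
Let R1 (t : HH) : HH := tlift (rho1 q) t.
Let R2 (t : HH) : HH := tlift (rho2 f) t.

(** An idempotent, as the product of three commuting ones. *)
Definition braid_proj (t : HH) : HH := Th (R1 (R2 t)).
Local Notation G := braid_proj.

Let tlE (g g' : H -> H -> HH) t : tlift g (tlift g' t) = tlift (fun w v => tlift g (g' w v)) t.
Proof. by rewrite (@lin_tl k _ _ _ _ (tlift g)) //; exact: tlift_is_linear. Qed.

Lemma braid_proj_lin : lin G.
Proof.
by move=> a x y; rewrite /G /R2 (tlift_is_linear (rho2 f)) /R1 (tlift_is_linear (rho1 q)) /Th (tlift_is_linear (theta r p)).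
Qed.

Lemma braid_proj_idem t : G (G t) = G t.
Proof.
have TT s : Th (Th s) = Th s.
  by rewrite /Th tlE; apply: eq_tl => w v; rewrite (theta_conv Rr) pp.
have RR1 s : R1 (R1 s) = R1 s.
  by rewrite /R1 tlE; apply: eq_tl => w v; rewrite rho1_conv qq.
have RR2 s : R2 (R2 s) = R2 s.
  by rewrite /R2 tlE; apply: eq_tl => w v; rewrite rho2_conv ff.
have T1 s : Th (R1 s) = R1 (Th s).
  by rewrite /Th /R1 !tlE; apply: eq_tl => w v; rewrite (theta_rho1 SS Rr).
have T2 s : Th (R2 s) = R2 (Th s).
  by rewrite /Th /R2 !tlE; apply: eq_tl => w v; rewrite (theta_rho2 SS).
have R12 s : R1 (R2 s) = R2 (R1 s).
  by rewrite /R1 /R2 !tlE; apply: eq_tl => w v; rewrite rho1_rho2.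
by rewrite /G -T2 -R12 RR2 -T1 RR1 TT.
Qed.

Lemma rhitL_central (s : dual_space H) x : tracial s -> rhit s L * x = x * rhit s L.
Proof.
move=> sC; have -> : rhit s L = L ↼ s.
  by rewrite /rhit (swL_flip SS intL l1) //; multilin.
exact: (hit_central SS intL).
Qed.

(** In the partial trace over the first factor, [braid_trace] eliminates R
    and leaves λ(1) times the operator v ↦ p' ⇀ (f ⇀ v), where p' is p
    multiplied by the central element q ⇀ Λ; its trace is given by
    [trL_rhit]. *)
Lemma trL_braid_proj : trL G = lam H 1 * lam H 1 * p (rhit f L * rhit q L).
Proof.
set m := rhit q L; have a1 := @ad_lin1 k H; have a2 := @ad_lin2 k H.
have mC x : m * x = x * m by apply: rhitL_central.
rewrite (trL_tensor braid_proj_lin); set B := vbasis _.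
pose p' : dual_space H := linfun (fun h => p (h * m) : k^o).
have p'E h : p' h = p (h * m) by rewrite /p' lin_linfunE //; lins.
have p'C : tracial p'.
  by move=> x y; rewrite !p'E -mulrA -mC mulrA pC mulrA.
transitivity (trL (fun v : H => lam H 1 *: rhit p' (rhit f v))); last first.
  transitivity (lam H 1 * trL (fun v : H => rhit (p' ∗ f) v)).
    by rewrite /trL mulr_sumr; apply: eq_bigr => i _; rewrite linearZ /= rhit_conv.
  rewrite (trL_rhit SS intL l1) mulrA; congr (_ * _).
  rewrite convE -p'E (@lin_tl k _ _ _ _ p'); last by lins.
  by apply: (@eq_tl k H H k^o) => a b; rewrite linearZ; exact: mulrC.
apply: (@eq_trL k) => v; set u := rhit f v.
rewrite [rhit p' u]/rhit -(braid_trace SS Rr _ p'C).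
have GE w : G (w ⊗ v) = tlift (theta r p) (rho1 q w u).
  rewrite /G /R2 tliftE; last exact: rho2_bil.
  rewrite /rho2 /R1 tliftE //; exact: rho1_bil.
have lB (i : 'I_(\dim {:H})) : lin (fun t : HH => \sw_(a, b <- t) (coord B i a *: b)).
  exact: tlift_is_linear.
have lc (i : 'I_(\dim {:H})) : lin (coord B i : H -> k^o) by move=> a x y; rewrite linearP.
pose phi x v1 : dual_space H := linfun (fun z => \sw_(u2, w2 <- Δ z) (p (x * u2) * q (S v1 * w2) : k^o)).
have phiE x v1 z : phi x v1 z = \sw_(u2, w2 <- Δ z) (p (x * u2) * q (S v1 * w2) : k^o).
  by rewrite /phi lin_linfunE //; lins.
have phiL x v1 : phi x v1 L = p' (x * v1).
  rewrite phiE -(@swL_l k H L intL k^o (fun a b => p (x * a) * q b)); last by multilin.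
  rewrite p'E /m /rhit (@lin_tl k _ _ _ _ (fun t : H => p (x * v1 * t))); last by lins.
  apply: (@eq_tl k H H k^o) => a b; rewrite SS -scalerAr linearZ mulrA; exact: mulrC.
transitivity (\sum_(i < \dim {:H}) \sw_(v1, v2 <- Δ u) \sw_(x, y <- r)
   (coord B i (rhit (phi x v1) B`_i) : k) *: ad y v2).
  apply: eq_bigr => i _; rewrite GE theta_rho1E (lin_tl _ _ (lB i)).
  apply: eq_tl => v1 v2; rewrite (lin_tl _ _ (lB i)).
  transitivity (\sw_(u1, z <- Δ B`_i) \sw_(x, y <- r) (coord B i u1 * phi x v1 z : k) *: ad y v2).
    apply: eq_tl => u1 z; rewrite (lin_tl _ _ (lB i)); apply: eq_tl => x y.
    rewrite (lin_tl _ _ (lB i)) phiE mulrC -scalerA.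
    rewrite (@lin_tl k _ _ _ _ (fun c : k^o => (c : k) *: (coord B i u1 *: ad y v2))); last by lins.
    apply: eq_tl => u2 w2; rewrite (linZ _ _ (lB i)) tliftE //.
    by have lci := lc i; multilin.
  rewrite tlC; apply: eq_tl => x y; rewrite /rhit.
  rewrite (lin_tl _ _ (lc i)) (@lin_tl k _ _ _ _ (fun c : k^o => (c : k) *: ad y v2)); last by lins.
  apply: eq_tl => u1 z; rewrite (linZ _ _ (lc i)); congr (_ *: _); exact: mulrC.
rewrite tl_sum scale_tl; apply: eq_tl => v1 v2; rewrite tl_sum scale_tl; apply: eq_tl => x y.
by rewrite -scaler_suml -/(trL (rhit (phi x v1))) (trL_rhit SS intL l1) phiL scalerA.
Qed.

Lemma braid_multiplicity : exists N : nat,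
  lam H 1 * lam H 1 * p (rhit f L * rhit q L) = N%:R.
Proof.
exists (\dim (limg (linfun G))).
by rewrite -trL_braid_proj (trL_idem braid_proj_lin braid_proj_idem).
Qed.
End TraceBraiding.

(** * The Markov chain on the conjugacy classes *)

(** The mass outside the state 0 flows into it at a rate of at least c, so it is
    multiplied by at most 1 - c at each step. *)
Lemma absorbing_cvg (R : realType) n (t : 'I_n.+1 -> 'I_n.+1 -> R) (c : R)
    (a : nat -> 'I_n.+1 -> R) :
  0 < c <= 1 -> t ord0 ord0 = 1 -> (forall i, c <= t i ord0) ->
  (forall m i, 0 <= a m i) -> (forall m, \sum_i a m i = 1) ->
  (forall m j, a m.+1 j = \sum_i a m i * t i j) ->
  a m ord0 @[m --> \oo] --> (1 : R).
Proof.
move=> /andP[c0 c1] t00 tc a0 a1 aS.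
have le1 m : a m ord0 <= 1 by rewrite -(a1 m) (bigD1 ord0) //= lerDl sumr_ge0.
have esc m : 1 - a m ord0 <= (1 - c) ^+ m.
  elim: m => [|m IH]; first by rewrite expr0 lerBlDr lerDl.
  have step : a m ord0 + (1 - a m ord0) * c <= a m.+1 ord0.
    rewrite aS (bigD1 ord0) //= t00 mulr1 lerD2l.
    have -> : 1 - a m ord0 = \sum_(i | i != ord0) a m i.
      by rewrite -(a1 m) (bigD1 ord0) //= addrAC subrr add0r.
    by rewrite mulr_suml; apply: ler_sum => i _; apply: ler_wpM2l.
  rewrite exprS; apply: le_trans (_ : (1 - c) * (1 - a m ord0) <= _).
    rewrite lerBlDr; apply: le_trans (lerD (lexx _) step).
    by rewrite mulrBl mul1r [c * _]mulrC addrA addrAC subrK subrK.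
  by apply: ler_wpM2l => //; rewrite subr_ge0.
apply: (@squeeze_cvgr _ _ _ _ (fun m => 1 - (1 - c) ^+ m) (fun=> 1)).
- by near=> m; rewrite le1 andbT lerBlDr -lerBlDl esc.
- rewrite -[X in _ --> X]subr0; apply: cvgB; first exact: cvg_cst.
  apply: cvg_expr; rewrite ger0_norm ?subr_ge0 //.
  by rewrite ltrBlDr ltrDl.
- exact: cvg_cst.
Unshelve. all: by end_near.
Qed.

Section Distributions.
Variables (R : realType) (k : closedFieldType) (chark : [pchar k] =i pred0).
Variable iota : {rmorphism R -> k}.
Variables (H : hopfAlgType k) (ssH : semisimple H).
Variables (r : tensor H H) (Rr : is_universal_R r).
Variables (L : H) (intL : idempotent_integral L).
Variables (n : nat) (chi F : 'I_n.+1 -> dual_space H).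
Hypotheses (hchi : enum_irr chi) (hF : enum_primitive_idempotents chi F).
Hypothesis SS : forall x : H, S (S x) = x.
Local Notation eta i := (normalized_class_sum L (F i)).
Local Notation T := (commutator_op L).

(** F_i ⇀ Λ is F_i(Λ) η_i, and λ(1) F_i(Λ) is the dimension of the i-th
    conjugacy class, so this is [braid_multiplicity] for F_l, F_j and F_i. *)
Lemma structure_constant_nat i j l : exists N : nat,
  (class_dim L F i)%:R * (class_dim L F j)%:R * F l (eta i * eta j) = N%:R.
Proof.
have l1 : lam H 1 != 0 by rewrite (lam1 SS) dim_neq0.
have [N NE] := braid_multiplicity SS Rr intL l1 (F_tracial hchi hF l)
  (F_tracial hchi hF j) (F_tracial hchi hF i) (F_idem hF l) (F_idem hF j)
  (F_idem hF i).
exists N; rewrite -NE.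
have rE a : rhit (F a) L = F a L *: eta a.
  by rewrite (etaE' chark intL hF SS) scalerA mulfV ?scale1r // (FL_neq0 chark intL hF SS).
rewrite !rE (lam1 SS) !(class_dimE chark intL hF SS); move: (eta i) (eta j) => x y.
have -> : F l (F i L *: x * (F j L *: y)) = F i L * F j L * F l (x * y).
  by rewrite -scalerAl -scalerAr scalerA (linZ _ _ (@lin_lfun k _ _ (F l))).
by rewrite mulrACA -!mulrA.
Qed.

Lemma commutator_lin : lin T.
Proof. by rewrite /commutator_op /hcommutator; lins. Qed.

Lemma commutator_eta_central i x : T (eta i) * x = x * T (eta i).
Proof.
rewrite (commutator_eta chark ssH Rr intL hchi hF SS) -mulrA.
have c := eta_central chark intL hchi hF SS.
by rewrite c -mulrA c mulrA.
Qed.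

(** The matrix entries of T are rational, hence in the image of R, and they
    inherit the sign of the structure constants. *)
Lemma transition_exists i j : exists t : R, 0 <= t /\ iota t = F j (T (eta i)).
Proof.
have [N NE] := structure_constant_nat i (star F i) j.
exists (N%:R / ((class_dim L F i)%:R * (class_dim L F (star F i))%:R)).
split; first by rewrite divr_ge0 // mulr_ge0.
have c0 := class_dim_neq0 chark intL hF SS.
rewrite (commutator_eta chark ssH Rr intL hchi hF SS) fmorph_div rmorphM !rmorph_nat -NE.
by rewrite mulrAC mulfV ?mul1r // mulf_neq0.
Qed.

Definition transition i j : R := sval (cid (transition_exists i j)).

Lemma transition_ge0 i j : 0 <= transition i j.
Proof. by rewrite /transition; case: cid => t []. Qed.

Lemma iota_transition i j : iota (transition i j) = F j (T (eta i)).
Proof. by rewrite /transition; case: cid => t []. Qed.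

Lemma commutator_eta_transition i : T (eta i) = \sum_j iota (transition i j) *: eta j.
Proof.
rewrite [LHS](central_eta chark ssH Rr intL hchi hF SS (commutator_eta_central i)).
by apply: eq_bigr => j _; rewrite iota_transition.
Qed.

Lemma transition_sum i : \sum_j transition i j = 1.
Proof.
apply: (fmorph_inj iota); rewrite rmorph_sum rmorph1 /=.
transitivity (counit (T (eta i))).
  rewrite -(sum_F chark ssH Rr hchi hF) sum_lfunE.
  by apply: eq_bigr => j _; rewrite iota_transition.
rewrite (commutator_eta chark ssH Rr intL hchi hF SS) counitM.
by rewrite !(counit_eta chark ssH Rr intL hchi hF SS) mulr1.
Qed.

Lemma transition_return i : transition i ord0 = (class_dim L F i)%:R^-1.
Proof.
apply: (fmorph_inj iota); rewrite iota_transition fmorphV rmorph_nat.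
exact: (F0_commutator_eta chark ssH Rr intL hchi hF SS).
Qed.

Definition step (alpha : {ffun 'I_n.+1 -> R}) : {ffun 'I_n.+1 -> R} :=
  [ffun j => \sum_i alpha i * transition i j].

Lemma step_distribution z alpha :
  is_distribution_of iota L F z alpha -> is_distribution_of iota L F (T z) (step alpha).
Proof.
case=> a0 a1 zE; split.
- by move=> j; rewrite ffunE sumr_ge0 // => i _; rewrite mulr_ge0 ?transition_ge0.
- under eq_bigr do rewrite ffunE.
  rewrite exchange_big -[RHS]a1; apply: eq_bigr => i _.
  by rewrite -mulr_sumr transition_sum mulr1.
rewrite zE (linear_sumZ _ _ commutator_lin).
under eq_bigr do rewrite commutator_eta_transition scaler_sumr.
rewrite exchange_big; apply: eq_bigr => j _.
rewrite ffunE rmorph_sum scaler_suml; apply: eq_bigr => i _.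
by rewrite scalerA rmorphM.
Qed.

Lemma distribution_central z alpha :
  is_distribution_of iota L F z alpha -> central_distribution iota L F z.
Proof.
move=> za; split; last by exists alpha.
case: za => _ _ zE; rewrite memv_cap memvf; apply/centvP => x _.
rewrite zE mulr_suml mulr_sumr; apply: eq_bigr => i _.
by rewrite -scalerAl -scalerAr (eta_central chark intL hchi hF SS).
Qed.

Lemma distribution_unique z alpha beta :
  is_distribution_of iota L F z alpha -> is_distribution_of iota L F z beta ->
  alpha = beta.
Proof.
have cE (c : {ffun 'I_n.+1 -> R}) : is_distribution_of iota L F z c ->
    forall j, F j z = iota (c j).
  case=> _ _ -> j; rewrite linear_sum (bigD1 j) //= big1 => [|i ij].
    by rewrite addr0 linearZ /= (F_eta chark ssH Rr intL hchi hF SS) eqxx; exact: mulr1.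
  by rewrite linearZ /= (F_eta chark ssH Rr intL hchi hF SS) (negPf ij); exact: mulr0.
move=> /cE za /cE zb; apply/ffunP => j; apply: (fmorph_inj iota).
by rewrite -za zb.
Qed.

Lemma prob_oneE z alpha :
  is_distribution_of iota L F z alpha -> prob_one iota L F z = alpha ord0.
Proof.
move=> za; rewrite /prob_one /prob_class.
case: xgetP => [b _ zb|/(_ alpha)//]; by rewrite (distribution_unique zb za).
Qed.

Lemma iterated_distribution z alpha m : is_distribution_of iota L F z alpha ->
  is_distribution_of iota L F (iter m T z) (iter m step alpha).
Proof. by move=> za; elim: m => //= m IH; exact: step_distribution. Qed.

Lemma prob_one_cvg z alpha : is_distribution_of iota L F z alpha ->
  prob_one iota L F (iter m T z) @[m --> \oo] --> (1 : R).
Proof.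
move=> za; have zm m := iterated_distribution m za.
have -> : (fun m => prob_one iota L F (iter m T z)) = (fun m => iter m step alpha ord0).
  by apply/funext => m; exact: prob_oneE.
have c1 i : (0 < class_dim L F i)%N.
  rewrite lt0n; apply/eqP => c0.
  by have := class_dim_neq0 chark intL hF SS i; rewrite c0 mulr0n eqxx.
have d1 := leq_trans (c1 ord0) (class_dim_le _ _ _).
apply: (@absorbing_cvg R n transition (\dim {:H})%:R^-1 (fun m => iter m step alpha)).
- by rewrite invr_gt0 ltr0n d1 invf_le1 ?ltr0n // ler1n.
- by rewrite transition_return (class_dim0 chark intL hchi hF SS) invr1.
- move=> i; rewrite transition_return lef_pV2 ?posrE ?ltr0n ?c1 //.
  by rewrite ler_nat class_dim_le.
- by move=> m; case: (zm m).
- by move=> m; case: (zm m).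
- by move=> m j; rewrite /= ffunE.
Qed.
End Distributions.

Unset Implicit Arguments.
Theorem proposition3p7 (R : realType) (k : closedFieldType)
    (chark : [pchar k] =i pred0) (iota : {rmorphism R -> k})
    (H : hopfAlgType k) (ssH : semisimple H) (qtH : quasitriangular H)
    (L : H) (intL : idempotent_integral L)
    (n : nat) (chi F : 'I_n.+1 -> dual_space H)
    (hchi : enum_irr chi) (hF : enum_primitive_idempotents chi F)
    (z : H) (hz : central_distribution iota L F z) :
  (forall m, central_distribution iota L F (iter m (commutator_op L) z)) /\
  prob_one iota L F (iter m (commutator_op L) z) @[m --> \oo] --> (1 : R).
Proof.
have [r Rr] := qtH.
have SS : forall x : H, S (S x) = x.
  exact: (antipode_involutive chark (iota \o (@ratr R)) ssH Rr intL hchi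
            (F_tracial hchi hF ord0) (F_idem hF ord0) (F0L intL hchi hF)).
have [_ [alpha za]] := hz; split; last exact: (prob_one_cvg chark ssH Rr intL hchi hF SS za).
move=> m; apply: (distribution_central chark intL hchi hF SS).
exact: (iterated_distribution chark ssH Rr intL hchi hF SS m za).
Qed.
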